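(* Let $n\ge 1$, let $\Lambda$ be an $n$-representation-finite algebra and let $q_\Lambda$ be the Euler form of $\Lambda$. (1) For any cluster-indecomposable $\Lambda$-module $X$, the dimension vector $\underline{\dim} X$ is a positive root of $q_\Lambda$. (2) The map $X\mapsto \underline{\dim} X$ gives an injection from the set of isomorphism classes of cluster-indecomposable $\Lambda$-modules to the set of positive roots of $q_\Lambda$.
   Context: Conventions: $K$ is an algebraically closed field. All algebras are basic, indecomposable (connected) and finite dimensional over $K$; modules are finitely generated right modules. $\Lambda=KQ/(R)$ where $Q$ is a finite connected acyclic quiver with vertex set $Q_0=\{1,\dots,l\}$ and $R$ is a set of relations; $e_1,\dots,e_l$ are the corresponding primitive orthogonal idempotents. An algebra $\Lambda$ is $n$-representation-finite if $\mathrm{gl.dim}\,\Lambda\le n$ and there is an $n$-cluster tilting $\Lambda$-module $M$, i.e. $\mathrm{add}\,M=\{X\in\mathrm{mod}\,\Lambda\mid \mathrm{Ext}^i_\Lambda(M,X)=0 \text{ for all } 0<i<n\}=\{X\in\mathrm{mod}\,\Lambda\mid \mathrm{Ext}^i_\Lambda(X,M)=0 \text{ for all } 0<i<n\}$. (For such $\Lambda$, $\mathrm{add}\,M$ is unique.) A $\Lambda$-module is cluster-indecomposable if it is isomorphic to an indecomposable direct summand of $M$. The dimension vector of $X$ is $\underline{\dim}X=(\dim_K Xe_1,\dots,\dim_K Xe_l)\in\mathbb{Z}^l$, regarded as a column vector. The Cartan matrix $C_\Lambda$ is the $l\times l$ matrix whose $(i,j)$ entry is $\dim_K(e_j\Lambda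 e_i)$ (its $j$-th column is the dimension vector of $P_j=e_j\Lambda$). The Euler form is $\langle x,y\rangle=x^t(C_\Lambda^{-1})^t y$ for $x,y\in\mathbb{Z}^l$, and also denotes the quadratic form $q_\Lambda(x)=\langle x,x\rangle$. A root of $q_\Lambda$ is $x\in\mathbb{Z}^l$ with $q_\Lambda(x)=1$; it is positive if all its coordinates are $\ge 0$. *)

(* Defs.v *)
From HB Require Import structures.
From mathcomp Require Import all_boot all_order all_algebra all_field.

Set Implicit Arguments.
Unset Strict Implicit.
Unset Printing Implicit Defensive.

Import Order.TTheory GRing.Theory Num.Theory.
Local Open Scope ring_scope.

(** * Quivers *)

(* The vertex set is ['I_l.+1]: quivers are nonempty, with [l.+1] vertices. *)
Record quiver (l : nat) := Quiver {
  arrow : finType;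
  src : arrow -> 'I_l.+1;
  tgt : arrow -> 'I_l.+1
}.

Section Paths.
Variables (l : nat) (Q : quiver l).

Fixpoint walk (i : 'I_l.+1) (s : seq (arrow Q)) : bool :=
  if s is a :: s' then (src a == i) && walk (tgt a) s' else true.

Definition walk_end (i : 'I_l.+1) (s : seq (arrow Q)) : 'I_l.+1 :=
  last i [seq tgt a | a <- s].

Definition acyclic_quiver : Prop :=
  forall (i : 'I_l.+1) (s : seq (arrow Q)),
    walk i s -> walk_end i s = i -> s = [::].

Definition adjacent : rel 'I_l.+1 := fun i j =>
  [exists a : arrow Q, ((src a == i) && (tgt a == j))
                    || ((src a == j) && (tgt a == i))].

Definition connected_quiver : Prop := forall i j, connect adjacent i j.

Lemma walk_cat i s t : walk i (s ++ t) = walk i s && walk (walk_end i s) t.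
Proof. by elim: s i => //= a s IHs i; rewrite IHs andbA. Qed.

Lemma walk_end_cat i s t : walk_end i (s ++ t) = walk_end (walk_end i s) t.
Proof. by rewrite /walk_end map_cat last_cat. Qed.

Lemma acyclic_walk_size (i : 'I_l.+1) (s : seq (arrow Q)) :
  acyclic_quiver -> walk i s -> (size s <= l)%N.
Proof.
move=> acQ ws.
have no_return j t : walk j t -> j \notin [seq tgt a | a <- t].
  move=> wt; apply/negP => /mapP[b b_t def_j].
  have /(_ _ _ _ b_t) [t1 [t2 def_t]] :
      forall (T : eqType) (x : T) u, x \in u -> exists u1 u2, u = u1 ++ x :: u2.
    by move=> T x u /path.splitPr[u1 u2]; exists u1, u2.
  move: wt; rewrite def_t -cat_rcons walk_cat => /andP[wt1 _].
  suff /(congr1 size) : rcons t1 b = [::] by rewrite size_rcons.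
  by apply: acQ wt1 _; rewrite /walk_end map_rcons last_rcons.
have /card_uniqP eq_card : uniq (i :: [seq tgt a | a <- s]).
  elim: s i ws => // a s IHs i ws.
  have /andP[_ ws'] := ws; rewrite map_cons [uniq (_ :: _)]/=.
  by apply/andP; split; [exact: (no_return i (a :: s)) | exact: IHs ws'].
have := max_card [in i :: [seq tgt a | a <- s]].
by rewrite eq_card card_ord /= size_map ltnS.
Qed.

(* A path is a starting vertex together with a composable word of arrows.
   The bound on the length makes this a finite type; in an acyclic quiver it
   excludes no path, by [acyclic_walk_size]. *)
Definition qpath : predArgType :=
  {p : 'I_l.+1 * l.-bseq (arrow Q) | walk p.1 p.2}.

HB.instance Definition _ := Finite.on qpath.

Definition psrc (p : qpath) : 'I_l.+1 := (val p).1.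
Definition parrows (p : qpath) : seq (arrow Q) := (val p).2.
Definition ptgt (p : qpath) : 'I_l.+1 := walk_end (psrc p) (parrows p).

(* [r] is [p] followed by [q]. *)
Definition pcat (p q r : qpath) : bool :=
  [&& psrc p == psrc r, ptgt p == psrc q & parrows r == parrows p ++ parrows q].

Lemma walk_qpath (p : qpath) : walk (psrc p) (parrows p).
Proof. exact: (valP p). Qed.

Lemma size_parrows (p : qpath) : (size (parrows p) <= l)%N.
Proof. exact: size_bseq. Qed.

Lemma qpath_inj (p q : qpath) :
  psrc p = psrc q -> parrows p = parrows q -> p = q.
Proof.
case: p q => [[i s] ps] [[j t] pt]; rewrite /psrc /parrows /= => eq_ij eq_st.
by apply: val_inj => /=; rewrite eq_ij; congr (_, _); apply: val_inj.
Qed.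

Lemma qpath_ex (i : 'I_l.+1) (s : seq (arrow Q)) :
  walk i s -> (size s <= l)%N -> exists p, psrc p = i /\ parrows p = s.
Proof.
move=> ws les.
by exists (exist (fun p : 'I_l.+1 * l.-bseq (arrow Q) => walk p.1 p.2)
             (i, Bseq les) ws).
Qed.

Lemma pcat_inj p q r r' : pcat p q r -> pcat p q r' -> r = r'.
Proof.
case/and3P=> /eqP sr _ /eqP ar /and3P[/eqP sr' _ /eqP ar'].
by apply: qpath_inj; [rewrite -sr -sr' | rewrite ar ar'].
Qed.

Lemma pcatA p q s r :
  [exists u, pcat p q u && pcat u s r] = [exists u, pcat q s u && pcat p u r].
Proof.
apply/existsP/existsP => -[u /andP[]].
- case/and3P=> /eqP su /eqP tp /eqP au /and3P[/eqP sr /eqP tu /eqP ar].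
  have wr := walk_qpath r; have szr := size_parrows r.
  have eq_r : parrows r = parrows p ++ (parrows q ++ parrows s).
    by rewrite ar au catA.
  have [||v [sv av]] := @qpath_ex (psrc q) (parrows q ++ parrows s).
  + by move: wr; rewrite eq_r walk_cat -sr -su -/(ptgt p) tp => /andP[].
  + by apply: leq_trans szr; rewrite eq_r [in X in (_ <= X)%N]size_cat leq_addl.
  exists v; rewrite /pcat sv av su sr tp eq_r !eqxx /= !andbT.
  by rewrite -tu /ptgt au walk_end_cat -su -/(ptgt p) tp.
- case/and3P=> /eqP su /eqP tq /eqP au /and3P[/eqP sr /eqP tp /eqP ar].
  have wr := walk_qpath r; have szr := size_parrows r.
  have eq_r : parrows r = (parrows p ++ parrows q) ++ parrows s.
    by rewrite ar au catA.
  have [||v [sv av]] := @qpath_ex (psrc p) (parrows p ++ parrows q).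
  + by move: wr; rewrite eq_r walk_cat -sr => /andP[].
  + by apply: leq_trans szr; rewrite eq_r [in X in (_ <= X)%N]size_cat leq_addr.
  have tv : ptgt v = ptgt q.
    by rewrite /ptgt sv av walk_end_cat -/(ptgt p) tp su.
  by exists v; rewrite /pcat tv sv av tp su sr tq eq_r !eqxx.
Qed.

End Paths.

(** * Path algebras *)

(* An element is the family of its coefficients on the basis of paths. *)
Definition path_alg (K : fieldType) (l : nat) (Q : quiver l) : Type :=
  {ffun qpath Q -> K^o}.

Section PathAlgebra.
Variables (K : fieldType) (l : nat) (Q : quiver l).
Local Notation KQ := (path_alg K Q).

HB.instance Definition _ := GRing.Lmodule.on KQ.
HB.instance Definition _ := Vector.on KQ.

Implicit Types (f g h : KQ) (p q r : qpath Q).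

Definition coef f p : K := (f : {ffun qpath Q -> K^o}) p.

Definition pa_vertex (i : 'I_l.+1) : KQ :=
  [ffun p : qpath Q => ((psrc p == i) && (parrows p == [::]))%:R].

Definition pa_one : KQ := [ffun p : qpath Q => (parrows p == [::])%:R].

Definition pa_mul f g : KQ :=
  [ffun r : qpath Q => \sum_p \sum_(q | pcat p q r) coef f p * coef g q].

Lemma coefD f g p : coef (f + g) p = coef f p + coef g p.
Proof. exact: ffunE. Qed.

Lemma coefZ c f p : coef (c *: f) p = c * coef f p.
Proof. exact: ffunE. Qed.

Lemma coefM f g r :
  coef (pa_mul f g) r = \sum_p \sum_q (pcat p q r)%:R * (coef f p * coef g q).
Proof.
rewrite /coef ffunE; apply: eq_bigr => p _; rewrite big_mkcond.
by apply: eq_bigr => q _; case: (pcat p q r); rewrite ?mul1r ?mul0r.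
Qed.

Lemma coef_inj f g : coef f =1 coef g -> f = g.
Proof. by move=> eq_fg; apply/ffunP. Qed.

Lemma pa_mulDl : left_distributive pa_mul +%R.
Proof.
move=> f g h; apply: coef_inj => r; rewrite coefD !coefM -big_split /=.
apply: eq_bigr => p _; rewrite -big_split /=; apply: eq_bigr => q _.
by rewrite coefD mulrDl mulrDr.
Qed.

Lemma pa_mulDr : right_distributive pa_mul +%R.
Proof.
move=> f g h; apply: coef_inj => r; rewrite coefD !coefM -big_split /=.
apply: eq_bigr => p _; rewrite -big_split /=; apply: eq_bigr => q _.
by rewrite coefD !mulrDr.
Qed.

Lemma pa_scaleAl c f g : c *: pa_mul f g = pa_mul (c *: f) g.
Proof.
apply: coef_inj => r; rewrite coefZ !coefM mulr_sumr.
apply: eq_bigr => p _; rewrite mulr_sumr; apply: eq_bigr => q _.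
by rewrite coefZ -mulrA mulrCA.
Qed.

Lemma pa_scaleAr c f g : c *: pa_mul f g = pa_mul f (c *: g).
Proof.
apply: coef_inj => r; rewrite coefZ !coefM mulr_sumr.
apply: eq_bigr => p _; rewrite mulr_sumr; apply: eq_bigr => q _.
by rewrite coefZ mulrCA [c * (_ * _)]mulrCA.
Qed.

Lemma sum_indicator (T : finType) (P : pred T) :
  (forall x y, P x -> P y -> x = y) ->
  \sum_x (P x)%:R = ([exists x, P x])%:R :> K.
Proof.
move=> uniqP; case: existsP => [[x Px]|noP].
  rewrite (bigD1 x) //= Px big1 ?addr0 // => y /negP neq_yx.
  by case Py: (P y) => //; case: neq_yx; rewrite (uniqP y x).
by rewrite big1 // => x _; case Px: (P x) => //; case: noP; exists x.
Qed.

Lemma pa_mulA : associative pa_mul.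
Proof.
move=> f g h; apply: coef_inj => r; rewrite !coefM.
pose F p q s := coef f p * coef g q * coef h s.
transitivity (\sum_p \sum_q \sum_s
    ([exists u, pcat q s u && pcat p u r])%:R * F p q s).
  apply: eq_bigr => p _.
  transitivity (\sum_u \sum_q \sum_s (pcat q s u && pcat p u r)%:R * F p q s).
    apply: eq_bigr => u _; rewrite coefM !mulr_sumr; apply: eq_bigr => q _.
    rewrite !mulr_sumr; apply: eq_bigr => s _.
    rewrite -mulnb natrM /F -!mulrA [RHS]mulrCA; congr (_ * _).
    by rewrite mulrCA.
  rewrite exchange_big /=; apply: eq_bigr => q _.
  rewrite exchange_big /=; apply: eq_bigr => s _.
  rewrite -mulr_suml; congr (_ * _); apply: sum_indicator => u v.
  by move=> /andP[cu _] /andP[cv _]; apply: pcat_inj cu cv.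
transitivity (\sum_p \sum_q \sum_s
    ([exists u, pcat p q u && pcat u s r])%:R * F p q s).
  by do 3!apply: eq_bigr => ? _; rewrite pcatA.
transitivity (\sum_u \sum_s \sum_p \sum_q
    (pcat p q u && pcat u s r)%:R * F p q s); last first.
  apply: eq_bigr => u _; apply: eq_bigr => s _.
  rewrite coefM mulr_suml mulr_sumr.
  apply: eq_bigr => p _; rewrite mulr_suml mulr_sumr; apply: eq_bigr => q _.
  by rewrite -mulnb natrM /F -!mulrA mulrCA.
rewrite [RHS]exchange_big /=.
transitivity (\sum_s \sum_p \sum_q
    ([exists u, pcat p q u && pcat u s r])%:R * F p q s).
  rewrite [RHS]exchange_big /=; apply: eq_bigr => p _.
  by rewrite [RHS]exchange_big.
apply: eq_bigr => s _; rewrite [RHS]exchange_big /=; apply: eq_bigr => p _.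
rewrite [RHS]exchange_big /=; apply: eq_bigr => q _.
rewrite -mulr_suml; congr (_ * _); apply/esym/sum_indicator => u v.
by move=> /andP[cu _] /andP[cv _]; apply: pcat_inj cu cv.
Qed.

Lemma pa_mul1r : left_id pa_one pa_mul.
Proof.
move=> f; apply: coef_inj => r; rewrite coefM.
have [||e [se ae]] := @qpath_ex _ Q (psrc r) [::] => //.
have cerr : pcat e r r by rewrite /pcat /ptgt se ae !eqxx.
rewrite (bigD1 e) //= (bigD1 r) //= cerr {1}/coef ffunE ae eqxx !mul1r.
rewrite big1 => [|q neq_qr].
  rewrite addr0 big1 ?addr0 // => p neq_pe; rewrite big1 // => q _.
  have [cpqr|_] := boolP (pcat p q r); last by rewrite mul0r.
  rewrite {1}/coef ffunE; case: eqP => [ap|]; last by rewrite mul0r mulr0.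
  case/eqP: neq_pe; apply: qpath_inj; last by rewrite ap ae.
  by case/and3P: cpqr => /eqP ->; rewrite se.
have [cerq|_] := boolP (pcat e q r); last by rewrite mul0r.
case/and3P: cerq => _ /eqP te /eqP ar.
case/eqP: neq_qr; apply: qpath_inj; last by rewrite ar ae.
by rewrite -te /ptgt ae se.
Qed.

Lemma pa_mulr1 : right_id pa_one pa_mul.
Proof.
move=> f; apply: coef_inj => r; rewrite coefM.
have [||e [se ae]] := @qpath_ex _ Q (ptgt r) [::] => //.
have crer : pcat r e r by rewrite /pcat se ae cats0 !eqxx.
rewrite (bigD1 r) //= (bigD1 e) //= crer [coef pa_one e]ffunE ae eqxx mulr1.
rewrite mul1r big1 => [|q neq_qe].
  rewrite addr0 big1 ?addr0 // => p neq_pr; rewrite big1 // => q _.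
  have [cpqr|_] := boolP (pcat p q r); last by rewrite mul0r.
  rewrite [coef pa_one q]ffunE; case: eqP => [aq|]; last by rewrite !mulr0.
  case/eqP: neq_pr; case/and3P: cpqr => /eqP sp _ /eqP ar.
  by apply: qpath_inj; rewrite // ar aq cats0.
have [cpqr|_] := boolP (pcat r q r); last by rewrite mul0r.
rewrite [coef pa_one q]ffunE; case: eqP => [aq|]; last by rewrite !mulr0.
case/eqP: neq_qe; apply: qpath_inj; last by rewrite aq ae.
by case/and3P: cpqr => _ /eqP <-.
Qed.

Lemma pa_one_neq0 : pa_one != 0.
Proof.
apply/eqP; have [||e [se ae]] := @qpath_ex _ Q ord0 [::] => //.
move/(congr1 (coef^~ e)); rewrite [LHS]ffunE [RHS]ffunE ae eqxx => /eqP.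
by rewrite oner_eq0.
Qed.

HB.instance Definition _ := GRing.Zmodule_isNzRing.Build KQ
  pa_mulA pa_mul1r pa_mulr1 pa_mulDl pa_mulDr pa_one_neq0.
HB.instance Definition _ := GRing.Lmodule_isLalgebra.Build K KQ pa_scaleAl.
HB.instance Definition _ := GRing.Lalgebra_isAlgebra.Build K KQ pa_scaleAr.

(* A relation is a linear combination of paths of length at least two with the
   same source and the same target. *)
Definition is_relation (r : KQ) : Prop :=
  exists i j, forall p, coef r p != 0 ->
    [/\ psrc p = i, ptgt p = j & (2 <= size (parrows p))%N].

(* Membership in the two-sided ideal [(R)] generated by a set [R]. *)
Definition in_ideal (R : KQ -> Prop) (x : KQ) : Prop :=
  exists (m : nat) (a r b : 'I_m -> KQ),
    (forall k, R (r k)) /\ x = \sum_(k < m) a k * r k * b k.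

End PathAlgebra.

(* [pi] induces an isomorphism from [KQ/(R)] onto [A]. *)
Definition presents (K : fieldType) (l : nat) (Q : quiver l)
    (R : path_alg K Q -> Prop) (A : falgType K)
    (pi : {lrmorphism path_alg K Q -> A}) : Prop :=
  (forall a : A, exists x, pi x = a) /\ (forall x, pi x = 0 <-> in_ideal R x).

(** * Finitely generated right modules *)

(* Over a finite-dimensional algebra, the finitely generated modules are those
   of finite dimension over the base field. *)
Record rmodule (K : fieldType) (A : falgType K) := RModule {
  rm_sort :> vectType K;
  rm_act : rm_sort -> A -> rm_sort;
  rm_actl : forall a, linear (rm_act^~ a);
  rm_actr : forall x, linear (rm_act x);
  rm_act1 : forall x, rm_act x 1 = x;
  rm_actA : forall x a b, rm_act x (a * b) = rm_act (rm_act x a) b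
}.
Arguments rm_act {K A r}.

Section Modules.
Variables (K : fieldType) (A : falgType K).
Implicit Types (X Y Z M N P : rmodule A).

Definition is_hom X Y (f : 'Hom(X, Y)) : Prop :=
  forall x a, f (rm_act x a) = rm_act (f x) a.

Definition rm_iso X Y : Prop :=
  exists f : 'Hom(X, Y), is_hom f /\ bijective f.

Definition rm_zero X : Prop := forall x : X, x = 0.

Section DirectSum.
Variables X Y : rmodule A.
Let act (z : X * Y) (a : A) : X * Y := (rm_act z.1 a, rm_act z.2 a).
Fact rm_sum_actl a : linear (act^~ a).
Proof. by move=> k u v; rewrite /act /= !rm_actl. Qed.
Fact rm_sum_actr z : linear (act z).
Proof. by move=> k u v; rewrite /act /= !rm_actr. Qed.
Fact rm_sum_act1 z : act z 1 = z.
Proof. by rewrite /act !rm_act1; case: z. Qed.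
Fact rm_sum_actA z a b : act z (a * b) = act (act z a) b.
Proof. by rewrite /act !rm_actA. Qed.
Definition rm_sum : rmodule A :=
  RModule rm_sum_actl rm_sum_actr rm_sum_act1 rm_sum_actA.
End DirectSum.

Section Power.
Variables (M : rmodule A) (m : nat).
Let act (z : {ffun 'I_m -> M}) (a : A) : {ffun 'I_m -> M} :=
  [ffun k => rm_act (z k) a].
Fact rm_pow_actl a : linear (act^~ a).
Proof. by move=> k u v; apply/ffunP => i; rewrite !ffunE rm_actl. Qed.
Fact rm_pow_actr z : linear (act z).
Proof. by move=> k u v; apply/ffunP => i; rewrite !ffunE rm_actr. Qed.
Fact rm_pow_act1 z : act z 1 = z.
Proof. by apply/ffunP => i; rewrite !ffunE rm_act1. Qed.
Fact rm_pow_actA z a b : act z (a * b) = act (act z a) b.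
Proof. by apply/ffunP => i; rewrite !ffunE rm_actA. Qed.
Definition rm_pow : rmodule A :=
  RModule rm_pow_actl rm_pow_actr rm_pow_act1 rm_pow_actA.
End Power.

Definition direct_summand X M : Prop := exists X', rm_iso (rm_sum X X') M.

Definition in_add M X : Prop := exists m : nat, direct_summand X (rm_pow M m).

Definition rm_indecomposable X : Prop :=
  ~ rm_zero X /\
  (forall Y Z, rm_iso X (rm_sum Y Z) -> rm_zero Y \/ rm_zero Z).

(** ** Projective resolutions, global dimension, Ext *)

Definition rm_projective P : Prop :=
  forall M N (g : 'Hom(M, N)) (f : 'Hom(P, N)),
    is_hom g -> limg g = fullv -> is_hom f ->
    exists2 h : 'Hom(P, M), is_hom h & (g \o h)%VF = f.

Record proj_resolution X := ProjResolution {
  res_obj :> nat -> rmodule A;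
  res_diff : forall i, 'Hom(res_obj i.+1, res_obj i);
  res_aug : 'Hom(res_obj 0, X);
  res_objP : forall i, rm_projective (res_obj i);
  res_diff_hom : forall i, is_hom (res_diff i);
  res_aug_hom : is_hom res_aug;
  res_aug_surj : limg res_aug = fullv;
  res_exact0 : lker res_aug = limg (res_diff 0);
  res_exactS : forall i, lker (res_diff i) = limg (res_diff i.+1)
}.

Definition pdim_le X (n : nat) : Prop :=
  exists P : proj_resolution X, forall i, (n < i)%N -> rm_zero (P i).

Definition gldim_le (n : nat) : Prop := forall X, pdim_le X n.

Definition cocycle X (P : proj_resolution X) Y i (f : 'Hom(P i, Y)) : Prop :=
  is_hom f /\ (f \o res_diff P i)%VF = 0.

Definition coboundary X (P : proj_resolution X) Y i :
    'Hom(P i, Y) -> Prop :=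
  match i with
  | 0%N => fun f => f = 0
  | j.+1 => fun f =>
      exists2 g : 'Hom(P j, Y), is_hom g & f = (g \o res_diff P j)%VF
  end.

(* [Ext^i(X, Y) = 0]: the complex [Hom(P, Y)] is exact in degree [i], for any
   projective resolution [P] of [X] (the choice of [P] is immaterial). *)
Definition Ext_eq0 (i : nat) X Y : Prop :=
  forall (P : proj_resolution X) (f : 'Hom(P i, Y)),
    cocycle f -> coboundary f.

(** ** n-cluster tilting modules *)

Definition cluster_tilting (n : nat) M : Prop :=
  forall X,
    (in_add M X <-> forall i, (0 < i < n)%N -> Ext_eq0 i M X) /\
    (in_add M X <-> forall i, (0 < i < n)%N -> Ext_eq0 i X M).

Definition n_representation_finite (n : nat) : Prop :=
  gldim_le n /\ exists M, cluster_tilting n M.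

(* [M] is the cluster tilting module; the class does not depend on it, since
   [add M] is unique when [A] is n-representation-finite. *)
Definition cluster_indecomposable M X : Prop :=
  rm_indecomposable X /\ direct_summand X M.

(** ** Dimension vectors and the Euler form *)

Section EulerForm.
Variables (l : nat) (e : 'I_l -> A).

(* [X e_i] is the image of the action of [e_i] on [X]. *)
Definition dimvec X : 'cV[int]_l :=
  \col_i (\dim (limg (linfun (fun x : X => rm_act x (e i)))))%:Z.

Definition Cartan : 'M[int]_l :=
  \matrix_(i, j) (\dim (<[e j]> * {:A} * <[e i]>)%VS)%:Z.

Definition Euler_form (x y : 'cV[int]_l) : int :=
  (x^T *m (invmx Cartan)^T *m y) 0 0.

Definition Euler_quad (x : 'cV[int]_l) : int := Euler_form x x.

Definition positive_root (q : 'cV[int]_l -> int) (x : 'cV[int]_l) : Prop :=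
  q x = 1 /\ forall i, 0 <= x i 0.

End EulerForm.
End Modules.

(* Main.v *)
(* Write [T X = D Ext^n(X, A)]. A projective resolution [P] of [X] exhibits [T X]
   as the kernel of [N P_n -> N P_(n-1)], where [N P = D Hom(P, A)], so that
   [Hom(Y, T X)] is dual to [Ext^n(X, Y)]. For [X], [Y] in [add M] the other
   [Ext] groups vanish, and the Euler form becomes
     <X, Y> = dim Hom(X, Y) + (-1)^n dim Hom(Y, T X).            (1)
   If [X] in [add M] is indecomposable and not projective, then [Hom(X, A) = 0];
   by (1) this gives <y, T X> = (-1)^n <X, y> for all [y], and (1) again gives
   dim Hom(X, Y) = dim Hom(T X, T Y). As [T] is faithful on such modules, it is
   fully faithful, and it preserves [add M], indecomposability and the Euler form.
   The orbits of the injectives [N (e_b A)] stay among the summands of [M], so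
   their dimension vectors are bounded, which forces each of them to end at a
   projective, and every [e_a A] is such an end. Consequently every
   indecomposable [X] in [add M] becomes some [e_a A] after finitely many steps;
   since [End(e_a A) = K] and [T (e_a A) = 0], (1) yields <X, X> = 1. Finally a
   nonprojective [X] never has the dimension vector of a projective, so equal
   dimension vectors can be compared along the orbits down to the projectives. *)

From HB Require Import structures.
From Stdlib Require ClassicalEpsilon Classical_Prop.
Require Import Defs.
From mathcomp Require Import all_boot all_order all_algebra all_field.
From mathcomp Require Import fingroup perm zify ring.

Set Implicit Arguments.
Unset Strict Implicit.
Unset Printing Implicit Defensive.

Import Order.TTheory GRing.Theory Num.Theory.
Local Open Scope ring_scope.

(** Full faithfulness of T is available only at nonprojective modules, and no inverse of T is
    constructed: an orbit is followed forward until it meets a projective, so termination is the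
    crux. For I_b = N (e_b A), unique decomposition of M is avoided. Along the orbit endomorphisms
    stay scalar, so each term is a summand of M itself, not merely of a power. By pigeonhole an
    endless orbit repeats a dimension vector; moved back to the start, this gives dv(T Y) = dv(I_b)
    with Y nonprojective, hence dv(Y) = dv(e_b A) up to sign, which positivity and a map through a
    simple module exclude. For other X, let N exceed all these orbit lengths. If the orbit of X did
    not end, then Hom(e_a A, T^N X), Hom(T^k I_b, T^N X) and Hom(I_b, T^(N-k) X) would have the same
    dimension for suitable b and k; the last space is 0, so T^N X = 0, which is absurd. Faithfulness
    of T is a descent: if T f = 0, the top component of a chain map over f factors through the
    differential; Ext^i(X, A) = 0 moves such a homotopy down to degree 0, where Hom(X, A) = 0 leaves
    f = 0. *)

Section LinearAlgebra.
Variable K : fieldType.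
Implicit Types V W aT rT : vectType K.

Lemma linfun_linear aT rT (f : aT -> rT) : linear f -> linfun f =1 f.
Proof.
move=> lf x; pose fM := GRing.isLinear.Build K aT rT *:%R f lf.
pose fL : {linear aT -> rT} := HB.pack f fM.
exact: (lfunE fL).
Qed.

(** Kernel and image enter through membership criteria, and [f] as a plain function, so that later
    counts apply to subspaces not given literally as [lker] or [limg]. *)
Lemma rank_nullity V W (f : V -> W) (U N : {vspace V}) (I : {vspace W}) :
  linear f -> (forall v, v \in N <-> v \in U /\ f v = 0) ->
  (forall w, w \in I <-> exists2 v, v \in U & f v = w) ->
  (\dim N + \dim I = \dim U)%N.
Proof.
move=> /linfun_linear fE NP IP; rewrite -(limg_ker_dim (linfun f) U).
have -> : N = (U :&: lker (linfun f))%VS.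
  apply/vspaceP=> x; rewrite memv_cap memv_ker fE.
  by apply/idP/andP=> [/NP[? /eqP ?] | [? /eqP ?]]; last apply/NP.
suff -> : I = (linfun f @: U)%VS by [].
apply/vspaceP=> x.
apply/idP/memv_imgP=> [/IP[v vU <-] | [v vU ->]]; first by exists v;
  rewrite ?fE.
by apply/IP; exists v; rewrite ?fE.
Qed.

Lemma ker_ex V W (f : V -> W) (U : {vspace V}) : linear f ->
  exists N : {vspace V}, forall v, v \in N <-> v \in U /\ f v = 0.
Proof.
move=> /linfun_linear fE; exists (U :&: lker (linfun f))%VS => v.
rewrite memv_cap memv_ker fE.
by split=> [/andP[-> /eqP] | [-> /eqP]].
Qed.

Lemma limg_surj aT rT (f : 'Hom(aT, rT)) :
  limg f = fullv <-> forall y, exists x, f x = y.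
Proof.
split=> [ff y|fs].
  have : y \in limg f by rewrite ff memvf.
  by case/memv_imgP=> x _ ->; exists x.
apply/vspaceP=> y; rewrite memvf; have [x <-] := fs y.
by rewrite memv_img ?memvf.
Qed.

(** Exactness of K-duality: a functional on [U] that kills the kernel of [g] on [U] depends only on
    the value of [g]. The witness composes [psi] with a pseudo-inverse of [g] restricted to [U]. *)
Lemma functional_factor V W (U : {vspace V}) (g : 'Hom(V, W))
    (psi : 'Hom(V, K^o)) :
  (forall u, u \in U -> g u = 0 -> psi u = 0) ->
  exists psi' : 'Hom(W, K^o), forall u, u \in U -> psi u = psi' (g u).
Proof.
move=> psi0; pose h := (g \o projv U)%VF.
exists ((psi \o projv U) \o h^-1)%VF => u uU.
have hu : h u = g u by rewrite comp_lfunE projv_id.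
have : h (h^-1%VF (g u)) = g u.
  by rewrite -hu limg_lfunVK // memv_img // memvf.
rewrite !comp_lfunE => hK; apply/eqP; rewrite -subr_eq0; apply/eqP.
rewrite -{1}(projv_id uU) -!linearB; apply: psi0; first exact: memv_proj.
by rewrite !linearB /= hK projv_id // subrr.
Qed.

Lemma dim_dual V : dim 'Hom(V, K^o) = dim V.
Proof. exact: muln1. Qed.

(** Restriction of functionals to [U] is onto the dual of [U], and its kernel is [B]. *)
Lemma dim_annihilator V (U : {vspace V}) (B : {vspace 'Hom(V, K^o)}) :
  (forall psi, psi \in B <-> forall u, u \in U -> psi u = 0) ->
  (\dim B + \dim U = \dim {:V})%N.
Proof.
move=> BP.
pose r (psi : 'Hom(V, K^o)) : 'Hom(subvs_of U, K^o) := (psi \o linfun vsval)%VF.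
have lr : linear r by move=> c f g; rewrite /r comp_lfunDl comp_lfunZl.
have := rank_nullity (U := fullv) (N := B) (I := fullv) lr.
rewrite !dimvf !dim_dual; apply=> [psi | g].
  split=> [/BP p0 | [_ /lfunP p0]].
    split; first exact: memvf.
    by apply/lfunP=> u; rewrite comp_lfunE lfunE /= p0 ?subvsP // zero_lfunE.
  apply/BP=> u uU; have := p0 (Subvs uU).
  by rewrite comp_lfunE lfunE zero_lfunE.
split=> _; rewrite ?memvf //; exists (g \o linfun (vsproj U))%VF;
  rewrite ?memvf //.
by apply/lfunP=> u; rewrite !comp_lfunE !lfunE /= vsvalK.
Qed.

End LinearAlgebra.

(** * Modules *)

Section ModuleBasics.
Variables (K : fieldType) (A : falgType K).
Implicit Types X Y Z M N P : rmodule A.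

Lemma rm_actDl X (x y : X) (a : A) :
  rm_act (x + y) a = rm_act x a + rm_act y a.
Proof. by have := rm_actl a 1 x y; rewrite !scale1r. Qed.

Lemma rm_actDr X (x : X) (a b : A) :
  rm_act x (a + b) = rm_act x a + rm_act x b.
Proof. by have := rm_actr x 1 a b; rewrite !scale1r. Qed.

Lemma rm_act0l X (a : A) : rm_act (0 : X) a = 0.
Proof. by apply: (addrI (rm_act 0 a)); rewrite -rm_actDl !addr0. Qed.

Lemma rm_act0r X (x : X) : rm_act x 0 = 0.
Proof. by apply: (addrI (rm_act x 0)); rewrite -rm_actDr !addr0. Qed.

Lemma rm_actZl X k (x : X) (a : A) : rm_act (k *: x) a = k *: rm_act x a.
Proof. by have := rm_actl a k x 0; rewrite !addr0 rm_act0l addr0. Qed.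

Lemma rm_actZr X k (x : X) (a : A) : rm_act x (k *: a) = k *: rm_act x a.
Proof. by have := rm_actr x k a 0; rewrite !addr0 rm_act0r addr0. Qed.

Lemma rm_act_suml X I (r : seq I) (F : I -> X) (a : A) :
  rm_act (\sum_(i <- r) F i) a = \sum_(i <- r) rm_act (F i) a.
Proof.
by elim/big_rec2: _ => [|i x y _ <-]; rewrite ?rm_act0l // rm_actDl.
Qed.

Lemma rm_act_sumr X I (r : seq I) (x : X) (F : I -> A) :
  rm_act x (\sum_(i <- r) F i) = \sum_(i <- r) rm_act x (F i).
Proof.
by elim/big_rec2: _ => [|i y z _ <-]; rewrite ?rm_act0r // rm_actDr.
Qed.

Section HomSpace.
Variables X Y : rmodule A.

Let defect (f : 'Hom(X, Y)) : 'Hom(X, 'Hom(A, Y)) :=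
  linfun (fun x : X => linfun (fun a : A => f (rm_act x a) - rm_act (f x) a)).

Let defectE f x a : defect f x a = f (rm_act x a) - rm_act (f x) a.
Proof.
have l2 (y : X) : linear (fun a : A => f (rm_act y a) - rm_act (f y) a).
  move=> c u v; rewrite !rm_actr linearP scalerBr opprD; exact: addrACA.
rewrite /defect linfun_linear ?linfun_linear // => c u v.
apply/lfunP=> b; rewrite add_lfunE scale_lfunE !linfun_linear //.
by rewrite rm_actl !linearP rm_actl scalerBr opprD addrACA.
Qed.

Let defect_linear : linear defect.
Proof.
move=> c f g; apply/lfunP=> x; apply/lfunP=> a.
rewrite !(add_lfunE, scale_lfunE) !defectE !(add_lfunE, scale_lfunE).
by rewrite rm_actl scalerBr opprD addrACA.
Qed.

(** Being a homomorphism is the vanishing of [defect f], which is linear in [f]; hence homomorphisms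
    form a subspace and have a dimension. *)
Definition hom_space : {vspace 'Hom(X, Y)} := lker (linfun defect).

Lemma hom_spaceP (f : 'Hom(X, Y)) : f \in hom_space <-> is_hom f.
Proof.
rewrite memv_ker linfun_linear //; split=> [/eqP/lfunP f0 x a | hf].
  have /lfunP/(_ a) := f0 x; rewrite defectE !zero_lfunE => /eqP.
  by rewrite subr_eq0 => /eqP.
apply/eqP/lfunP=> x; apply/lfunP=> a.
by rewrite defectE hf subrr !zero_lfunE.
Qed.

End HomSpace.

Definition hom_dim X Y : nat := \dim (hom_space X Y).

Lemma is_hom0 X Y : is_hom (0 : 'Hom(X, Y)).
Proof. by move=> x a; rewrite !zero_lfunE rm_act0l. Qed.

Lemma is_homD X Y (f g : 'Hom(X, Y)) : is_hom f -> is_hom g -> is_hom (f + g).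
Proof. by move=> /hom_spaceP hf /hom_spaceP hg; apply/hom_spaceP/memvD. Qed.

Lemma is_homB X Y (f g : 'Hom(X, Y)) : is_hom f -> is_hom g -> is_hom (f - g).
Proof. by move=> /hom_spaceP hf /hom_spaceP hg; apply/hom_spaceP/memvB. Qed.

Lemma is_homZ X Y c (f : 'Hom(X, Y)) : is_hom f -> is_hom (c *: f).
Proof. by move=> /hom_spaceP hf; apply/hom_spaceP/memvZ. Qed.

Lemma is_hom_sum X Y I (r : seq I) (F : I -> 'Hom(X, Y)) :
  (forall i, is_hom (F i)) -> is_hom (\sum_(i <- r) F i).
Proof. by move=> hF; elim/big_ind: _ => //;
  [apply: is_hom0|apply: is_homD]. Qed.

Lemma is_hom1 X : is_hom (\1%VF : 'Hom(X, X)).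
Proof. by move=> x a; rewrite !id_lfunE. Qed.

Lemma is_hom_comp X Y Z (g : 'Hom(Y, Z)) (f : 'Hom(X, Y)) :
  is_hom g -> is_hom f -> is_hom (g \o f)%VF.
Proof. by move=> hg hf x a; rewrite !comp_lfunE hf hg. Qed.

Lemma comp_lfun_suml (V1 V2 V3 : vectType K) I (r : seq I)
    (F : I -> 'Hom(V2, V3)) (g : 'Hom(V1, V2)) :
  ((\sum_(i <- r) F i) \o g = \sum_(i <- r) (F i \o g))%VF.
Proof.
by elim/big_rec2: _ => [|i f h _ <-]; rewrite ?comp_lfun0l // comp_lfunDl.
Qed.

Lemma comp_lfun_sumr (V1 V2 V3 : vectType K) I (r : seq I)
    (F : I -> 'Hom(V1, V2)) (g : 'Hom(V2, V3)) :
  (g \o (\sum_(i <- r) F i) = \sum_(i <- r) (g \o F i))%VF.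
Proof.
by elim/big_rec2: _ => [|i f h _ <-]; rewrite ?comp_lfun0r // comp_lfunDr.
Qed.

Section Submodule.
Variables (X : rmodule A) (U : {vspace X}).
Hypothesis stU : forall x a, x \in U -> rm_act x a \in U.

Let act (u : subvs_of U) (a : A) : subvs_of U := Subvs (stU a (subvsP u)).
Fact rm_sub_actl a : linear (act^~ a).
Proof. by move=> k u v; apply: subvs_inj; rewrite /= rm_actl. Qed.
Fact rm_sub_actr u : linear (act u).
Proof. by move=> k a b; apply: subvs_inj; rewrite /= rm_actr. Qed.
Fact rm_sub_act1 u : act u 1 = u.
Proof. by apply: subvs_inj; rewrite /= rm_act1. Qed.
Fact rm_sub_actA u a b : act u (a * b) = act (act u a) b.
Proof. by apply: subvs_inj; rewrite /= rm_actA. Qed.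
Definition rm_sub : rmodule A :=
  RModule rm_sub_actl rm_sub_actr rm_sub_act1 rm_sub_actA.

Definition sub_inj : 'Hom(rm_sub, X) := linfun (vsval : rm_sub -> X).

Lemma sub_injE (u : rm_sub) : sub_inj u = vsval u.
Proof. by rewrite lfunE. Qed.

Lemma sub_inj_inj : injective sub_inj.
Proof. by move=> u v; rewrite !sub_injE => /subvs_inj. Qed.

Lemma sub_inj_mem (u : rm_sub) : sub_inj u \in U.
Proof. by rewrite sub_injE subvsP. Qed.

Lemma sub_inj_hom : is_hom sub_inj.
Proof. by move=> x a; rewrite !sub_injE. Qed.

Lemma sub_inj_onto x : x \in U -> exists u : rm_sub, sub_inj u = x.
Proof. by move=> xU; exists (Subvs xU); rewrite sub_injE. Qed.

Lemma sub_factor Y (f : 'Hom(Y, X)) : is_hom f -> (forall y, f y \in U) ->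
  exists2 g : 'Hom(Y, rm_sub), is_hom g & (sub_inj \o g)%VF = f.
Proof.
move=> hf fU; exists (linfun (vsproj U) \o f : 'Hom(Y, rm_sub))%VF => [y a|].
  apply: subvs_inj; do !rewrite lfunE /=.
  by rewrite hf !vsprojK // ?stU.
by apply/lfunP=> y; rewrite !comp_lfunE sub_injE lfunE /= vsprojK.
Qed.

End Submodule.

Lemma ker_stable X Y (f : 'Hom(X, Y)) : is_hom f ->
  forall x a, x \in lker f -> rm_act x a \in lker f.
Proof. by move=> hf x a; rewrite !memv_ker hf => /eqP->; rewrite rm_act0l. Qed.

Lemma img_stable X Y (f : 'Hom(X, Y)) : is_hom f ->
  forall y a, y \in limg f -> rm_act y a \in limg f.
Proof.
by move=> hf y a /memv_imgP[x _ ->]; rewrite -hf memv_img ?memvf.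
Qed.

(** Projectivity speaks of surjections only; corestricting [f] and [g] to the submodule [limg g]
    reduces to that case. *)
Lemma proj_lift P M N (g : 'Hom(M, N)) (f : 'Hom(P, N)) :
  rm_projective P -> is_hom g -> is_hom f -> (forall x, f x \in limg g) ->
  exists2 h : 'Hom(P, M), is_hom h & (g \o h)%VF = f.
Proof.
move=> pP hg hf fg; have st := img_stable hg.
have [f' hf' def_f] := sub_factor st hf fg.
have gg x : g x \in limg g by rewrite memv_img ?memvf.
have [g' hg' def_g] := sub_factor st hg gg.
have g'surj : limg g' = fullv.
  apply/limg_surj=> y; have /memv_imgP[x _ def_y] := sub_inj_mem y.
  by exists x; apply: (@sub_inj_inj _ _ st); rewrite def_y -comp_lfunE def_g.
have [h hh def_h] := pP _ _ _ _ hg' g'surj hf'.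
exists h => //; transitivity ((sub_inj st \o g') \o h)%VF;
  first by rewrite def_g.
by rewrite -comp_lfunA def_h.
Qed.

Definition rm_reg : rmodule A.
Proof.
apply: (@RModule K A A (fun x a => x * a)).
- by move=> a k x y; rewrite mulrDl scalerAl.
- by move=> x k a b; rewrite mulrDr scalerAr.
- exact: mulr1.
- exact: mulrA.
Defined.

Definition orbit_map Y (y : Y) : 'Hom(rm_reg, Y) :=
  linfun (fun a : rm_reg => rm_act y a).

Lemma orbit_mapE Y (y : Y) a : orbit_map y a = rm_act y a.
Proof. by rewrite linfun_linear //; exact: rm_actr. Qed.

Lemma orbit_map_hom Y (y : Y) : is_hom (orbit_map y).
Proof. by move=> x a; rewrite !orbit_mapE -rm_actA. Qed.

(** The dual basis lemma: a K-basis of [P] gives a surjection from a free module onto [P], which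
    splits. The identity of [P] thus becomes a sum of maps through [A], the form in which
    projectivity enters the study of D Hom(P, A). *)
Lemma proj_dual_basis P : rm_projective P ->
  exists m (p : 'I_m -> P) (f : 'I_m -> 'Hom(P, rm_reg)),
    (forall i, is_hom (f i)) /\ (forall x, x = \sum_i rm_act (p i) (f i x)).
Proof.
move=> pP; pose m := \dim {:P}; pose p (i : 'I_m) : P := (vbasis {:P})`_i.
pose g0 (z : rm_pow rm_reg m) : P := \sum_i rm_act (p i) (z i : A).
have lg0 : linear g0.
  move=> c u v; rewrite /g0 scaler_sumr -big_split /=; apply: eq_bigr => i _.
  by rewrite !ffunE; exact: rm_actr.
pose g : 'Hom(rm_pow rm_reg m, P) := linfun g0.
have gE z : g z = g0 z by exact: linfun_linear.
have hg : is_hom g.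
  move=> z a; rewrite !gE /g0 rm_act_suml; apply: eq_bigr => i _.
  by rewrite ffunE -rm_actA.
have gs : limg g = fullv.
  apply/limg_surj=> x; exists [ffun i => (coord (vbasis {:P}) i x)%:A].
  rewrite gE /g0 [RHS](coord_vbasis (memvf x)); apply: eq_bigr => i _.
  by rewrite ffunE rm_actZr rm_act1.
have [h hh gh] := pP _ _ g \1%VF hg gs (@is_hom1 P).
pose pr i (z : rm_pow rm_reg m) : rm_reg := z i.
have lpr i : linear (pr i) by move=> c u v; rewrite /pr !ffunE.
exists m, p, (fun i => linfun (pr i) \o h)%VF; split=> [i x a | x].
  by rewrite !comp_lfunE hh !linfun_linear // /pr ffunE.
have /lfunP/(_ x) := gh; rewrite id_lfunE comp_lfunE gE => {1}<-.
by apply: eq_bigr => i _; rewrite comp_lfunE linfun_linear.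
Qed.

Lemma rm_iso_sym X Y : rm_iso X Y -> rm_iso Y X.
Proof.
move=> [f [hf bf]]; have k0 : lker f == 0%VS by apply/lker0P/bij_inj.
case: bf => g fK gK; have gE : g =1 f^-1%VF.
  by move=> y; apply: (can_inj fK);
    rewrite gK limg_lfunVK // -{1}[y]gK memv_img ?memvf.
exists f^-1%VF; split.
  by move=> y a; apply: (can_inj fK); rewrite hf -!gE !gK.
by exists f => x; rewrite -?gE ?gK ?fK.
Qed.

Lemma rm_isoP X Y (f : 'Hom(X, Y)) (g : 'Hom(Y, X)) : is_hom f ->
  (g \o f = \1)%VF -> (f \o g = \1)%VF -> rm_iso X Y.
Proof.
move=> hf gf fg; exists f; split => //; exists g => x.
  by have /lfunP/(_ x) := gf; rewrite comp_lfunE id_lfunE.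
by have /lfunP/(_ x) := fg; rewrite comp_lfunE id_lfunE.
Qed.

Lemma rm_iso_inv X Y : rm_iso X Y ->
  exists (f : 'Hom(X, Y)) (g : 'Hom(Y, X)),
    [/\ is_hom f, is_hom g, (g \o f = \1)%VF & (f \o g = \1)%VF].
Proof.
move=> [f [hf bf]]; have k0 : lker f == 0%VS by apply/lker0P/bij_inj.
have fVK y : f (f^-1%VF y) = y.
  by case: bf => g fK gK; rewrite limg_lfunVK // -{1}[y]gK memv_img ?memvf.
exists f, f^-1%VF; split=> //.
- by move=> y a; apply: (bij_inj bf); rewrite hf !fVK.
- by apply/lfunP=> x; rewrite comp_lfunE id_lfunE lker0_lfunK.
by apply/lfunP=> x; rewrite comp_lfunE id_lfunE fVK.
Qed.

End ModuleBasics.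

(** * Chain maps and Ext *)

Section Resolutions.
Variables (K : fieldType) (A : falgType K).
Implicit Types X Y Z M N : rmodule A.

Lemma comp_lfun_eqP (V1 V2 V3 V4 : vectType K) (f : 'Hom(V2, V4))
    (g : 'Hom(V1, V2)) (h : 'Hom(V3, V4)) (k : 'Hom(V1, V3)) :
  (f \o g = h \o k)%VF <-> forall x, f (g x) = h (k x).
Proof.
split=> [/lfunP E x | E]; first by have := E x; rewrite !comp_lfunE.
by apply/lfunP=> x; rewrite !comp_lfunE.
Qed.

Lemma comp_lfun_eq0P (V1 V2 V3 : vectType K) (f : 'Hom(V2, V3))
    (g : 'Hom(V1, V2)) :
  (f \o g = 0)%VF <-> forall x, f (g x) = 0.
Proof.
split=> [/lfunP E x | E]; first by have := E x; rewrite !lfunE.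
by apply/lfunP=> x; rewrite !lfunE /=.
Qed.

Section OneResolution.
Variables (X : rmodule A) (P : proj_resolution X).

Lemma res_augK x : res_aug P (res_diff P 0 x) = 0.
Proof. by apply/eqP; rewrite -memv_ker res_exact0 memv_img ?memvf. Qed.

Lemma res_diffK i x : res_diff P i (res_diff P i.+1 x) = 0.
Proof. by apply/eqP; rewrite -memv_ker res_exactS memv_img ?memvf. Qed.

Lemma res_aug_onto x : exists y, res_aug P y = x.
Proof. by have /limg_surj/(_ x) := res_aug_surj P. Qed.

Lemma res_aug_factor Y (f : 'Hom(P 0, Y)) : is_hom f ->
  (f \o res_diff P 0 = 0)%VF ->
  exists2 g : 'Hom(X, Y), is_hom g & (g \o res_aug P)%VF = f.
Proof.
move=> hf /comp_lfun_eq0P f0; pose s := (res_aug P)^-1%VF.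
have sK x : res_aug P (s x) = x.
  by rewrite limg_lfunVK // res_aug_surj memvf.
have gE y : f (s (res_aug P y)) = f y.
  apply/eqP; rewrite -subr_eq0 -linearB /=.
  have : s (res_aug P y) - y \in lker (res_aug P).
    by rewrite memv_ker linearB /= sK subrr.
  by rewrite res_exact0 => /memv_imgP[z _ ->]; rewrite f0.
exists (f \o s)%VF; last by apply/lfunP=> y; rewrite !comp_lfunE.
move=> x a; have [y <-] := res_aug_onto x.
by rewrite !comp_lfunE -res_aug_hom !gE hf.
Qed.

End OneResolution.

Section Lift.
Variables (X Y : rmodule A) (P : proj_resolution X) (R : proj_resolution Y).

(* [F] is the degree [i] part of a chain map lifting [f]; as a relation, it needs
   no choice of such a chain map. *)
Fixpoint chain_lift (f : 'Hom(X, Y)) (i : nat) : 'Hom(P i, R i) -> Prop :=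
  match i with
  | 0 => fun F => is_hom F /\ (res_aug R \o F = f \o res_aug P)%VF
  | j.+1 => fun F => is_hom F /\
      exists2 G, chain_lift f G & (res_diff R j \o F = G \o res_diff P j)%VF
  end.

Lemma chain_lift_hom f i F : chain_lift f (i := i) F -> is_hom F.
Proof. by case: i F => [|i] F []. Qed.

Lemma chain_lift_ex f i : is_hom f -> exists F, chain_lift f (i := i) F.
Proof.
move=> hf; elim: i => [|i [G lG]].
  have [||||F hF EF] := @proj_lift _ _ (P 0) _ _ (res_aug R)
      (f \o res_aug P)%VF.
  - exact: res_objP.
  - exact: res_aug_hom.
  - by apply: is_hom_comp; last exact: res_aug_hom.
  - by move=> x; rewrite res_aug_surj memvf.
  by exists F.
have hG := chain_lift_hom lG.
have [||||F hF EF] :=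
    @proj_lift _ _ (P i.+1) _ _ (res_diff R i) (G \o res_diff P i)%VF.
- exact: res_objP.
- exact: res_diff_hom.
- by apply: is_hom_comp; last exact: res_diff_hom.
- case: i G lG hG => [|i] G lG hG x.
    have [_ /comp_lfun_eqP E] := lG.
    by rewrite -res_exact0 memv_ker comp_lfunE E res_augK linear0.
  have [_ [G' _ /comp_lfun_eqP E]] := lG.
  by rewrite -res_exactS memv_ker comp_lfunE E res_diffK linear0.
by exists F; split=> //; exists G.
Qed.

Lemma chain_lift0 i : chain_lift 0 (0 : 'Hom(P i, R i)).
Proof.
elim: i => [|i IH]; split; try exact: is_hom0.
  by rewrite comp_lfun0r comp_lfun0l.
by exists 0; rewrite // comp_lfun0r comp_lfun0l.
Qed.

Lemma chain_liftD f g i F G : chain_lift f (i := i) F -> chain_lift g G ->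
    chain_lift (f + g) (F + G).
Proof.
elim: i F G => [|i IH] F G [hF EF] [hG EG]; split; try exact: is_homD.
  by rewrite comp_lfunDl comp_lfunDr EF EG.
have [[F' lF' EF'] [G' lG' EG']] := (EF, EG).
by exists (F' + G'); [exact: IH | rewrite comp_lfunDl comp_lfunDr EF' EG'].
Qed.

Lemma chain_liftZ c f i F : chain_lift f (i := i) F ->
    chain_lift (c *: f) (c *: F).
Proof.
elim: i F => [|i IH] F [hF EF]; split; try exact: is_homZ.
  by rewrite -comp_lfunZr -comp_lfunZl EF.
have [F' lF' EF'] := EF.
by exists (c *: F'); [exact: IH | rewrite -comp_lfunZr -comp_lfunZl EF'].
Qed.

Lemma chain_liftB f g i F G : chain_lift f (i := i) F -> chain_lift g G ->
    chain_lift (f - g) (F - G).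
Proof.
move=> lF lG; rewrite -!(scaleN1r g) -(scaleN1r G).
by apply: chain_liftD => //; exact: chain_liftZ.
Qed.

Lemma chain_lift_sum I (r : seq I) (f : I -> 'Hom(X, Y)) i (F : I ->
    'Hom(P i, R i)) :
  (forall k, chain_lift (f k) (F k)) ->
  chain_lift (\sum_(k <- r) f k) (\sum_(k <- r) F k).
Proof.
move=> lF; elim: r => [|k r IH]; rewrite ?big_nil ?big_cons;
  first exact: chain_lift0.
exact: chain_liftD.
Qed.

(** This is the homotopy identity F = d s + s' d composed with d on the right. The term in s' drops
    out, so the identity has the same shape in every degree and can be carried by induction. *)
Lemma chain_lift_null i F : chain_lift 0 (i := i) F ->
  exists2 s : 'Hom(P i, R i.+1), is_hom s &
    (res_diff R i \o s \o res_diff P i = F \o res_diff P i)%VF.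
Proof.
elim: i F => [|i IH] F [hF EF].
  have [||||s hs Es] := @proj_lift _ _ (P 0) _ _ (res_diff R 0) F.
  - exact: res_objP.
  - exact: res_diff_hom.
  - by [].
  - move=> x; rewrite -res_exact0 memv_ker; move/comp_lfun_eqP: EF => ->.
    by rewrite zero_lfunE.
  by exists s; rewrite ?Es.
have [G lG /comp_lfun_eqP EG] := EF; have [s hs /comp_lfun_eqP Es] := IH G lG.
have hsd : is_hom (s \o res_diff P i) by apply/is_hom_comp/res_diff_hom.
have [||||s' hs' Es'] :=
    @proj_lift _ _ (P i.+1) _ _ (res_diff R i.+1) (F - (s \o res_diff P i))%VF.
- exact: res_objP.
- exact: res_diff_hom.
- exact: is_homB.
- move=> x; rewrite -res_exactS memv_ker !(add_lfunE, opp_lfunE) linearB /=.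
  by rewrite EG -Es !comp_lfunE subrr.
exists s' => //; rewrite Es'; apply/comp_lfun_eqP => x.
by rewrite !(add_lfunE, opp_lfunE) comp_lfunE res_diffK linear0 subr0.
Qed.

Lemma chain_lift_homotopy i F : chain_lift 0 (i := i.+1) F ->
  exists (s : 'Hom(P i, R i.+1)) (s' : 'Hom(P i.+1, R i.+2)),
    [/\ is_hom s, is_hom s' &
        F = ((res_diff R i.+1 \o s') + (s \o res_diff P i))%VF].
Proof.
move=> [hF [G lG /comp_lfun_eqP EG]];
  have [s hs /comp_lfun_eqP Es] := chain_lift_null lG.
have hsd : is_hom (s \o res_diff P i) by apply/is_hom_comp/res_diff_hom.
have [||||s' hs' Es'] :=
    @proj_lift _ _ (P i.+1) _ _ (res_diff R i.+1) (F - (s \o res_diff P i))%VF.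
- exact: res_objP.
- exact: res_diff_hom.
- exact: is_homB.
- move=> x; rewrite -res_exactS memv_ker !(add_lfunE, opp_lfunE) linearB /=.
  by rewrite EG -Es !comp_lfunE subrr.
by exists s, s'; split; rewrite // Es' subrK.
Qed.

End Lift.

Lemma chain_lift1 X (P : proj_resolution X) i : chain_lift \1
    (\1%VF : 'Hom(P i, P i)).
Proof.
elim: i => [|i IH]; split; try exact: is_hom1.
  by rewrite comp_lfun1r comp_lfun1l.
by exists \1%VF; rewrite // comp_lfun1r comp_lfun1l.
Qed.

Lemma chain_lift_comp X Y Z (P : proj_resolution X) (R : proj_resolution Y)
    (S : proj_resolution Z) f g i (F : 'Hom(P i, R i)) (G : 'Hom(R i, S i)) :
  chain_lift f F -> chain_lift g G -> chain_lift (g \o f) (G \o F).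
Proof.
elim: i F G => [|i IH] F G [hF EF] [hG EG]; split; try exact: is_hom_comp.
  by rewrite comp_lfunA EG -comp_lfunA EF comp_lfunA.
have [[F' lF' EF'] [G' lG' EG']] := (EF, EG).
exists (G' \o F')%VF; first exact: IH.
by rewrite comp_lfunA EG' -comp_lfunA EF' comp_lfunA.
Qed.

(** Membership in add M, expressed by maps to and from [M] alone: the identity of [X] is a sum of
    maps through [M]. The power of [M] no longer appears. *)
Definition retract M X : Prop :=
  exists m (a : 'I_m -> 'Hom(X, M)) (b : 'I_m -> 'Hom(M, X)),
    [/\ forall k, is_hom (a k), forall k, is_hom (b k) &
        (\sum_k (b k \o a k) = \1)%VF].

Lemma coboundaryD X (P : proj_resolution X) Y i (f g : 'Hom(P i, Y)) :
  coboundary f -> coboundary g -> coboundary (f + g).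
Proof.
case: i f g => [|i] f g /=; first by move=> -> ->; rewrite addr0.
move=> [f' hf ->] [g' hg ->]; exists (f' + g'); rewrite ?comp_lfunDl //.
exact: is_homD.
Qed.

Lemma coboundary_sum X (P : proj_resolution X) Y i I (r : seq I)
    (f : I -> 'Hom(P i, Y)) :
  (forall k, coboundary (f k)) -> coboundary (\sum_(k <- r) f k).
Proof.
move=> cf; elim/big_ind: _ => //; last exact: coboundaryD.
case: i f cf => [|i] f _ //=; exists 0; rewrite ?comp_lfun0l //; exact: is_hom0.
Qed.

Lemma coboundaryN X (P : proj_resolution X) Y i (f : 'Hom(P i, Y)) :
  coboundary f -> coboundary (- f).
Proof.
case: i f => [|i] f /=; first by move=> ->; rewrite oppr0.
move=> [g hg ->]; exists (- g); rewrite ?comp_lfunNl // -scaleN1r.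
exact: is_homZ.
Qed.

Lemma coboundary_comp X Y Z (P : proj_resolution X) (R : proj_resolution Z)
    (i : nat) (h : 'Hom(X, Z)) (F : 'Hom(P i, R i)) (g : 'Hom(R i, Y)) :
  chain_lift h F -> coboundary g -> coboundary (g \o F)%VF.
Proof.
case: i F g => [|i] F g /= [hF EF]; first by move=> ->; rewrite comp_lfun0l.
have [G lG EG] := EF => -[k hk ->]; exists (k \o G)%VF.
  by apply: is_hom_comp => //; exact: chain_lift_hom lG.
by rewrite -!comp_lfunA EG.
Qed.

Lemma Ext_eq0_retractr X M Y i : retract M Y -> Ext_eq0 i X M -> Ext_eq0 i X Y.
Proof.
move=> [m [a [b [ha hb ab]]]] E0 P f [hf f0].
have -> : f = (\sum_k (b k \o (a k \o f)))%VF.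
  by under eq_bigr do rewrite comp_lfunA;
    rewrite -comp_lfun_suml ab comp_lfun1l.
apply: coboundary_sum => k.
have /E0 : cocycle (a k \o f)%VF.
  by split; [exact: is_hom_comp | rewrite -comp_lfunA f0 comp_lfun0r].
case: {E0} i f {hf f0} => [|i] f /=; first by move=> ->; rewrite comp_lfun0r.
move=> [g hg ->]; exists (b k \o g)%VF; rewrite ?comp_lfunA //.
exact: is_hom_comp.
Qed.

(** Lifts [F k], [H k] of [a k], [b k] make the sum of the [H k \o F k] homotopic to the identity of
    [P], so up to a coboundary [f] is the sum of the [f \o H k \o F k], and each [f \o H k] is a
    cocycle on a resolution of [M]. *)
Lemma Ext_eq0_retractl X M Y i : retract M X ->
    (exists R : proj_resolution M, True) ->
  Ext_eq0 i.+1 M Y -> Ext_eq0 i.+1 X Y.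
Proof.
move=> [m [a [b [ha hb ab]]]] [R _] E0 P f [hf f0].
have /fin_all_exists[F lF] k : exists F : 'Hom(P i.+1, R i.+1), chain_lift
    (a k) F.
  exact: chain_lift_ex.
(* The lift is built one degree higher than used: [f \o H k] is a cocycle only because [H k]
   commutes with the differential coming from degree [i.+2]. *)
have /fin_all_exists[H HG] k : exists H : 'Hom(R i.+1, P i.+1), chain_lift
    (b k) H /\
    exists G : 'Hom(R i.+2, P i.+2), (res_diff P i.+1 \o G =
      H \o res_diff R i.+1)%VF.
  have [G [_ [H lH EH]]] := @chain_lift_ex _ _ R P _ i.+2 (hb k).
  by exists H; split=> //; exists G.
have cb k : coboundary (f \o H k)%VF.
  apply: E0; have [lH [G EH]] := HG k; split.
    by apply: is_hom_comp => //; exact: chain_lift_hom lH.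
  by rewrite -comp_lfunA -EH comp_lfunA f0 comp_lfun0l.
have /chain_lift_homotopy [s [s' [hs hs' Es]]] :
    chain_lift (0 : 'Hom(X, X)) (\sum_k
      (H k \o F k) - \1 : 'Hom(P i.+1, P i.+1))%VF.
  rewrite -(subrr \1%VF) -{1}ab; apply: chain_liftB (chain_lift1 _ _).
  by apply: chain_lift_sum => k; have [lH _] := HG k;
    exact: (chain_lift_comp (lF k) lH).
have -> : f = (\sum_k ((f \o H k) \o F k) - (f \o s \o res_diff P i))%VF.
  have -> : (\sum_k ((f \o H k) \o F k) = f \o \sum_k (H k \o F k))%VF.
    by rewrite comp_lfun_sumr; apply: eq_bigr => k _; rewrite comp_lfunA.
  rewrite -[X in (f \o X)%VF](subrK \1%VF) Es !comp_lfunDr comp_lfun1r.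
  by rewrite !comp_lfunA f0 comp_lfun0l add0r addrAC subrr add0r.
apply: coboundaryD; first by apply: coboundary_sum => k;
  apply: coboundary_comp (cb k).
apply: coboundaryN; exists (f \o s)%VF => //; exact: is_hom_comp.
Qed.

(* The resolution of a projective module splits: [id] is chain homotopic to a
   map concentrated in degree 0. *)
Lemma Ext_eq0_proj X Y i : rm_projective X -> Ext_eq0 i.+1 X Y.
Proof.
move=> pX P f [hf f0].
have [||||s hs Es] := @proj_lift _ _ X _ _ (res_aug P) \1%VF => //.
- exact: res_aug_hom.
- exact: is_hom1.
- by move=> x; rewrite res_aug_surj memvf.
have l0 j : chain_lift \1 (0 : 'Hom(P j.+1, P j.+1)).
  elim: j => [|j IH]; split; try exact: is_hom0.
    exists (s \o res_aug P)%VF.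
      split; first by apply: is_hom_comp => //; exact: res_aug_hom.
      by rewrite comp_lfunA Es.
    apply/comp_lfun_eqP=> x.
    by rewrite comp_lfunE res_augK linear0 zero_lfunE linear0.
  by exists 0; rewrite // comp_lfun0l comp_lfun0r.
have /chain_lift_homotopy [t [t' [ht ht' Et]]] :
    chain_lift (0 : 'Hom(X, X)) (\1 - 0 : 'Hom(P i.+1, P i.+1))%VF.
  by rewrite -(subrr \1%VF); apply: chain_liftB (chain_lift1 _ _) (l0 _).
exists (f \o t)%VF; first exact: is_hom_comp.
rewrite -[LHS]comp_lfun1r -[\1%VF]subr0 Et comp_lfunDr.
by rewrite comp_lfunA f0 comp_lfun0l add0r comp_lfunA.
Qed.

Lemma in_add_retract M X : in_add M X -> retract M X.
Proof.
move=> [m [X' /rm_iso_inv[f [g [hf hg gf fg]]]]].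
pose i1 : 'Hom(X, rm_sum X X') := linfun (fun x : X => (x, 0 : X')).
have i1E x : i1 x = (x, 0).
  apply: linfun_linear => c u v; congr (_, _).
  by rewrite /= scaler0 addr0.
pose p1 : 'Hom(rm_sum X X', X) := linfun (fun z : rm_sum X X' => z.1).
have p1E z : p1 z = z.1 by exact: linfun_linear.
pose a (k : 'I_m) : 'Hom(X, M) :=
  linfun (fun x => (f (i1 x) : rm_pow M m) k).
have aE k x : a k x = (f (i1 x) : rm_pow M m) k.
  by apply: linfun_linear => c u v; rewrite !linearP /= !ffunE.
pose j (k : 'I_m) (y : M) : rm_pow M m := [ffun k' => if k' == k then y else 0].
have lj k : linear (j k).
  move=> c u v; apply/ffunP => k'; rewrite !ffunE.
  by case: eqP => // _; rewrite scaler0 addr0.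
pose b (k : 'I_m) : 'Hom(M, X) := linfun (fun y => p1 (g (j k y))).
have bE k y : b k y = p1 (g (j k y)).
  by apply: linfun_linear => c u v; rewrite lj !linearP.
exists m, a, b; split=> [k x r | k y r |].
- have i1h : i1 (rm_act x r) = rm_act (i1 x) r.
    by rewrite !i1E /=; congr (_, _); rewrite rm_act0l.
  by rewrite !aE i1h hf; exact: ffunE.
- rewrite !bE !p1E; have -> : j k (rm_act y r) = rm_act (j k y) r.
    by apply/ffunP => k'; rewrite !ffunE; case: eqP; rewrite ?rm_act0l.
  by rewrite hg.
apply/lfunP=> x; rewrite sum_lfunE id_lfunE.
transitivity (p1 (g (f (i1 x)))); last first.
  by have /lfunP/(_ (i1 x)) := gf; rewrite comp_lfunE id_lfunE => ->;
    rewrite p1E i1E.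
have -> : f (i1 x) = \sum_k j k (a k x).
  apply/ffunP=> k'; rewrite sum_ffunE
    (bigD1 k') //= ffunE eqxx big1 ?addr0 ?aE //.
  by move=> k nk; rewrite ffunE eq_sym (negPf nk).
by rewrite !linear_sum; apply: eq_bigr => k _; rewrite comp_lfunE bE.
Qed.

End Resolutions.

(** * The Nakayama functor *)

Section Nakayama.
Variables (K : fieldType) (A : falgType K).
Implicit Types X Y Z M N P : rmodule A.

Section LeftAction.
Variable P : rmodule A.

Definition lact (a : A) (h : 'Hom(P, rm_reg A)) : 'Hom(P, rm_reg A) :=
  linfun (fun x : P => a * h x : rm_reg A).

Lemma lactE a h x : lact a h x = a * h x.
Proof.
apply: linfun_linear => c u v; rewrite linearP mulrDr; congr (_ + _).
exact/esym/scalerAr.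
Qed.

Lemma lact_hom a h : is_hom h -> is_hom (lact a h).
Proof. by move=> hh x b; rewrite !lactE hh /= mulrA. Qed.

Lemma lact_linearr a : linear (lact a).
Proof.
move=> c f g; apply/lfunP=> x.
rewrite lactE !(add_lfunE, scale_lfunE) !lactE mulrDr; congr (_ + _).
exact/esym/scalerAr.
Qed.

Lemma lact_linearl h : linear (lact^~ h).
Proof.
move=> c a b; apply/lfunP=> x.
rewrite lactE !(add_lfunE, scale_lfunE) !lactE mulrDl; congr (_ + _).
exact/esym/scalerAl.
Qed.

Lemma lact1 h : lact 1 h = h.
Proof. by apply/lfunP=> x; rewrite lactE mul1r. Qed.

Lemma lactM a b h : lact (a * b) h = lact a (lact b h).
Proof. by apply/lfunP=> x; rewrite !lactE mulrA. Qed.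

(* The Nakayama functor [N P = D Hom(P, A)]. *)
Let nak_sort := 'Hom(subvs_of (hom_space P (rm_reg A)), K^o).

(** [nak_sort] is the dual of the space of homomorphisms only. Evaluation first projects onto that
    subspace, so it accepts any linear map but carries meaning only at homomorphisms. *)
Definition nak_ev (phi : nak_sort) (h : 'Hom(P, rm_reg A)) : K^o :=
  phi (vsproj _ h).

Lemma nak_ext (phi psi : nak_sort) :
  (forall h, is_hom h -> nak_ev phi h = nak_ev psi h) -> phi = psi.
Proof.
move=> E; apply/lfunP=> u; rewrite -[u]vsvalK; apply: E.
by apply/hom_spaceP; exact: subvsP.
Qed.

Definition nak_of (psi : 'Hom('Hom(P, rm_reg A), K^o)) : nak_sort :=
  (psi \o linfun vsval)%VF.

Lemma nak_ofE psi h : is_hom h -> nak_ev (nak_of psi) h = psi h.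
Proof.
by move/hom_spaceP=> hh; rewrite /nak_ev comp_lfunE lfunE /= vsprojK.
Qed.

Lemma nak_evP (phi : nak_sort) : linear (nak_ev phi).
Proof. by move=> c f g; rewrite /nak_ev !linearP. Qed.

Definition nak_act (phi : nak_sort) (a : A) : nak_sort :=
  nak_of (linfun (fun h => nak_ev phi (lact a h))).

Lemma nak_actE phi a h : is_hom h ->
  nak_ev (nak_act phi a) h = nak_ev phi (lact a h).
Proof.
move=> hh; rewrite nak_ofE // linfun_linear // => c f g.
by rewrite lact_linearr nak_evP.
Qed.

Lemma nak_evD (phi psi : nak_sort) c h :
  nak_ev (c *: phi + psi) h = c *: nak_ev phi h + nak_ev psi h.
Proof. by rewrite /nak_ev add_lfunE scale_lfunE. Qed.

Fact nak_actl a : linear (nak_act^~ a).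
Proof.
by move=> c f g; apply: nak_ext => h hh; rewrite nak_evD !nak_actE // nak_evD.
Qed.

Fact nak_actr phi : linear (nak_act phi).
Proof.
move=> c a b; apply: nak_ext => h hh.
by rewrite nak_evD !nak_actE // lact_linearl nak_evP.
Qed.

Fact nak_act1 phi : nak_act phi 1 = phi.
Proof. by apply: nak_ext => h hh; rewrite nak_actE // lact1. Qed.

Fact nak_actM phi a b : nak_act phi (a * b) = nak_act (nak_act phi a) b.
Proof.
apply: nak_ext => h hh; rewrite !nak_actE ?lactM //; exact: lact_hom.
Qed.

Definition nak : rmodule A := RModule nak_actl nak_actr nak_act1 nak_actM.

End LeftAction.

Lemma nak_evA P (phi : nak P) a h : is_hom h ->
  nak_ev (rm_act phi a) h = nak_ev phi (lact a h).
Proof. exact: nak_actE. Qed.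

Lemma nak_ev0 P h : nak_ev (0 : nak P) h = 0.
Proof. by rewrite /nak_ev zero_lfunE. Qed.

Lemma nak_ev_sum P (phi : nak P) I (r : seq I) F :
  nak_ev phi (\sum_(i <- r) F i) = \sum_(i <- r) nak_ev phi (F i).
Proof. by rewrite /nak_ev !linear_sum. Qed.

Section NakMap.
Variables (P Q : rmodule A) (d : 'Hom(P, Q)).

Definition nak_map : 'Hom(nak P, nak Q) :=
  linfun (fun phi : nak P => nak_of (linfun (fun h => nak_ev phi (h \o d)%VF))
    : nak Q).

Hypothesis hd : is_hom d.

Lemma nak_mapE (phi : nak P) h : is_hom h ->
  nak_ev (nak_map phi) h = nak_ev phi (h \o d)%VF.
Proof.
have lin1 (xi : nak P) : linear (fun h => nak_ev xi (h \o d)%VF).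
  by move=> c f g; rewrite comp_lfunDl -comp_lfunZl nak_evP.
move=> hh; rewrite linfun_linear ?nak_ofE ?linfun_linear // => c f g.
apply: nak_ext => k hk; rewrite nak_evD !nak_ofE // !linfun_linear //.
by rewrite nak_evD.
Qed.

Lemma nak_map_hom : is_hom nak_map.
Proof.
move=> phi a; apply: nak_ext => h hh.
rewrite nak_evA // !nak_mapE //; last exact: lact_hom.
rewrite nak_evA; last exact: is_hom_comp.
by congr (nak_ev _ _); apply/lfunP=> x; rewrite comp_lfunE !lactE comp_lfunE.
Qed.

End NakMap.

Lemma nak_map_comp (P Q S : rmodule A) (f : 'Hom(P, Q)) (g : 'Hom(Q, S)) :
  is_hom g -> nak_map (g \o f)%VF = (nak_map g \o nak_map f)%VF.
Proof.
move=> hg; apply/lfunP=> phi; apply: nak_ext => h hh.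
rewrite comp_lfunE !nak_mapE ?comp_lfunA //; exact: is_hom_comp.
Qed.

Lemma nak_map1 P : nak_map (\1%VF : 'Hom(P, P)) = \1%VF.
Proof.
apply/lfunP=> phi; apply: nak_ext => h hh.
by rewrite nak_mapE ?comp_lfun1r ?id_lfunE.
Qed.

Lemma nak_map_linear (P Q : rmodule A) : linear (@nak_map P Q).
Proof.
move=> c f g; apply/lfunP=> phi; apply: nak_ext => h hh.
rewrite add_lfunE scale_lfunE nak_evD !nak_mapE // comp_lfunDr -comp_lfunZr.
by rewrite nak_evP.
Qed.

Lemma nak_map0 (P Q : rmodule A) : nak_map (0 : 'Hom(P, Q)) = 0.
Proof.
have := nak_map_linear 1 (0 : 'Hom(P, Q)) 0.
rewrite !scale1r addr0 => E.
by apply: (addrI (nak_map 0)); rewrite addr0 -E.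
Qed.

Section Theta.
Variables P Y : rmodule A.
Implicit Type psi : 'Hom('Hom(P, Y), K^o).

(* The correspondence [D Hom(P, Y) = Hom(Y, N P)], for [P] projective. *)
Definition theta psi : 'Hom(Y, nak P) :=
  linfun (fun y : Y =>
    nak_of (linfun (fun h => psi (orbit_map y \o h)%VF)) : nak P).

Lemma orbit_map_linear : linear (@orbit_map K A Y).
Proof.
move=> c u v; apply/lfunP=> a; rewrite add_lfunE scale_lfunE !orbit_mapE.
exact: rm_actl.
Qed.

Lemma thetaE psi y h : is_hom h ->
  nak_ev (theta psi y) h = psi (orbit_map y \o h)%VF.
Proof.
have lin1 z : linear (fun h : 'Hom(P, rm_reg A) => psi (orbit_map z \o h)%VF).
  by move=> c f g; rewrite comp_lfunDr -comp_lfunZr linearP.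
move=> hh; rewrite linfun_linear ?nak_ofE ?linfun_linear // => c f g.
apply: nak_ext => k hk; rewrite nak_evD !nak_ofE // !linfun_linear //.
by rewrite orbit_map_linear comp_lfunDl -comp_lfunZl linearP.
Qed.

Lemma theta_hom psi : is_hom (theta psi).
Proof.
move=> y a; apply: nak_ext => h hh.
rewrite nak_evA // !thetaE //; last exact: lact_hom.
congr (psi _); apply/lfunP=> x.
by rewrite !comp_lfunE !orbit_mapE lactE rm_actA.
Qed.

Hypothesis pP : rm_projective P.

Lemma theta_onto (g : 'Hom(Y, nak P)) : is_hom g -> exists psi, theta psi = g.
Proof.
move=> hg; have [m [p [f [hf def_p]]]] := proj_dual_basis pP.
(* With h = sum_i h(p_i) f_i from the dual basis, A-linearity of [g] turns sum_i g(y h(p_i))(f_i)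
   into g(y)(h), so this functional is a preimage of [g]. *)
exists (linfun (fun u : 'Hom(P, Y) => \sum_i nak_ev (g (u (p i))) (f i))).
apply/lfunP=> y; apply: nak_ext => h hh; rewrite thetaE // linfun_linear.
  transitivity (nak_ev (g y) (\sum_i lact (h (p i)) (f i))).
    rewrite nak_ev_sum; apply: eq_bigr => i _.
    by rewrite comp_lfunE orbit_mapE hg nak_evA.
  congr (nak_ev _ _); apply/lfunP=> x;
    rewrite sum_lfunE {2}(def_p x) linear_sum.
  by apply: eq_bigr => i _; rewrite lactE /= hh.
move=> c u v; rewrite scaler_sumr -big_split /=; apply: eq_bigr => i _.
by rewrite add_lfunE scale_lfunE linearP nak_evD.
Qed.

(** By the dual basis every homomorphism from [P] to [Y] is a sum of maps P -> A -> Y, and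
    [theta psi] records the values of [psi] on exactly these. With [theta_onto] this makes [theta]
    an isomorphism from D Hom(P, Y) onto Hom(Y, N P). *)
Lemma theta_eq0 psi :
  theta psi = 0 <-> (forall u, is_hom u -> psi u = 0).
Proof.
have [m [p [f [hf def_p]]]] := proj_dual_basis pP.
split=> [/lfunP E u hu | E]; last first.
  apply/lfunP=> y; apply: nak_ext => h hh; rewrite thetaE // zero_lfunE.
rewrite E ?nak_ev0 //; apply: is_hom_comp hh; exact: orbit_map_hom.
have -> : u = \sum_i (orbit_map (u (p i)) \o f i)%VF.
  apply/lfunP=> x; rewrite sum_lfunE {1}(def_p x) linear_sum.
  by apply: eq_bigr => i _; rewrite comp_lfunE orbit_mapE /= hu.
rewrite linear_sum big1 // => i _.
by rewrite /= -thetaE // E zero_lfunE nak_ev0.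
Qed.

End Theta.

Lemma theta_linear P Y (c : K) (f g : 'Hom('Hom(P, Y), K^o)) :
  theta (c *: f + g) = c *: theta f + theta g.
Proof.
apply/lfunP=> y; apply: nak_ext => h hh.
by rewrite add_lfunE scale_lfunE nak_evD !thetaE // add_lfunE scale_lfunE.
Qed.

Definition precomp (V1 V2 W : vectType K) (d : 'Hom(V1, V2)) :
    'Hom('Hom(V2, W), 'Hom(V1, W)) := linfun (fun h => h \o d)%VF.

Lemma precompE (V1 V2 W : vectType K) (d : 'Hom(V1, V2)) (h : 'Hom(V2, W)) :
  precomp W d h = (h \o d)%VF.
Proof.
by apply: linfun_linear => c f g; rewrite comp_lfunDl -comp_lfunZl.
Qed.

Definition postcomp (U V1 V2 : vectType K) (d : 'Hom(V1, V2)) :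
    'Hom('Hom(U, V1), 'Hom(U, V2)) := linfun (fun h => d \o h)%VF.

Lemma postcompE (U V1 V2 : vectType K) (d : 'Hom(V1, V2)) (h : 'Hom(U, V1)) :
  postcomp U d h = (d \o h)%VF.
Proof.
by apply: linfun_linear => c f g; rewrite comp_lfunDr -comp_lfunZr.
Qed.

Lemma theta_natl (P Q Y : rmodule A) (d : 'Hom(P, Q))
    (psi : 'Hom('Hom(P, Y), K^o)) :
  is_hom d -> (nak_map d \o theta psi = theta (psi \o precomp Y d))%VF.
Proof.
move=> hd; apply/lfunP=> y; apply: nak_ext => h hh.
rewrite comp_lfunE nak_mapE // !thetaE ?comp_lfunE ?precompE ?comp_lfunA //.
exact: is_hom_comp.
Qed.

Lemma theta_natr P Y Z (g : 'Hom(Z, Y)) (psi : 'Hom('Hom(P, Y), K^o)) :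
  is_hom g -> (theta psi \o g = theta (psi \o postcomp P g))%VF.
Proof.
move=> hg; apply/lfunP=> z; apply: nak_ext => h hh.
rewrite comp_lfunE !thetaE // comp_lfunE postcompE; congr (psi _).
by apply/lfunP=> x; rewrite !comp_lfunE !orbit_mapE hg.
Qed.

End Nakayama.

(** Functionals detect membership in [U]: the test functionals are the coordinates composed with the
    projection away from [U]. This turns duality statements back into membership in an image. *)
Lemma functional_sep (K : fieldType) (V : vectType K) (U : {vspace V}) v :
  (forall psi : 'Hom(V, K^o), (forall u, u \in U -> psi u = 0) -> psi v = 0) ->
  v \in U.
Proof.
move=> sep; suff /eqP : v - projv U v = 0 by rewrite subr_eq0 => /eqP->;
  exact: memv_proj.
set w := v - _; rewrite (coord_vbasis (memvf w)) big1 // => i _.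
pose c : 'Hom(V, K^o) := linfun (coord (vbasis {:V}) i : V -> K^o).
have cE x : c x = coord (vbasis {:V}) i x.
  by apply: linfun_linear => a x1 x2; rewrite linearP.
have := sep (c - (c \o projv U))%VF.
rewrite add_lfunE opp_lfunE comp_lfunE -linearB /= cE => E.
rewrite E ?scale0r // => u uU.
by rewrite add_lfunE opp_lfunE comp_lfunE projv_id ?subrr.
Qed.

(** * Kernels of the Nakayama complex *)

Section Translate.
Variables (K : fieldType) (A : falgType K).
Implicit Types X Y Z M N : rmodule A.
Local Notation reg := (rm_reg A).

Lemma theta_eq (P Y : rmodule A)
    (psi psi' : 'Hom('Hom(P, Y), K^o)) : rm_projective P ->
  (forall u : 'Hom(P, Y), is_hom u -> psi u = psi' u) -> theta psi = theta psi'.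
Proof.
move=> pP E; apply/eqP; rewrite -subr_eq0; apply/eqP.
rewrite addrC -[- theta psi']scaleN1r -theta_linear.
apply/(theta_eq0 pP) => u hu.
by rewrite add_lfunE scale_lfunE E // scaleN1r addNr.
Qed.

Definition ann (V : vectType K) (U : {vspace V}) : {vspace 'Hom(V, K^o)} :=
  lker (precomp K^o (projv U)).

Lemma annP (V : vectType K) (U : {vspace V}) psi :
  psi \in ann U <-> forall u, u \in U -> psi u = 0.
Proof.
rewrite memv_ker precompE; split=> [/eqP/lfunP E u uU | E].
  by have := E u; rewrite comp_lfunE zero_lfunE projv_id.
by apply/eqP/lfunP=> v; rewrite comp_lfunE zero_lfunE E ?memv_proj.
Qed.

(** [theta] carries the annihilator of [B] onto [W], with kernel the annihilator of all
    homomorphisms. Hence [W] is dual to Hom(P, Y)/B, and the dimensions are compared inside the dual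
    of the space of all linear maps. *)
Lemma theta_dim (P Y : rmodule A) (B : {vspace 'Hom(P, Y)})
    (W : {vspace 'Hom(Y, nak P)}) :
  rm_projective P -> (B <= hom_space P Y)%VS -> (W <= hom_space Y (nak P))%VS ->
  (forall psi, theta psi \in W <-> forall b, b \in B -> psi b = 0) ->
  (\dim W + \dim B)%N = hom_dim P Y.
Proof.
move=> pP sB sW WP.
have := rank_nullity (U := ann B) (N := ann (hom_space P Y)) (I := W)
  (@theta_linear _ _ P Y).
have H1 psi : psi \in ann (hom_space P Y) <-> psi \in ann B /\ theta psi = 0.
  split=> [/annP p0 | [_ /(theta_eq0 pP) p0]]; last first.
    by apply/annP=> u /hom_spaceP/p0.
  split; first by apply/annP=> b /(subvP sB)/p0.
  by apply/(theta_eq0 pP) => u /hom_spaceP/p0.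
have H2 g : g \in W <-> exists2 psi, psi \in ann B & theta psi = g.
  split=> [gW | [psi /annP p0 <-]]; last exact/WP.
  have /hom_spaceP hg := subvP sW _ gW.
  have [psi def_g] := theta_onto pP hg; exists psi => //.
  by apply/annP/WP; rewrite def_g.
move/(_ H1 H2).
have dB := dim_annihilator (@annP _ B).
have dH := dim_annihilator (@annP _ (hom_space P Y)).
rewrite /hom_dim; lia.
Qed.

Lemma hom_dim_nak (P Y : rmodule A) : rm_projective P ->
    hom_dim Y (nak P) = hom_dim P Y.
Proof.
move=> pP; rewrite -(theta_dim (B := 0%VS) (W := hom_space Y
  (nak P)) pP) ?sub0v //.
  by rewrite dimv0 addn0.
move=> psi; split=> [_ b | _]; last by apply/hom_spaceP; exact: theta_hom.
by rewrite memv0 => /eqP->; rewrite linear0.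
Qed.

Lemma nak_map_eq0 (P Q : rmodule A) (f : 'Hom(P, Q)) : rm_projective Q ->
    is_hom f ->
  nak_map f = 0 -> f = 0.
Proof.
move=> pQ hf N0; have [m [p [g [hg def_p]]]] := proj_dual_basis pQ.
have gf0 i : (g i \o f = 0)%VF.
  apply/eqP; rewrite -memv0; apply: functional_sep => psi _.
  have /lfunP/(_ (nak_of psi)) := N0.
  rewrite zero_lfunE => /(congr1 (fun phi => nak_ev phi (g i))).
  by rewrite nak_mapE // nak_ev0 nak_ofE //; exact: is_hom_comp.
apply/lfunP=> x; rewrite zero_lfunE (def_p (f x)) big1 // => i _.
by have /lfunP/(_ x) := gf0 i; rewrite comp_lfunE zero_lfunE => ->;
  rewrite rm_act0r.
Qed.

(** N is faithful on maps into projectives, and dim Hom(N P, N Q) = dim Hom(Q, N P) = dim Hom(P, Q)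
    by two uses of [hom_dim_nak]; fullness is the resulting equality of dimensions. *)
Lemma nak_full (P Q : rmodule A) (g : 'Hom(nak P, nak Q)) :
  rm_projective P -> rm_projective Q -> is_hom g ->
  exists2 f : 'Hom(P, Q), is_hom f & nak_map f = g.
Proof.
move=> pP pQ hg.
pose I := (linfun (@nak_map _ _ P Q) @: hom_space P Q)%VS.
have IP w : w \in I <-> exists2 f, f \in hom_space P Q & nak_map f = w.
  split=> [/memv_imgP[f hf ->] | [f hf <-]].
    by exists f => //; rewrite linfun_linear //; exact: nak_map_linear.
  by rewrite -(linfun_linear (@nak_map_linear _ _ P Q)) memv_img.
have := rank_nullity (N := 0%VS) (@nak_map_linear _ _ P Q) _ IP.
rewrite dimv0 add0n => dI.
have /eqP EI : I == hom_space (nak P) (nak Q).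
  rewrite eqEdim dI; last first.
    move=> f; rewrite memv0; split=> [/eqP->|[/hom_spaceP hf f0]].
      by rewrite mem0v nak_map0.
    by apply/eqP; apply: nak_map_eq0 f0.
  apply/andP; split; last by rewrite -/(hom_dim _ _) !hom_dim_nak.
  apply/subvP=> _ /IP[f /hom_spaceP hf <-]; apply/hom_spaceP;
    exact: nak_map_hom.
move/hom_spaceP: hg; rewrite -EI => /IP[f /hom_spaceP hf <-].
by exists f.
Qed.

Section Syzygies.
Variables (X : rmodule A) (P : proj_resolution X).

(** The augmented resolution: [X] sits below degree 0 and the augmentation is the map leaving degree
    0. In particular [syz 0] below is the kernel of N P_0 -> N X. *)
Definition res_tgt (k : nat) : rmodule A := if k is j.+1 then P j else X.

Definition res_out (k : nat) : 'Hom(P k, res_tgt k) :=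
  match k with 0 => res_aug P | j.+1 => res_diff P j end.

Lemma res_out_hom k : is_hom (res_out k).
Proof. by case: k => [|k]; [exact: res_aug_hom | exact: res_diff_hom]. Qed.

Lemma res_out_exact k : lker (res_out k) = limg (res_diff P k).
Proof. by case: k => [|k]; [exact: res_exact0 | exact: res_exactS]. Qed.

Lemma res_outK k : (res_out k \o res_diff P k)%VF = 0.
Proof.
apply/comp_lfun_eq0P => x; apply/eqP.
by rewrite -memv_ker res_out_exact memv_img ?memvf.
Qed.

(* The complex [N P_n -> ... -> N P_0 -> N X] and its kernels; [syz n] is the
   higher Auslander-Reiten translate of [X] when [P] has length [n]. *)
Definition syz (k : nat) : rmodule A :=
  rm_sub (ker_stable (nak_map_hom (@res_out_hom k))).

Definition syz_inj (k : nat) : 'Hom(syz k, nak (P k)) :=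
  sub_inj (ker_stable (nak_map_hom (@res_out_hom k))).

Lemma syz_inj_hom k : is_hom (syz_inj k).
Proof. exact: sub_inj_hom. Qed.

Lemma syz_inj_inj k : injective (syz_inj k).
Proof. exact: sub_inj_inj. Qed.

Lemma syz_injK k : (nak_map (res_out k) \o syz_inj k)%VF = 0.
Proof.
apply/comp_lfun_eq0P => z; apply/eqP.
by rewrite -memv_ker; exact: sub_inj_mem.
Qed.

Lemma syz_factor k Y (f : 'Hom(Y, nak (P k))) : is_hom f ->
  (nak_map (res_out k) \o f = 0)%VF ->
  exists2 g : 'Hom(Y, syz k), is_hom g & (syz_inj k \o g)%VF = f.
Proof.
move=> hf /comp_lfun_eq0P f0; apply: sub_factor => // y.
by rewrite memv_ker f0.
Qed.

Lemma syz_onto k (phi : nak (P k)) : nak_map (res_out k) phi = 0 ->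
  exists z, syz_inj k z = phi.
Proof. by move=> p0; apply: sub_inj_onto; rewrite memv_ker p0. Qed.

Lemma nak_res_outK k : (nak_map (res_out k) \o nak_map (res_diff P k) = 0)%VF.
Proof.
by rewrite -nak_map_comp ?res_outK ?nak_map0 //; exact: res_out_hom.
Qed.

Lemma syz_proj k : exists2 q : 'Hom(nak (P k.+1), syz k), is_hom q &
  (syz_inj k \o q)%VF = nak_map (res_diff P k).
Proof.
apply: syz_factor; first by apply: nak_map_hom; exact: res_diff_hom.
exact: nak_res_outK.
Qed.

(* Exactness of [Hom(P, Y)] in degree [k]; it is automatic for [k = 0]. *)
Definition out_exact (k : nat) Y : Prop :=
  forall f : 'Hom(P k, Y), cocycle f ->
    exists2 g : 'Hom(res_tgt k, Y), is_hom g & f = (g \o res_out k)%VF.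

Lemma out_exact0 Y : out_exact 0 Y.
Proof.
by move=> f [hf f0]; have [g hg <-] := res_aug_factor hf f0; exists g.
Qed.

Lemma out_exactS k Y : Ext_eq0 k.+1 X Y -> out_exact k.+1 Y.
Proof. by move=> E f /E. Qed.

Lemma nak_exact k (phi : nak (P k)) : out_exact k reg ->
  nak_map (res_out k) phi = 0 ->
  exists phi', nak_map (res_diff P k) phi' = phi.
Proof.
move=> ex p0; pose psi : 'Hom('Hom(P k, reg), K^o) := linfun (nak_ev phi).
have psiE h : psi h = nak_ev phi h by apply: linfun_linear; exact: nak_evP.
have [|psi' E] := @functional_factor _ _ _ (hom_space (P k) reg)
    (precomp reg (res_diff P k)) psi.
  move=> u /hom_spaceP hu; rewrite precompE => ud.
  have [g hg ->] := ex u (conj hu ud).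
  by rewrite psiE -nak_mapE // p0 nak_ev0.
exists (nak_of psi'); apply: nak_ext => h hh; rewrite nak_mapE //.
rewrite nak_ofE -?precompE -?E ?psiE //; first exact/hom_spaceP.
by rewrite precompE; apply: is_hom_comp => //; exact: res_diff_hom.
Qed.

(** Through [theta], the complex Hom(Y, N P) is the dual of Hom(P, Y), so exactness of the latter in
    degree [k.+1] passes to the former. *)
Lemma nak_exact_hom k Y (gam : 'Hom(Y, nak (P k.+1))) : out_exact k.+1 Y ->
  is_hom gam -> (nak_map (res_diff P k) \o gam)%VF = 0 ->
  exists2 gam' : 'Hom(Y, nak (P k.+2)), is_hom gam' &
    (nak_map (res_diff P k.+1) \o gam')%VF = gam.
Proof.
move=> ex hg; have pP j : rm_projective (P j) by exact: res_objP.
have [psi <-] := theta_onto (pP k.+1) hg.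
rewrite theta_natl; last exact: res_diff_hom.
move/(theta_eq0 (pP k)) => psi0.
have [|psi' E] := @functional_factor _ _ _ (hom_space (P k.+1) Y)
    (precomp Y (res_diff P k.+1)) psi.
  move=> u /hom_spaceP hu; rewrite precompE => ud.
  have [g hg' ->] := ex u (conj hu ud).
  by have := psi0 g hg'; rewrite comp_lfunE precompE.
exists (theta psi'); first exact: theta_hom.
rewrite theta_natl; last exact: res_diff_hom.
apply: theta_eq => // u hu; rewrite comp_lfunE -E //; exact/hom_spaceP.
Qed.

(** Hom(Y, -) is left exact, so Hom(Y, syz k.+1) is the kernel of Hom(Y, N P_(k+1)) -> Hom(Y, N
    P_k), dual to the cokernel of Hom(P_k, Y) -> Hom(P_(k+1), Y). When [P] ends in degree k+1 that
    cokernel is Ext^(k+1)(X, Y). *)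
Lemma hom_dim_syz k Y :
  (hom_dim Y (syz k.+1) +
     \dim (precomp Y (res_diff P k) @: hom_space (P k) Y))%N
  = hom_dim (P k.+1) Y.
Proof.
have pP j : rm_projective (P j) by exact: res_objP.
pose i := postcomp Y (syz_inj k.+1).
rewrite -(theta_dim (B := (precomp Y (res_diff P k) @: hom_space (P k) Y)%VS)
  (W := (i @: hom_space Y (syz k.+1))%VS) (pP k.+1)).
- congr (_ + _)%N; rewrite limg_dim_eq //.
  apply/eqP; rewrite -subv0; apply/subvP=> f.
  rewrite memv_cap memv_ker postcompE memv0 => /andP[_ /eqP/lfunP f0].
  apply/eqP/lfunP=> y; apply: (@syz_inj_inj k.+1).
  by have := f0 y; rewrite comp_lfunE !zero_lfunE linear0.
- apply/subvP=> _ /memv_imgP[f /hom_spaceP hf ->]; rewrite precompE.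
  by apply/hom_spaceP/is_hom_comp => //; exact: res_diff_hom.
- apply/subvP=> _ /memv_imgP[f /hom_spaceP hf ->]; rewrite postcompE.
  by apply/hom_spaceP/is_hom_comp => //; exact: syz_inj_hom.
move=> psi; have hd : is_hom (res_diff P k) by exact: res_diff_hom.
transitivity (nak_map (res_diff P k) \o theta psi = 0)%VF.
  split=> [/memv_imgP[f _ ->] | E].
    rewrite postcompE comp_lfunA; have -> := syz_injK k.+1; exact: comp_lfun0l.
  have [|g hg <-] := @syz_factor k.+1 _ (theta psi) _ E; first exact: theta_hom.
  by rewrite -postcompE memv_img //; apply/hom_spaceP.
rewrite theta_natl //; split=> [/(theta_eq0
  (pP k)) p0 _ /memv_imgP[h /hom_spaceP hh ->]|p0].
  by have := p0 h hh; rewrite comp_lfunE.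
apply/(theta_eq0 (pP k)) => u hu; rewrite comp_lfunE p0 //.
by rewrite memv_img //; apply/hom_spaceP.
Qed.

End Syzygies.

End Translate.

(** * Dimension shifting *)

Section Shift.
Variables (K : fieldType) (A : falgType K).
Implicit Types X Y Z M N : rmodule A.
Local Notation reg := (rm_reg A).

(** Vanishing along one fixed resolution, since the shifts below chase cocycles on the same [R] in
    neighbouring degrees. *)
Definition Ext_res Y (R : proj_resolution Y) (j : nat) Z : Prop :=
  forall f : 'Hom(R j, Z), cocycle f -> coboundary f.

(** * Segments of the long exact sequence of Ext(Y, -) *)

Section ShortExact.
Variables (Y : rmodule A) (R : proj_resolution Y).
Variables (Z I Z' : rmodule A) (i : 'Hom(Z, I)) (p : 'Hom(I, Z')).
Hypotheses (hi : is_hom i) (i_inj : injective i).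
Hypotheses (hp : is_hom p) (p_onto : forall z, exists y, p y = z).
Hypothesis pi_exact : forall y, p y = 0 <-> exists z, i z = y.

Let pi0 z : p (i z) = 0. Proof. by apply/pi_exact; exists z. Qed.

Lemma short_exact_lift (P : rmodule A) (f : 'Hom(P, Z')) : rm_projective P ->
    is_hom f ->
  exists2 g : 'Hom(P, I), is_hom g & (p \o g)%VF = f.
Proof.
move=> pP hf; apply: proj_lift => // x.
by have [y <-] := p_onto (f x); rewrite memv_img ?memvf.
Qed.

Lemma short_exact_factor (N : rmodule A) (f : 'Hom(N, I)) : is_hom f ->
  (forall x, p (f x) = 0) -> exists2 g : 'Hom(N, Z), is_hom g & (i \o g)%VF = f.
Proof.
move=> hf f0; pose g := (i^-1 \o f)%VF.
have gE x : i (g x) = f x.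
  have /pi_exact[z Ez] := f0 x.
  by rewrite comp_lfunE limg_lfunVK // -Ez memv_img ?memvf.
exists g; last by apply/lfunP=> x; rewrite comp_lfunE gE.
by move=> x a; apply: i_inj; rewrite hi !gE hf.
Qed.

(** Exactness of Hom(Y, I) -> Hom(Y, Z') -> Ext^1(Y, Z) -> Ext^1(Y, I). The start of the sequence is
    not an Ext of positive degree, so surjectivity on Hom replaces the vanishing used in
    [shift_up]. *)
Lemma shift_up1 : Ext_res R 1 I ->
  (forall f : 'Hom(Y, Z'), is_hom f ->
     exists2 g : 'Hom(Y, I), is_hom g & (p \o g)%VF = f) ->
  Ext_res R 1 Z.
Proof.
move=> EI lft f [hf /comp_lfun_eq0P f0].
have [|g hg /comp_lfun_eqP Eg] := EI (i \o f)%VF.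
  split; first exact: is_hom_comp.
  by apply/comp_lfun_eq0P => x; rewrite comp_lfunE f0 linear0.
have [||c hc Ec] := @res_aug_factor _ _ _ R _ (p \o g)%VF.
- exact: is_hom_comp.
- by apply/comp_lfun_eq0P => x; rewrite comp_lfunE -Eg pi0.
have [c' hc' Ec'] := lft c hc.
have hca : is_hom (c' \o res_aug R) by apply/is_hom_comp/res_aug_hom.
have [||k hk Ek] := @short_exact_factor _ (g - (c' \o res_aug R))%VF.
- exact: is_homB.
- move=> x; rewrite add_lfunE opp_lfunE linearB /=.
  by rewrite -!comp_lfunE comp_lfunA Ec' Ec subrr.
exists k => //; apply/lfunP=> x; apply: i_inj.
rewrite comp_lfunE -[i (k _)]comp_lfunE Ek add_lfunE opp_lfunE comp_lfunE.
by rewrite res_augK linear0 subr0 Eg.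
Qed.

Lemma shift_up j : Ext_res R j.+2 I -> Ext_res R j.+1 Z' -> Ext_res R j.+2 Z.
Proof.
move=> EI EZ f [hf /comp_lfun_eq0P f0].
have [|g hg /comp_lfun_eqP Eg] := EI (i \o f)%VF.
  split; first exact: is_hom_comp.
  by apply/comp_lfun_eq0P => x; rewrite comp_lfunE f0 linear0.
have [|c hc Ec] := EZ (p \o g)%VF.
  split; first exact: is_hom_comp.
  by apply/comp_lfun_eq0P => x; rewrite comp_lfunE -Eg pi0.
have [c' hc' Ec'] := short_exact_lift (@res_objP _ _ _ R j) hc.
have hcd : is_hom (c' \o res_diff R j) by apply/is_hom_comp/res_diff_hom.
have [||k hk Ek] := @short_exact_factor _ (g - (c' \o res_diff R j))%VF.
- exact: is_homB.
- move=> x; rewrite add_lfunE opp_lfunE linearB /=.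
  by rewrite -!comp_lfunE comp_lfunA Ec' Ec subrr.
exists k => //; apply/lfunP=> x; apply: i_inj.
rewrite comp_lfunE -[i (k _)]comp_lfunE Ek add_lfunE opp_lfunE comp_lfunE.
by rewrite res_diffK linear0 subr0 Eg.
Qed.

Lemma shift_down j : Ext_res R j.+1 I -> Ext_res R j.+2 Z -> Ext_res R j.+1 Z'.
Proof.
move=> EI EZ f [hf /comp_lfun_eq0P f0].
have [f' hf' Ef'] := short_exact_lift (@res_objP _ _ _ R j.+1) hf.
have hfd : is_hom (f' \o res_diff R j.+1) by apply/is_hom_comp/res_diff_hom.
have [|g hg /comp_lfun_eqP Eg] := short_exact_factor hfd.
  by move=> x; rewrite comp_lfunE -comp_lfunE Ef' f0.
have [|h hh /lfunP Eh] := EZ g.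
  split=> //; apply/comp_lfun_eq0P => x; apply: i_inj.
  by rewrite Eg res_diffK !linear0.
have hih := is_hom_comp hi hh.
have [|k hk Ek] := EI (f' - (i \o h))%VF.
  split; first exact: is_homB.
  apply/comp_lfun_eq0P => x; rewrite add_lfunE opp_lfunE comp_lfunE.
  by rewrite -Eg Eh comp_lfunE subrr.
exists (p \o k)%VF; first exact: is_hom_comp.
rewrite -comp_lfunA -Ek -Ef'; apply/lfunP=> x.
by rewrite !comp_lfunE add_lfunE opp_lfunE linearB /= comp_lfunE pi0 subr0.
Qed.

End ShortExact.

(** N P behaves as an injective module: Hom(-, N P) is the dual of Hom(P, -), which is exact because
    [P] is projective. *)
Lemma Ext_res_nak Y (R : proj_resolution Y)
    (P : rmodule A) j : rm_projective P ->
  Ext_res R j.+1 (nak P).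
Proof.
move=> pP f [hf]; have [psi <-] := theta_onto pP hf.
rewrite theta_natr; last exact: res_diff_hom.
move/(theta_eq0 pP) => psi0.
have [|psi' E] := @functional_factor _ _ _ (hom_space P (R j.+1))
    (postcomp P (res_diff R j)) psi.
  move=> u /hom_spaceP hu; rewrite postcompE => /comp_lfun_eq0P du.
  have [||||v hv <-] := @proj_lift _ _ P _ _ (res_diff R j.+1) u => //.
  - exact: res_diff_hom.
  - by move=> x; rewrite -res_exactS memv_ker du.
  by have := psi0 v hv; rewrite comp_lfunE postcompE.
exists (theta psi'); first exact: theta_hom.
rewrite theta_natr; last exact: res_diff_hom.
by apply: theta_eq => // u /hom_spaceP hu; rewrite comp_lfunE -E.
Qed.

(** * Dimension shifting along the Nakayama complex *)

Section Syz.
Variables (X : rmodule A) (P : proj_resolution X).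

Lemma syz_short_exact k : out_exact P k reg ->
  exists q : 'Hom(nak (P k.+1), syz P k),
  [/\ is_hom q, forall z, exists y, q y = z,
      forall y, q y = 0 <-> exists z, syz_inj P k.+1 z = y &
      (syz_inj P k \o q)%VF = nak_map (res_diff P k)].
Proof.
move=> ex; have [q hq Eq] := syz_proj P k; exists q; split=> // [z | y].
  have /comp_lfun_eq0P/(_ z)/nak_exact := syz_injK P k => /(_ ex)[y Ey].
  by exists y; apply: (@syz_inj_inj _ _ _ P k); rewrite -comp_lfunE Eq.
split=> [q0 | [z <-]].
  by apply: syz_onto => /=; rewrite -Eq comp_lfunE q0 linear0.
apply: (@syz_inj_inj _ _ _ P k); rewrite -comp_lfunE Eq linear0.
by have /comp_lfun_eq0P := syz_injK P k.+1; apply.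
Qed.

(** Induction along 0 -> syz (k+1) -> N P_(k+1) -> syz k -> 0. For i > 1 the vanishing comes from
    degree i-1 at [syz k]; for i = 1 maps Y -> syz k must lift to N P_(k+1), which is dual to
    Ext^k(X, Y) = 0. *)
Lemma Ext_res_syz_up n Y (R : proj_resolution Y) :
  (forall i, (0 < i < n)%N -> Ext_eq0 i X Y) ->
  (forall i, (0 < i < n)%N -> Ext_eq0 i X reg) ->
  forall k, (k <= n)%N -> forall i, (0 < i < k)%N -> Ext_res R i (syz P k).
Proof.
move=> EY Ereg; elim=> [|k IH] lek i //; first by rewrite ltn0 andbF.
case: i => [|i] // /andP[_ lti]; rewrite ltnS in lti.
have lt0k : (0 < k)%N by exact: leq_ltn_trans lti.
have lt0kn : (0 < k < n)%N by rewrite lt0k.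
have ex Z : Ext_eq0 k X Z -> out_exact P k Z.
  by case: (k) lt0k => // k' _; exact: out_exactS.
have [q [hq q_onto q_exact Eq]] := syz_short_exact (ex _ (Ereg k lt0kn)).
have hi := @syz_inj_hom _ _ _ P k.+1; have i_inj := @syz_inj_inj _ _ _ P k.+1.
have EI j : Ext_res R j.+1 (nak (P k.+1)) by apply/Ext_res_nak/res_objP.
case: i lti => [|i] lti; last first.
  by apply: (shift_up hi i_inj hq q_onto q_exact) => //; apply: IH;
    rewrite ?(ltnW lek).
apply: (shift_up1 hi i_inj hq q_exact) => // f hf.
case: (k) lt0k lt0kn ex q hq Eq f hf {IH lek lti q_onto q_exact hi i_inj EI}.
  by [].
move=> k' _ lt0kn ex q hq Eq f hf.
have hif := is_hom_comp (@syz_inj_hom _ _ _ P k'.+1) hf.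
have [|g hg Eg] := nak_exact_hom (ex _ (EY _ lt0kn)) hif.
  by rewrite comp_lfunA [X in (X \o f)%VF](syz_injK P k'.+1) comp_lfun0l.
exists g => //; apply/lfunP=> y; apply: (@syz_inj_inj _ _ _ P k'.+1).
by rewrite comp_lfunE -comp_lfunE Eq -!comp_lfunE Eg.
Qed.

(** The start is Ext^(n+1)(Y, syz n) = 0, immediate from R_(n+1) = 0; each short exact sequence then
    lowers both the degree and the index of the kernel by one. *)
Lemma Ext_res_syz_down n Y (R : proj_resolution Y) :
  (forall i, (0 < i < n)%N -> Ext_eq0 i X reg) -> rm_zero (R n.+1) ->
  Ext_res R 1 (syz P 0).
Proof.
move=> Ereg R0; suff: forall d, (d <= n)%N ->
  Ext_res R (n - d).+1 (syz P (n - d)).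
  by move/(_ n (leqnn n)); rewrite subnn.
elim=> [|d IH] ltd.
  rewrite subn0 => f _; exists 0; first exact: is_hom0.
  by apply/lfunP=> x; rewrite (R0 x) !linear0.
have [k Ek] : exists k, k = (n - d.+1)%N by exists (n - d.+1)%N.
have {}IH := IH (ltnW ltd); have Ek' : (n - d = k.+1)%N by lia.
rewrite -Ek; rewrite Ek' in IH.
have ex : out_exact P k reg.
  by case: (k) Ek => [|k'] Ek; [exact: out_exact0 | apply/out_exactS/Ereg; lia].
have [q [hq q_onto q_exact Eq]] := syz_short_exact ex.
have hi := @syz_inj_hom _ _ _ P k.+1; have i_inj := @syz_inj_inj _ _ _ P k.+1.
apply: (shift_down hi i_inj hq q_onto q_exact) IH.
by apply/Ext_res_nak/res_objP.
Qed.

End Syz.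

(** * Idempotents, and maps from a nonprojective module to [A] *)

Lemma rm_projective_retract (P X : rmodule A) (p : 'Hom(P, X))
    (s : 'Hom(X, P)) :
  rm_projective P -> is_hom p -> is_hom s -> (p \o s = \1)%VF ->
  rm_projective X.
Proof.
move=> pP hp hs ps M N g f hg gs hf.
have [h hh Eh] := pP _ _ g (f \o p)%VF hg gs (is_hom_comp hf hp).
exists (h \o s)%VF; first exact: is_hom_comp.
by rewrite comp_lfunA Eh -comp_lfunA ps comp_lfun1r.
Qed.

Lemma indec_idempotent X (f : 'Hom(X, X)) : rm_indecomposable X -> is_hom f ->
  (f \o f = f)%VF -> f = 0 \/ f = \1%VF.
Proof.
move=> [_ indX] hf /lfunP ff.
have {}ff x : f (f x) = f x by have := ff x; rewrite comp_lfunE.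
pose U : rmodule A := rm_sub (img_stable hf).
pose V : rmodule A := rm_sub (ker_stable hf).
have [u hu Eu] := sub_factor (img_stable hf) hf (fun x => memv_img f (memvf x)).
have [|v hv Ev] := @sub_factor _ _ _ _ (ker_stable hf) _ _ (is_homB
    (@is_hom1 _ _ X) hf).
  by move=> x; rewrite memv_ker add_lfunE opp_lfunE id_lfunE linearB /= ff subrr.
have {}Eu x : sub_inj (img_stable hf) (u x) = f x by rewrite -comp_lfunE Eu.
have {}Ev x : sub_inj (ker_stable hf) (v x) = x - f x.
  by rewrite -comp_lfunE Ev add_lfunE opp_lfunE id_lfunE.
pose w : 'Hom(X, rm_sum U V) := linfun (fun x => (u x, v x)).
have wE x : w x = (u x, v x).
  by apply: linfun_linear => c y z; rewrite !linearP.
have /indX [U0|V0] : rm_iso X (rm_sum U V).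
- exists w; split=> [x a|]; first by rewrite !wE hu hv.
  exists (fun z : rm_sum U V =>
      sub_inj (img_stable hf) z.1 + sub_inj (ker_stable hf) z.2) => [x|[y z]].
    by rewrite wE /= Eu Ev addrC subrK.
  rewrite wE /=; have /memv_imgP[x _ Ex] := sub_inj_mem y.
  have := sub_inj_mem z; rewrite memv_ker => /eqP fz.
  have Ey : f (sub_inj (img_stable hf) y) = sub_inj (img_stable hf) y.
    by rewrite Ex ff.
  congr (_, _); apply: sub_inj_inj.
    by rewrite Eu linearD /= fz addr0.
  by rewrite Ev linearD /= fz addr0 Ey addrC addKr.
- left; apply/lfunP=> x; rewrite -Eu.
  by rewrite (U0 (u x)) linear0 zero_lfunE.
right; apply/lfunP=> x; apply/esym/eqP; rewrite -subr_eq0 id_lfunE -Ev.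
by rewrite (V0 (v x)) linear0.
Qed.

(* The surjection [N P_0 -> N X] splits; the resulting idempotent of [N P_0]
   comes from an idempotent of [P_0] that factors through [X]. *)
Lemma hom_reg_eq0 n X (P : proj_resolution X) :
  rm_indecomposable X -> ~ rm_projective X ->
  (forall i, (0 < i < n)%N -> Ext_eq0 i X reg) -> pdim_le (nak X) n ->
  forall h : 'Hom(X, reg), is_hom h -> h = 0.
Proof.
move=> indX npX Ereg [R R0].
(* This is Ext^1(N X, ker (N P_0 -> N X)) = 0, the obstruction group for splitting N P_0 -> N X. *)
have ES := @Ext_res_syz_down _ P n _ R Ereg (R0 n.+1 (leqnn _)).
pose e := res_aug P; have he : is_hom e by exact: res_aug_hom.
have e_onto phi : exists psi, nak_map e psi = phi.
  pose f : 'Hom('Hom(X, reg), K^o) := linfun (nak_ev phi).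
  have fE h : f h = nak_ev phi h by apply: linfun_linear; exact: nak_evP.
  have [|psi' E] := @functional_factor _ _ _ (hom_space X reg)
      (precomp reg e) f.
    move=> h hh; rewrite precompE => /comp_lfun_eq0P h0.
    suff -> : h = 0 by rewrite linear0.
    by apply/lfunP=> x; have [y <-] := res_aug_onto P x; rewrite h0 zero_lfunE.
  exists (nak_of psi'); apply: nak_ext => h hh; rewrite nak_mapE // nak_ofE.
    by rewrite -precompE -E ?fE //; apply/hom_spaceP.
  exact: is_hom_comp.
have pP j : rm_projective (P j) by exact: res_objP.
have hN : is_hom (nak_map e) by exact: nak_map_hom.
have [||||t ht Et] := @proj_lift _ _ (R 0) _ _ (nak_map e) (res_aug R).
- exact: res_objP.
- exact: hN.
- exact: res_aug_hom.
- by move=> x; have [y <-] := e_onto (res_aug R x); rewrite memv_img ?memvf.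
(* [t \o res_diff R 0] lands in the kernel [syz P 0] and gives the obstruction cocycle [g]. Writing
   [g] as a coboundary of [k] corrects [t] into a map that descends to the section [s]. *)
have htd : is_hom (t \o res_diff R 0) by apply/is_hom_comp/res_diff_hom.
have [|g hg Eg] := @syz_factor _ _ _ P 0 _ _ htd.
  by apply/comp_lfun_eq0P=> x; rewrite comp_lfunE -comp_lfunE Et res_augK.
have [|k hk Ek] := ES g.
  split=> //; apply/comp_lfun_eq0P=> x; apply: (@syz_inj_inj _ _ _ P 0).
  by rewrite -comp_lfunE Eg comp_lfunE res_diffK !linear0.
have hik := is_hom_comp (@syz_inj_hom _ _ _ P 0) hk.
have [||s hs Es] := @res_aug_factor _ _ _ R _ (t - (syz_inj P 0 \o k))%VF.
- exact: is_homB.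
- apply/comp_lfun_eq0P=> x; rewrite add_lfunE opp_lfunE comp_lfunE.
  by rewrite -[t _]comp_lfunE -Eg Ek !comp_lfunE subrr.
have es : (nak_map e \o s = \1)%VF.
  apply/lfunP=> x; have [y <-] := res_aug_onto R x.
  rewrite comp_lfunE -[s _]comp_lfunE Es add_lfunE opp_lfunE linearB /=.
  rewrite id_lfunE -[nak_map e (t y)]comp_lfunE Et comp_lfunE.
  by have /comp_lfun_eq0P-> := syz_injK P 0; rewrite subr0.
have [f hf Ef] := nak_full (pP 0) (pP 0) (is_hom_comp hs hN).
have [|u hu Eu] := res_aug_factor (P := P) hf.
  apply: nak_map_eq0 => //; first by apply: is_hom_comp => //;
    exact: res_diff_hom.
  rewrite nak_map_comp // Ef -comp_lfunA.
  by rewrite [X in (s \o X)%VF](nak_res_outK P 0) comp_lfun0r.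
have ff : (f \o f = f)%VF.
  apply/eqP; rewrite -subr_eq0; apply/eqP.
  apply: (nak_map_eq0 (pP 0)); first exact: is_homB (is_hom_comp _ _) _.
  rewrite addrC -scaleN1r nak_map_linear scaleN1r nak_map_comp // Ef.
  have -> : ((s \o nak_map e) \o (s \o nak_map e) = s \o nak_map e)%VF.
    by rewrite -comp_lfunA [(nak_map e \o _)%VF]comp_lfunA es comp_lfun1l.
  by rewrite addNr.
have heu : is_hom (e \o u)%VF by exact: is_hom_comp.
have uE z : u (e z) = f z by rewrite -Eu comp_lfunE.
(* If the idempotent e u of [X] is 0, then f = 0, so N X = 0 and Hom(X, A) = 0. If it is the
   identity, [X] is a retract of P_0, which is excluded. *)
have [|eu0|eu1] := indec_idempotent indX heu.
- apply/lfunP=> x; have [y <-] := res_aug_onto P x; rewrite !comp_lfunE.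
  rewrite (uE y) (uE (f y)) -[f (f y)]comp_lfunE ff //.
- move=> h hh; have f0 : f = 0.
    by rewrite -ff -Eu comp_lfunA -[X in
      (X \o e)%VF]comp_lfunA eu0 comp_lfun0r comp_lfun0l.
  have N1 : \1%VF = 0 :> 'Hom(nak X, nak X).
    rewrite -es -[s]comp_lfun1r -es [X in
      (_ \o X)%VF]comp_lfunA -Ef f0 nak_map0.
    by rewrite comp_lfun0l comp_lfun0r.
  have : h \in 0%VS.
    apply: functional_sep => psi _.
    have /lfunP/(_ (nak_of psi)) := N1; rewrite id_lfunE zero_lfunE.
    by move/(congr1 (fun phi => nak_ev phi h)); rewrite nak_ev0 nak_ofE.
  by rewrite memv0 => /eqP.
by case: npX; exact: (rm_projective_retract (pP 0) he hu eu1).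
Qed.

End Shift.

(** * The higher translate as a functor *)

Section TauFunctor.
Variables (K : fieldType) (A : falgType K) (m : nat).
Implicit Types X Y Z M N : rmodule A.
Local Notation reg := (rm_reg A).
Local Notation T P := (syz P m.+1).
Local Notation inj P := (syz_inj P m.+1).

(** The action of T on maps, with n = m.+1. The lift [F] is determined only up to homotopy, so [f]
    is related to every map that some lift induces on the kernels, without a choice. *)
Definition tau_rel X Y (P : proj_resolution X) (R : proj_resolution Y)
    (f : 'Hom(X, Y)) (g : 'Hom(T P, T R)) : Prop :=
  is_hom g /\ exists2 F : 'Hom(P m.+1, R m.+1), chain_lift f F &
    (inj R \o g = nak_map F \o inj P)%VF.

Lemma tau_rel_ex X Y (P : proj_resolution X) (R : proj_resolution Y)
    (f : 'Hom(X, Y)) : is_hom f -> exists g, @tau_rel X Y P R f g.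
Proof.
move=> hf; have [F lF] := @chain_lift_ex _ _ _ _ P R f m.+1 hf.
have hF := chain_lift_hom lF; have [_ [G lG EG]] := lF.
have [||g hg Eg] := @syz_factor _ _ _ R m.+1 _ (nak_map F \o inj P)%VF.
- by apply: is_hom_comp; [exact: nak_map_hom | exact: syz_inj_hom].
- rewrite comp_lfunA /= -nak_map_comp; last exact: res_diff_hom.
  rewrite EG nak_map_comp; last exact: chain_lift_hom lG.
  by rewrite -comp_lfunA [X in (_ \o X)%VF](syz_injK P m.+1) comp_lfun0r.
by exists g; split=> //; exists F.
Qed.

Lemma tau_rel_linear X Y (P : proj_resolution X)
    (R : proj_resolution Y) c f f' g g' :
  @tau_rel X Y P R f g -> @tau_rel X Y P R f' g' ->
  tau_rel (c *: f + f') (c *: g + g').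
Proof.
move=> [hg [F lF EF]] [hg' [F' lF' EF']]; split;
  first exact: is_homD (is_homZ _ _) _.
exists (c *: F + F'); first exact: chain_liftD (chain_liftZ _ _) _.
by rewrite nak_map_linear comp_lfunDl comp_lfunDr -comp_lfunZl -comp_lfunZr EF EF'.
Qed.

Lemma tau_relB X Y (P : proj_resolution X) (R : proj_resolution Y) f f' g g' :
  @tau_rel X Y P R f g -> @tau_rel X Y P R f' g' -> tau_rel (f - f') (g - g').
Proof.
by move=> t t'; have := tau_rel_linear (-1) t' t;
  rewrite !scaleN1r ![- _ + _]addrC.
Qed.

Lemma tau_rel0 X Y (P : proj_resolution X) (R : proj_resolution Y) :
  @tau_rel X Y P R 0 0.
Proof.
split; first exact: is_hom0.
by exists 0; [exact: chain_lift0 | rewrite nak_map0 comp_lfun0l comp_lfun0r].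
Qed.

Lemma tau_rel1 X (P : proj_resolution X) : @tau_rel X X P P \1%VF \1%VF.
Proof.
split; first exact: is_hom1.
by exists \1%VF; [exact: chain_lift1 |
  rewrite nak_map1 comp_lfun1l comp_lfun1r].
Qed.

Lemma tau_rel_comp X Y Z (P : proj_resolution X) (R : proj_resolution Y)
    (S : proj_resolution Z) f f' g g' :
  @tau_rel X Y P R f g -> @tau_rel Y Z R S f' g' -> 
  tau_rel (f' \o f)%VF (g' \o g)%VF.
Proof.
move=> [hg [F lF EF]] [hg' [F' lF' EF']]; split; first exact: is_hom_comp.
exists (F' \o F)%VF; first exact: chain_lift_comp lF lF'.
rewrite nak_map_comp; last exact: chain_lift_hom lF'.
by rewrite -comp_lfunA -EF !comp_lfunA EF'.
Qed.

Lemma retract_reg_proj Q : rm_projective Q -> retract reg Q.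
Proof.
move=> /proj_dual_basis[k [p [f [hf def_p]]]].
exists k, f, (fun i => orbit_map (p i)); split=> // [i|];
  first exact: orbit_map_hom.
apply/lfunP=> x; rewrite sum_lfunE id_lfunE [RHS]def_p.
by apply: eq_bigr => i _; rewrite comp_lfunE orbit_mapE.
Qed.

(** * Faithfulness and fullness of the translate *)

Section Faithful.
Variables (X : rmodule A) (P : proj_resolution X).
Hypothesis Ereg : forall i, (0 < i < m.+1)%N -> Ext_eq0 i X reg.
Hypothesis hom0 : forall h : 'Hom(X, reg), is_hom h -> h = 0.

Lemma hom_proj_eq0 (Q : rmodule A) (h : 'Hom(X, Q)) : rm_projective Q ->
    is_hom h -> h = 0.
Proof.
move=> /retract_reg_proj[k [a [b [ha hb ab]]]] hh.
rewrite -[h]comp_lfun1l -ab comp_lfun_suml big1 // => i _.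
by rewrite -comp_lfunA (hom0 (is_hom_comp (ha i) hh)) comp_lfun0r.
Qed.

(** If F = h d + d s, then G - d h is a cocycle one degree lower. In positive degree Ext(X,
    projective) = 0 writes it as t d, an identity of the same shape for [G]; in degree 0 it factors
    through a map from [X] to a projective, which is zero, so that f = 0. *)
Lemma chain_lift_null_homotopic Y (R : proj_resolution Y) (f : 'Hom(X, Y)) k
    (F : 'Hom(P k.+1, R k.+1)) (h : 'Hom(P k, R k.+1))
      (s : 'Hom(P k.+1, R k.+2)) :
  (k <= m)%N -> is_hom h -> chain_lift f F ->
  F = ((h \o res_diff P k) + (res_diff R k.+1 \o s))%VF -> f = 0.
Proof.
have step j (F' : 'Hom(P j.+1, R j.+1)) (G : 'Hom(P j, R j)) h' s' :
    is_hom h' -> chain_lift f G ->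
      (res_diff R j \o F' = G \o res_diff P j)%VF ->
    F' = ((h' \o res_diff P j) + (res_diff R j.+1 \o s'))%VF ->
    cocycle (G - (res_diff R j \o h'))%VF.
  move=> hh lG /comp_lfun_eqP EG EF; split.
    by apply: is_homB (chain_lift_hom lG) (is_hom_comp _ hh);
      exact: res_diff_hom.
  apply/comp_lfun_eq0P => x; rewrite add_lfunE opp_lfunE -EG EF add_lfunE.
  by rewrite !comp_lfunE linearD /= res_diffK addr0 subrr.
elim: k F h s => [|k IH] F h s lek hh [hF [G lG EG]] EF.
  have [hGdh cG] := step 0 F G h s hh lG EG EF.
  have [t ht Et] := res_aug_factor hGdh cG.
  have t0 : t = 0 by apply: hom_proj_eq0 ht; exact: res_objP.
  have EG' : G = (res_diff R 0 \o h)%VF.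
    by apply/eqP; rewrite -subr_eq0 -Et t0 comp_lfun0l.
  apply/lfunP=> x; have [y <-] := res_aug_onto P x; rewrite zero_lfunE.
  have [_ /comp_lfun_eqP <-] := lG.
  by rewrite EG' comp_lfunE res_augK.
have Ek : Ext_eq0 k.+1 X (R k.+1).
  apply: (@Ext_eq0_retractr _ _ _ reg); first exact/retract_reg_proj/res_objP.
  by apply: Ereg; rewrite ltnS.
have [t ht Et] := Ek P _ (step k.+1 F G h s hh lG EG EF).
apply: (IH G t h (ltnW lek) ht lG).
by rewrite -Et subrK.
Qed.

(** T f = 0 says that N F vanishes on ker (N P_n -> N P_(n-1)). Dually, [u \o F] factors through the
    differential for each u : R_n -> A, and a dual basis of R_n gives F = H d, where the descent
    starts. *)
Lemma tau_rel_faithful Y (R : proj_resolution Y) f : @tau_rel X Y P R f 0 ->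
    f = 0.
Proof.
move=> [_ [F lF]]; rewrite comp_lfun0r => /esym/comp_lfun_eq0P N0.
have hF := chain_lift_hom lF.
have FB (u : 'Hom(R m.+1, reg)) : is_hom u ->
    exists h : 'Hom(P m, reg), is_hom h /\ (u \o F = h \o res_diff P m)%VF.
  move=> hu.
  have : (u \o F)%VF \in (precomp reg (res_diff P m) @: hom_space (P m) reg)%VS.
    (* A functional that kills the image of Hom(P_m, A) is an element of the translate of [X], and
       there [N0] applies. *)
    apply: functional_sep => psi psi0.
    have [|z Ez] := @syz_onto _ _ _ P m.+1 (nak_of psi).
      apply: nak_ext => h hh; rewrite nak_mapE // nak_ev0 nak_ofE.
        by rewrite -precompE psi0 // memv_img //; apply/hom_spaceP.
      by apply: is_hom_comp => //; exact: res_diff_hom.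
    have := N0 z; rewrite Ez => /(congr1 (fun phi => nak_ev phi u)).
    by rewrite nak_mapE // nak_ev0 nak_ofE //; exact: is_hom_comp.
  by case/memv_imgP=> h /hom_spaceP hh ->; exists h; rewrite precompE.
have [k [a [b [ha hb ab]]]] := retract_reg_proj (@res_objP _ _ _ R m.+1).
have /fin_all_exists[h hE] i := FB (a i) (ha i).
pose H := \sum_i (b i \o h i)%VF.
have hH : is_hom H by apply: is_hom_sum => i;
    apply: is_hom_comp (hb i) (hE i).1.
apply: (@chain_lift_null_homotopic _ R f m F H 0) => //.
rewrite comp_lfun0r addr0 -[F]comp_lfun1l -ab /H !comp_lfun_suml.
by apply: eq_bigr => i _; rewrite -!comp_lfunA (hE i).2.
Qed.

(** Choose images of a basis of Hom(X, Y). Faithfulness makes them linearly independent, and the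
    equality of dimensions makes them a basis of Hom(T X, T Y). *)
Lemma tau_rel_full Y (R : proj_resolution Y) (g : 'Hom(T P, T R)) :
  hom_dim X Y = hom_dim (T P) (T R) -> is_hom g ->
  exists2 f, is_hom f & @tau_rel X Y P R f g.
Proof.
move=> dXY hg; pose k := \dim (hom_space X Y).
pose b (i : 'I_k) : 'Hom(X, Y) := (vbasis (hom_space X Y))`_i.
have hb i : is_hom (b i).
  by apply/hom_spaceP; apply: vbasis_mem; rewrite mem_nth // size_tuple.
have /fin_all_exists[t tE] i := tau_rel_ex P R (hb i).
have tS (c : 'I_k -> K) : tau_rel (\sum_i c i *: b i) (\sum_i c i *: t i).
  elim/big_rec2: _ => [|i x y _ xy]; first exact: tau_rel0.
  exact: tau_rel_linear.
have free_t : free [tuple t i | i < k].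
  apply/freeP => c; under eq_bigr do rewrite -tnth_nth tnth_mktuple.
  move=> c0; have := tS c; rewrite c0 => /tau_rel_faithful b0.
  have /freeP := basis_free (vbasisP (hom_space X Y)); apply.
  exact: b0.
have : g \in <<[tuple t i | i < k]>>%VS.
  suff -> : (<<[tuple t i | i < k]>> = hom_space (T P)
    (T R))%VS by apply/hom_spaceP.
  apply/eqP; rewrite eqEdim; apply/andP; split.
    apply/span_subvP=> _ /mapP[i _ ->]; apply/hom_spaceP; exact: (tE i).1.
  by move: free_t; rewrite /free => /eqP->;
    rewrite size_tuple -/(hom_dim _ _) -dXY.
move/coord_span=> ->; pose c i := coord [tuple t i | i < k] i g.
exists (\sum_i c i *: b i).
  by apply: is_hom_sum => i; apply: is_homZ.
have := tS c; congr tau_rel; apply: eq_bigr => i _.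
by rewrite -tnth_nth tnth_mktuple.
Qed.

End Faithful.

End TauFunctor.

(** * Euler characteristics *)

Section HomDim.
Variables (K : fieldType) (A : falgType K).
Implicit Types X Y Z M N : rmodule A.

Lemma precomp_linear (V1 V2 W : vectType K) (d : 'Hom(V1, V2)) :
  linear (fun h : 'Hom(V2, W) => (h \o d)%VF).
Proof. by move=> c f g; rewrite comp_lfunDl -comp_lfunZl. Qed.

Lemma postcomp_linear (U V1 V2 : vectType K) (d : 'Hom(V1, V2)) :
  linear (fun h : 'Hom(U, V1) => (d \o h)%VF).
Proof. by move=> c f g; rewrite comp_lfunDr -comp_lfunZr. Qed.

Lemma dim_bij (V W : vectType K) (f : V ->
    W) (U : {vspace V}) (I : {vspace W}) :
  linear f ->
  (forall v, v \in U -> f v = 0 -> v = 0) ->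
  (forall w, w \in I <-> exists2 v, v \in U & f v = w) -> \dim U = \dim I.
Proof.
move=> lf f0 IP; rewrite -(rank_nullity (N := 0%VS) lf _ IP) ?dimv0 // => v.
rewrite memv0; split=> [/eqP-> | [vU fv]]; last by apply/eqP/f0.
split; first exact: mem0v.
by have := lf (-1) 0 0; rewrite scaler0 addr0 scaleN1r addNr.
Qed.

Section Biproduct.
Variables X X1 X2 : rmodule A.
Variables (i1 : 'Hom(X1, X)) (p1 : 'Hom(X, X1)) (i2 : 'Hom(X2, X))
  (p2 : 'Hom(X, X2)).
Hypotheses (hi1 : is_hom i1) (hp1 : is_hom p1) (hi2 : is_hom i2)
  (hp2 : is_hom p2).
Hypotheses (pi1 : (p1 \o i1 = \1)%VF) (pi2 : (p2 \o i2 = \1)%VF).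
Hypotheses (pi12 : (p1 \o i2 = 0)%VF) (pi21 : (p2 \o i1 = 0)%VF).
Hypothesis ip : ((i1 \o p1) + (i2 \o p2) = \1)%VF.

Lemma hom_dim_biprodl Z : hom_dim X Z = (hom_dim X1 Z + hom_dim X2 Z)%N.
Proof.
have [N NP] := ker_ex (hom_space X Z) (precomp_linear (W := Z) i1).
have <- : \dim N = hom_dim X2 Z.
  apply: (dim_bij (precomp_linear (W := Z) i2)) => [f /NP[_ f1] f2 | g].
    by rewrite -[f]comp_lfun1r -ip comp_lfunDr !comp_lfunA f1 f2 !comp_lfun0l addr0.
  split=> [/hom_spaceP hg | [f /NP[/hom_spaceP hf _] <-]]; last first.
    by apply/hom_spaceP/is_hom_comp.
  exists (g \o p2)%VF; last by rewrite -comp_lfunA pi2 comp_lfun1r.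
  apply/NP; split; first by apply/hom_spaceP/is_hom_comp.
  by rewrite -comp_lfunA pi21 comp_lfun0r.
rewrite addnC; apply/esym/(rank_nullity (precomp_linear (W := Z) i1) NP) => g.
split=> [/hom_spaceP hg | [f /hom_spaceP hf <-]];
  last by apply/hom_spaceP/is_hom_comp.
exists (g \o p1)%VF; last by rewrite -comp_lfunA pi1 comp_lfun1r.
by apply/hom_spaceP/is_hom_comp.
Qed.

Lemma hom_dim_biprodr Z : hom_dim Z X = (hom_dim Z X1 + hom_dim Z X2)%N.
Proof.
have [N NP] := ker_ex (hom_space Z X) (postcomp_linear (U := Z) p1).
have <- : \dim N = hom_dim Z X2.
  apply: (dim_bij (postcomp_linear (U := Z) p2)) => [f /NP[_ f1] f2 | g].
    by rewrite -[f]comp_lfun1l -ip comp_lfunDl -!comp_lfunA f1 f2 !comp_lfun0r addr0.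
  split=> [/hom_spaceP hg | [f /NP[/hom_spaceP hf _] <-]]; last first.
    by apply/hom_spaceP/is_hom_comp.
  exists (i2 \o g)%VF; last by rewrite comp_lfunA pi2 comp_lfun1l.
  apply/NP; split; first by apply/hom_spaceP/is_hom_comp.
  by rewrite comp_lfunA pi12 comp_lfun0l.
rewrite addnC; apply/esym/(rank_nullity (postcomp_linear (U := Z) p1) NP) => g.
split=> [/hom_spaceP hg | [f /hom_spaceP hf <-]];
  last by apply/hom_spaceP/is_hom_comp.
exists (i1 \o g)%VF; last by rewrite comp_lfunA pi1 comp_lfun1l.
by apply/hom_spaceP/is_hom_comp.
Qed.

End Biproduct.

Lemma split_biprod X X1 (i1 : 'Hom(X1, X)) (p1 : 'Hom(X, X1)) :
  is_hom i1 -> is_hom p1 -> (p1 \o i1 = \1)%VF ->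
  exists X2 (i2 : 'Hom(X2, X)) (p2 : 'Hom(X, X2)),
    [/\ is_hom i2, is_hom p2, (p2 \o i2 = \1)%VF,
        (p1 \o i2 = 0 /\ p2 \o i1 = 0)%VF & ((i1 \o p1) + (i2 \o p2) = \1)%VF].
Proof.
move=> hi hp pi; pose st := ker_stable hp.
have p0 (z : rm_sub st) : p1 (sub_inj st z) = 0.
  by apply/eqP; rewrite -memv_ker; exact: sub_inj_mem.
have [|x|q hq Eq] := @sub_factor _ _ _ _ st X (\1 - (i1 \o p1))%VF.
- by apply: is_homB (@is_hom1 _ _ X) (is_hom_comp hi hp).
- rewrite memv_ker add_lfunE opp_lfunE id_lfunE comp_lfunE linearB /=.
  by rewrite -[p1 (i1 _)]comp_lfunE pi id_lfunE subrr.
exists (rm_sub st), (sub_inj st), q; split=> //; first exact: sub_inj_hom.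
- apply/lfunP=> z; apply: sub_inj_inj; rewrite comp_lfunE -[LHS]comp_lfunE Eq.
  by rewrite add_lfunE opp_lfunE !id_lfunE comp_lfunE p0 linear0 subr0.
- split; first by apply/comp_lfun_eq0P.
  apply/lfunP=> x; apply: sub_inj_inj; rewrite comp_lfunE -[LHS]comp_lfunE Eq.
  rewrite add_lfunE opp_lfunE id_lfunE comp_lfunE -[p1 _]comp_lfunE pi.
  by rewrite id_lfunE subrr zero_lfunE linear0.
by rewrite Eq addrC subrK.
Qed.

Lemma hom_dim_zerol X Z : rm_zero X -> hom_dim X Z = 0%N.
Proof.
move=> X0; apply/eqP; rewrite dimv_eq0 -subv0; apply/subvP=> f _.
by rewrite memv0; apply/eqP/lfunP=> x; rewrite (X0 x) !linear0.
Qed.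

Lemma hom_dim_zeror X Z : rm_zero X -> hom_dim Z X = 0%N.
Proof.
move=> X0; apply/eqP; rewrite dimv_eq0 -subv0; apply/subvP=> f _.
by rewrite memv0; apply/eqP/lfunP=> z; rewrite (X0 (f z)) zero_lfunE.
Qed.

Lemma hom_dim_isor X Y Z : rm_iso X Y -> hom_dim Z X = hom_dim Z Y.
Proof.
move/rm_iso_inv=> [f [g [hf hg gf fg]]].
apply: (dim_bij (postcomp_linear (U := Z) f)) => [h _ h0 | k].
  by rewrite -[h]comp_lfun1l -gf -comp_lfunA h0 comp_lfun0r.
split=> [/hom_spaceP hk | [h /hom_spaceP hh <-]];
  last by apply/hom_spaceP/is_hom_comp.
exists (g \o k)%VF; last by rewrite comp_lfunA fg comp_lfun1l.
by apply/hom_spaceP/is_hom_comp.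
Qed.

Lemma hom_dim_isol X Y Z : rm_iso X Y -> hom_dim X Z = hom_dim Y Z.
Proof.
move/rm_iso_inv=> [f [g [hf hg gf fg]]].
apply: (dim_bij (precomp_linear (W := Z) g)) => [h _ h0 | k].
  by rewrite -[h]comp_lfun1r -gf comp_lfunA h0 comp_lfun0l.
split=> [/hom_spaceP hk | [h /hom_spaceP hh <-]];
  last by apply/hom_spaceP/is_hom_comp.
exists (k \o f)%VF; last by rewrite -comp_lfunA fg comp_lfun1r.
by apply/hom_spaceP/is_hom_comp.
Qed.

Lemma hom_dim_gt0 X Y (f : 'Hom(X, Y)) : is_hom f -> f <> 0 ->
    (0 < hom_dim X Y)%N.
Proof.
move=> /hom_spaceP hf f0; rewrite lt0n dimv_eq0; apply/eqP=> E.
by apply: f0; apply/eqP; rewrite -memv0 -E.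
Qed.

Lemma hom_dim_neq0 X Y : hom_dim X Y <> 0%N ->
    exists2 f : 'Hom(X, Y), is_hom f & f <> 0.
Proof.
move/eqP; rewrite dimv_eq0 -vpick0 => /eqP f0.
by exists (vpick (hom_space X Y)); first exact/hom_spaceP/memv_pick.
Qed.

Lemma alternating_telescope (a w : nat -> nat) n :
  (forall i, (i < n)%N -> a i = (w i + w i.+1)%N) ->
  \sum_(i < n) (-1) ^+ i * (a i)%:Z = (w 0%N)%:Z - (-1) ^+ n * (w n)%:Z.
Proof.
elim: n => [|n IH] aE; first by rewrite big_ord0 expr0 mul1r subrr.
rewrite big_ord_recr /= IH => [|i lti]; last by apply: aE; rewrite ltnS ltnW.
by rewrite aE // PoszD exprS; ring.
Qed.

(** * Alternating sums along a resolution *)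

Section EulerChar.
Variables (X : rmodule A) (P : proj_resolution X) (m : nat).

Lemma euler_char_proj Q : rm_projective Q -> rm_zero (P m.+2) ->
  \sum_(i < m.+2) (-1) ^+ i * (hom_dim Q (P i))%:Z = (hom_dim Q X)%:Z.
Proof.
(* [w i] is the rank of the map leaving degree i after applying Hom(Q, -). Since Hom(Q, -) is exact,
   its kernel has dimension [w i.+1], and the telescope leaves w 0 = dim Hom(Q, X). *)
move=> pQ P0; pose w i := \dim (postcomp Q (res_out P i) @: hom_space Q (P i)).
have w0 : w 0%N = hom_dim Q X.
  congr (\dim _); apply/vspaceP=> f;
    apply/memv_imgP/idP=> [[g /hom_spaceP hg ->] | /hom_spaceP hf].
    by rewrite postcompE; apply/hom_spaceP/is_hom_comp => //;
      exact: res_out_hom.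
  have [||||g hg Eg] := @proj_lift _ _ Q _ _ (res_aug P) f => //.
  - exact: res_aug_hom.
  - by move=> x; rewrite res_aug_surj memvf.
  by exists g; [exact/hom_spaceP | rewrite postcompE -Eg].
have wn : w m.+2 = 0%N.
  apply/eqP; rewrite dimv_eq0 -subv0; apply/subvP=> _ /memv_imgP[f _ ->].
  rewrite memv0 postcompE; apply/eqP/lfunP=> x.
  by rewrite comp_lfunE (P0 (f x)) linear0 zero_lfunE.
rewrite (@alternating_telescope (fun i => hom_dim Q
  (P i)) w) ?w0 ?wn ?mulr0 ?subr0 // => i _.
rewrite /hom_dim -(limg_ker_dim (postcomp Q (res_out P i))) addnC;
  congr (_ + _)%N.
congr (\dim _); apply/vspaceP=> f; rewrite memv_cap memv_ker postcompE.
apply/andP/memv_imgP=> [[/hom_spaceP hf /eqP/comp_lfun_eq0P f0] |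
  [g /hom_spaceP hg ->]].
  have [||||g hg Eg] := @proj_lift _ _ Q _ _ (res_diff P i) f => //.
  - exact: res_diff_hom.
  - by move=> x; rewrite -res_out_exact memv_ker f0.
  by exists g; [exact/hom_spaceP | rewrite postcompE -Eg].
rewrite postcompE /= comp_lfunA res_outK comp_lfun0l; split=> //.
by apply/hom_spaceP/is_hom_comp => //; exact: res_diff_hom.
Qed.

(* With no intermediate [Ext], the alternating sum keeps only [Hom] and the top
   [Ext], which is dual to [Hom(Y, syz P m.+1)]. *)
Lemma euler_char_hom Y : (forall i, (0 < i < m.+1)%N -> Ext_eq0 i X Y) ->
  \sum_(i < m.+2) (-1) ^+ i * (hom_dim (P i) Y)%:Z
    = (hom_dim X Y)%:Z + (-1) ^+ m.+1 * (hom_dim Y (syz P m.+1))%:Z.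
Proof.
move=> E0.
pose b i := \dim (precomp Y (res_out P i) @: hom_space (res_tgt P i) Y).
have b0 : b 0%N = hom_dim X Y.
  apply: limg_dim_eq; apply/eqP; rewrite -subv0; apply/subvP=> f.
  rewrite memv_cap memv_ker precompE memv0 => /andP[_ /eqP/comp_lfun_eq0P f0].
  by apply/eqP/lfunP=> x; have [y <-] := res_aug_onto P x;
    rewrite f0 zero_lfunE.
rewrite big_ord_recr /= (@alternating_telescope (fun i => hom_dim
  (P i) Y) b) => [|i lti].
  by rewrite b0 -(hom_dim_syz P m Y) -[X in (_ + X)%N]/(b m.+1) PoszD; ring.
have ex : out_exact P i Y.
  case: i lti => [|i] lti; first exact: out_exact0.
  by apply: out_exactS; apply: E0.
rewrite /hom_dim -(limg_ker_dim (precomp Y (res_diff P i))); congr (_ + _)%N.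
congr (\dim _); apply/vspaceP=> f; rewrite memv_cap memv_ker precompE.
apply/andP/memv_imgP=> [[/hom_spaceP hf /eqP f0] | [g /hom_spaceP hg ->]].
  by have [g hg ->] := ex f (conj hf f0); exists g;
    [exact/hom_spaceP | rewrite precompE].
rewrite precompE -comp_lfunA res_outK comp_lfun0r; split=> //.
by apply/hom_spaceP/is_hom_comp => //; exact: res_out_hom.
Qed.

End EulerChar.

End HomDim.

(** * Dimension vectors and the Euler form *)

(** What is retained of the presentation by a quiver up to the last section: complete orthogonal
    idempotents with e_i A e_i = K e_i, and a rank [r] of vertices that increases along nonzero
    elements of e_i A e_j for i <> j, which encodes acyclicity. *)
Record directed_idempotents (K : fieldType) (A : falgType K) (s : nat)
    (e : 'I_s -> A) (r : 'I_s -> nat) : Prop := DirectedIdempotents {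
  di_idem : forall i, e i * e i = e i;
  di_orth : forall i j, i != j -> e i * e j = 0;
  di_sum : \sum_i e i = 1;
  di_neq0 : forall i, e i != 0;
  di_local : forall i a, exists c : K, e i * a * e i = c *: e i;
  di_rank : forall i j a, e i * a * e j != 0 -> i = j \/ (r i < r j)%N
}.

Section Idempotents.
Variables (K : fieldType) (A : falgType K) (s : nat).
Variables (e : 'I_s -> A) (r : 'I_s -> nat).
Hypothesis dirE : directed_idempotents e r.
Implicit Types X Y Z M N : rmodule A.
Local Notation reg := (rm_reg A).

Let eK := di_idem dirE.

Lemma act_sum_idem X (x : X) : x = \sum_i rm_act x (e i).
Proof. by rewrite -rm_act_sumr (di_sum dirE) rm_act1. Qed.

Section Pe.
Variable i : 'I_s.

Let U := limg (lact (e i) \1%VF : 'Hom(reg, reg)).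

Let hE : is_hom (lact (e i) \1%VF : 'Hom(reg, reg)).
Proof. exact/lact_hom/is_hom1. Qed.

(* The indecomposable projective [e_i A]. *)
Definition Pe : rmodule A := rm_sub (img_stable hE).
Definition Pe_inj : 'Hom(Pe, reg) := sub_inj (img_stable hE).

Lemma Pe_inj_hom : is_hom Pe_inj. Proof. exact: sub_inj_hom. Qed.

Lemma Pe_inj_inj : injective Pe_inj. Proof. exact: sub_inj_inj. Qed.

Lemma Pe_injE z : e i * Pe_inj z = Pe_inj z.
Proof.
have /memv_imgP[x _ ->] := sub_inj_mem z.
by rewrite lactE id_lfunE mulrA eK.
Qed.

Lemma Pe_factor Y (f : 'Hom(Y, reg)) : is_hom f ->
  exists2 g : 'Hom(Y, Pe), is_hom g & (Pe_inj \o g = lact (e i) f)%VF.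
Proof.
move=> hf; apply: sub_factor; first exact: lact_hom.
move=> y; rewrite lactE; apply/memv_imgP; exists (f y); first exact: memvf.
by rewrite lactE id_lfunE.
Qed.

Lemma Pe_gen_ex : exists g : Pe, Pe_inj g = e i.
Proof.
apply: sub_inj_onto; apply/memv_imgP; exists 1; first exact: memvf.
by rewrite lactE id_lfunE mulr1.
Qed.

Lemma Pe_gen g z : Pe_inj g = e i -> z = rm_act g (Pe_inj z).
Proof. by move=> Eg; apply: Pe_inj_inj; rewrite Pe_inj_hom Eg /= Pe_injE. Qed.

Definition Pe_map Y (y : Y) : 'Hom(Pe, Y) := (orbit_map y \o Pe_inj)%VF.

Lemma Pe_mapE Y (y : Y) z : Pe_map y z = rm_act y (Pe_inj z).
Proof. by rewrite comp_lfunE orbit_mapE. Qed.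

Lemma Pe_map_hom Y (y : Y) : is_hom (Pe_map y).
Proof. by apply: is_hom_comp; [exact: orbit_map_hom | exact: Pe_inj_hom]. Qed.

Lemma Pe_hom Y (f : 'Hom(Pe, Y)) : is_hom f ->
  exists2 y : Y, rm_act y (e i) = y & f = Pe_map y.
Proof.
move=> hf; have [g Eg] := Pe_gen_ex; exists (f g).
  by rewrite -hf; congr (f _); rewrite {2}(Pe_gen g Eg) Eg.
by apply/lfunP=> z; rewrite Pe_mapE -hf -Pe_gen.
Qed.

Lemma Pe_projective : rm_projective Pe.
Proof.
move=> M N g f hg gs hf; have [y _ ->] := Pe_hom hf.
have /limg_surj/(_ y)[x <-] := gs.
exists (Pe_map x); first exact: Pe_map_hom.
by apply/lfunP=> z; rewrite comp_lfunE !Pe_mapE hg.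
Qed.

Lemma act_img Y (y : Y) :
  y \in limg (linfun (fun x : Y => rm_act x (e i))) <-> rm_act y (e i) = y.
Proof.
have lE := linfun_linear (rm_actl (r := Y) (e i)).
split=> [/memv_imgP[x _ ->] | <-]; first by rewrite lE -rm_actA eK.
by rewrite -lE memv_img ?memvf.
Qed.

Lemma Pe_map_linear Y : linear (@Pe_map Y).
Proof. by move=> c x y; rewrite /Pe_map orbit_map_linear comp_lfunDl -comp_lfunZl. Qed.

Lemma hom_dim_Pe Y :
  hom_dim Pe Y = \dim (limg (linfun (fun x : Y => rm_act x (e i)))).
Proof.
apply/esym/(dim_bij (Pe_map_linear (Y := Y))) => [y /act_img Ey y0 | f].
  have [g Eg] := Pe_gen_ex.
  by rewrite -Ey -Eg -Pe_mapE y0 zero_lfunE.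
split=> [/hom_spaceP/Pe_hom[y Ey ->] | [y _ <-]]; first by exists y => //;
  apply/act_img.
by apply/hom_spaceP; exact: Pe_map_hom.
Qed.

End Pe.

Lemma dimvecE X i : dimvec e X i 0 = (hom_dim (Pe i) X)%:Z.
Proof. by rewrite mxE hom_dim_Pe. Qed.

Lemma hom_dim_Pe_Pe i j :
  hom_dim (Pe i) (Pe j) = \dim (<[e j]> * {:A} * <[e i]>)%VS.
Proof.
rewrite hom_dim_Pe; apply: (dim_bij (f := fun z : Pe j => Pe_inj j z : A)).
- by move=> c x y; rewrite linearP.
- by move=> z _ z0; apply: (@Pe_inj_inj j); rewrite z0 linear0.
move=> x; split=> [xI | [z /act_img Ez <-]]; last first.
  have -> : Pe_inj j z = e j * Pe_inj j z * e i.
    by rewrite Pe_injE -{1}Ez Pe_inj_hom.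
  by rewrite !memv_mul ?memv_line ?memvf.
(* A product of subspaces is a span, so e_j x e_i = x is stated as membership in a kernel and
   checked on products. *)
have : x \in lker (linfun (fun x : A => e j * x * e i - x)).
  apply: subvP xI; apply/prodvP=> u v ua /vlineP[c ->].
  have : u \in lker (linfun (fun x : A => e j * x - x)).
    apply: subvP ua; apply/prodvP=> u' v' /vlineP[c' ->] _.
    rewrite memv_ker linfun_linear -?scalerAl -?scalerAr ?mulrA ?eK ?subrr //.
    by move=> k a b; rewrite mulrDr -scalerAr scalerBr opprD addrACA.
  rewrite !memv_ker !linfun_linear.
  - rewrite subr_eq0 => /eqP Eu.
    by rewrite -!scalerAr -!scalerAl mulrA Eu -mulrA eK subrr.
  - by move=> k a b; rewrite mulrDr mulrDl -scalerAr -scalerAl scalerBr opprD addrACA.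
  by move=> k a b; rewrite mulrDr -scalerAr scalerBr opprD addrACA.
rewrite memv_ker linfun_linear => [|k a b]; last first.
  by rewrite mulrDr mulrDl -scalerAr -scalerAl scalerBr opprD addrACA.
rewrite subr_eq0 => /eqP Ex.
have [g Eg] := Pe_gen_ex j.
exists (rm_act g (x * e i)).
  by apply/act_img; rewrite -rm_actA -mulrA eK.
by rewrite Pe_inj_hom Eg /= mulrA.
Qed.

Lemma CartanE i j : Cartan e i j = (hom_dim (Pe i) (Pe j))%:Z.
Proof. by rewrite mxE hom_dim_Pe_Pe. Qed.

Lemma Cartan_rank i j : Cartan e i j != 0 -> i = j \/ (r j < r i)%N.
Proof.
rewrite CartanE => /eqP C0.
have [|f hf f0] := @hom_dim_neq0 _ _ (Pe i) (Pe j); first by move=> E;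
    rewrite E in C0.
have [y Ey Ef] := Pe_hom hf.
have /eqP/(di_rank dirE)[->|] : e j * Pe_inj j y * e i <> 0; last by right.
  rewrite Pe_injE -[_ * _]/(rm_act (Pe_inj j y) (e i)) -Pe_inj_hom Ey => y0.
  apply: f0; rewrite Ef; apply/lfunP=> z; apply: (@Pe_inj_inj j).
  by rewrite Pe_mapE Pe_inj_hom y0 rm_act0l zero_lfunE linear0.
by left.
Qed.

Lemma hom_dim_Pe_self i : hom_dim (Pe i) (Pe i) = 1%N.
Proof.
have [g Eg] := Pe_gen_ex i.
have -> : hom_dim (Pe i) (Pe i) = \dim <[g]>%VS.
  rewrite hom_dim_Pe; congr (\dim _); apply/vspaceP=> z; apply/idP/vlineP.
    move/act_img=> Ez; have [c Ec] := di_local dirE i (Pe_inj i z).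
    exists c; apply: (@Pe_inj_inj i).
    by rewrite -Ez Pe_inj_hom /= -[Pe_inj i z]Pe_injE Ec linearZ /= Eg.
  move=> [c ->]; apply/act_img; rewrite rm_actZl; congr (_ *: _).
  by apply: (@Pe_inj_inj i); rewrite Pe_inj_hom Eg /= eK.
rewrite dim_vline; suff -> : g != 0 by [].
by apply/eqP=> g0; have := di_neq0 dirE i; rewrite -Eg g0 linear0 eqxx.
Qed.

(** The matrix is unitriangular for the order given by [r], but the vertices are not sorted. In the
    Leibniz formula a nonzero term makes [r] weakly decrease along the permutation, and strictly at
    any moved vertex, which contradicts the invariance of the sum of [r]; only the identity
    survives. *)
Lemma Cartan_unit : Cartan e \in unitmx.
Proof.
suff : \det (Cartan e) = 1 by rewrite unitmxE => ->; exact: unitr1.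
rewrite /determinant (bigD1 (1%g : 'S_s)) //= odd_perm1 expr0 mul1r.
rewrite [X in X + _]big1 => [|i _];
  last by rewrite perm1 CartanE hom_dim_Pe_self.
rewrite big1 ?addr0 // => sg sg1.
suff /existsP[i /eqP Ci] : [exists i, Cartan e i (sg i) == 0].
  by rewrite (bigD1 i) //= Ci mul0r mulr0.
apply: contraT; rewrite negb_exists => /forallP C0.
have le_r i : (r (sg i) <= r i)%N.
  by have [<-|/ltnW] := Cartan_rank (C0 i).
have [i sgi] : exists i, sg i != i.
  apply/existsP; apply: contraR sg1; rewrite negb_exists => /forallP sgE.
  by apply/eqP/permP=> i; rewrite perm1; apply/eqP; rewrite -[_ == _]negbK.
have lt_r : (r (sg i) < r i)%N.
  by have [E|//] := Cartan_rank (C0 i); rewrite -E eqxx in sgi.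
have : (\sum_j r (sg j) < \sum_j r j)%N.
  rewrite (bigD1 i) //= [X in (_ < X)%N](bigD1 i) //=.
  by rewrite -addSn leq_add // leq_sum.
by rewrite [X in (_ < X)%N](reindex_inj (@perm_inj _ sg)) ltnn.
Qed.

Lemma Euler_linearl c x x' y :
  Euler_form e (c *: x + x') y = c * Euler_form e x y + Euler_form e x' y.
Proof.
by rewrite /Euler_form linearP mulmxDl mulmxDl -!scalemxAl !mxE.
Qed.

Lemma Euler0l y : Euler_form e 0 y = 0.
Proof. by rewrite /Euler_form trmx0 !mul0mx mxE. Qed.

Lemma Euler_linearr c x y y' :
  Euler_form e x (c *: y + y') = c * Euler_form e x y + Euler_form e x y'.
Proof. by rewrite /Euler_form mulmxDr -scalemxAr !mxE. Qed.

(** The dimension vector of e_i A is the i-th column of the Cartan matrix, so the inverse in the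
    form cancels it and leaves a coordinate. *)
Lemma Euler_Pe i y : Euler_form e (dimvec e (Pe i)) y = y i 0.
Proof.
have -> : dimvec e (Pe i) = Cartan e *m delta_mx i 0.
  by apply/colP=> j; rewrite dimvecE -CartanE -colE [RHS]mxE.
rewrite /Euler_form trmx_mul -(mulmxA (delta_mx i 0)^T) -trmx_mul.
by rewrite mulVmx ?Cartan_unit // trmx1 mulmx1 trmx_delta -rowE mxE.
Qed.

Lemma Euler_suml I (t : seq I) (c : I -> int) (x : I -> 'cV[int]_s) y :
  Euler_form e (\sum_(i <- t) c i *: x i) y =
    \sum_(i <- t) c i * Euler_form e (x i) y.
Proof.
elim: t => [|i t IH]; rewrite ?big_nil ?big_cons ?Euler0l //.
by rewrite Euler_linearl IH.
Qed.

Lemma dimvec_span x : exists c : 'I_s -> int, x = \sum_i c i *: dimvec e (Pe i).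
Proof.
exists (fun i => (invmx (Cartan e) *m x) i 0).
rewrite -[LHS](mulKVmx Cartan_unit); apply/colP=> j.
rewrite mxE summxE; apply: eq_bigr => i _.
by rewrite [RHS]mxE dimvecE CartanE mulrC.
Qed.

Lemma Euler_nondegl x x' :
  (forall i, Euler_form e x (dimvec e (Pe i)) = Euler_form e x' (dimvec e
    (Pe i))) ->
  x = x'.
Proof.
move=> E; have {}E y : Euler_form e x y = Euler_form e x' y.
  have [c ->] := dimvec_span y.
  elim/big_rec: _ => [|i z _ IH]; last by rewrite !Euler_linearr E IH.
  by rewrite /Euler_form !mulmx0.
have : (x^T *m (invmx (Cartan e))^T) = (x'^T *m (invmx (Cartan e))^T).
  apply/rowP=> j; have := E (delta_mx j 0).
  by rewrite /Euler_form -!colE !mxE.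
rewrite -!trmx_mul => /trmx_inj/(congr1 (mulmx (Cartan e))).
by rewrite !mulKVmx ?Cartan_unit.
Qed.

Lemma dimvec_Pe_inj i j : dimvec e (Pe i) = dimvec e (Pe j) -> i = j.
Proof.
move=> E; have := Euler_Pe i (delta_mx i 0);
  rewrite E Euler_Pe !mxE !eqxx andbT.
by case: eqP => [->|].
Qed.

Lemma zero_Pe X : (forall i, hom_dim (Pe i) X = 0%N) -> rm_zero X.
Proof.
move=> X0 x; rewrite (act_sum_idem x) big1 // => i _.
have /eqP := X0 i; rewrite hom_dim_Pe dimv_eq0 => /eqP E.
have : rm_act x (e i) \in limg (linfun (fun x : X => rm_act x (e i))).
  by apply/act_img; rewrite -rm_actA eK.
by rewrite E memv0 => /eqP.
Qed.

(** Take [a] of least rank in the support of [P] and x <> 0 in P e_a. In the dual basis expansion of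
    [x], minimality leaves only terms through e_a, so some e_a f_k(x) e_a is a nonzero multiple of
    e_a; after rescaling, [x] and f_k give the inclusion and the retraction. *)
Lemma proj_split P : rm_projective P -> ~ rm_zero P ->
  exists a (i : 'Hom(Pe a, P)) (p : 'Hom(P, Pe a)),
    [/\ is_hom i, is_hom p & (p \o i = \1)%VF].
Proof.
move=> pP nP0.
have [a0 /eqP a0P] : exists a, hom_dim (Pe a) P != 0%N.
  apply/existsP; apply: contraT; rewrite negb_exists => /forallP P0; case: nP0.
  by apply: zero_Pe => i; apply/eqP/negPn/P0.
have [a /eqP aP a_min] := @arg_minnP _ a0 (fun a => hom_dim
    (Pe a) P != 0%N) r (introN eqP a0P).
have [u hu u0] := hom_dim_neq0 aP; have [x Ex Eu] := Pe_hom hu.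
have supp b : (r b < r a)%N -> forall y : P, rm_act y (e b) = 0.
  move=> ltb y; have : hom_dim (Pe b) P = 0%N.
    by apply/eqP; apply: contraLR ltb => /a_min; rewrite -leqNgt.
  move/eqP; rewrite hom_dim_Pe dimv_eq0 => /eqP E.
  have : rm_act y (e b) \in limg (linfun (fun x : P => rm_act x (e b))).
    by apply/act_img; rewrite -rm_actA eK.
  by rewrite E memv0 => /eqP.
have [m [p [f [hf def_p]]]] := proj_dual_basis pP.
have fa k : f k x * e a = f k x by rewrite -[_ * _]/(rm_act (f k x)
    (e a)) -hf Ex.
have [k fk] : exists k, e a * f k x * e a != 0.
  apply/existsP; apply: contraT; rewrite negb_exists => /forallP f0.
  case: u0; rewrite Eu; suff -> : x = 0.
    by apply/lfunP=> z; rewrite Pe_mapE rm_act0l zero_lfunE.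
  rewrite (def_p x) big1 // => k _; rewrite (act_sum_idem (p k)) rm_act_suml.
  rewrite big1 // => b _; rewrite -rm_actA.
  have [->|nab] := eqVneq b a.
    by have /negPn/eqP := f0 k; rewrite -mulrA fa => ->; rewrite rm_act0r.
  have [E0|] := eqVneq (e b * f k x * e a) 0.
    by rewrite -[f k x]fa mulrA E0 rm_act0r.
  case/(di_rank dirE) => [Eb|/supp E0]; first by rewrite Eb eqxx in nab.
  by rewrite rm_actA E0 rm_act0l.
have [c Ec] := di_local dirE a (f k x); rewrite Ec in fk.
have c0 : c != 0 by apply: contraNneq fk => ->; rewrite scale0r.
have [q hq Eq] := Pe_factor a (hf k).
exists a, (c^-1 *: Pe_map a x), q; split=> //; first exact/is_homZ/Pe_map_hom.
apply/lfunP=> z; rewrite comp_lfunE id_lfunE; apply: (@Pe_inj_inj a).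
rewrite -[LHS]comp_lfunE Eq lactE scale_lfunE Pe_mapE linearZ /= hf /=.
by rewrite -fa -scalerAr !mulrA Ec -scalerAl scalerA mulVf // scale1r Pe_injE.
Qed.

(** Summands e_a A are split off one at a time; the induction is on dim Hom(A, P), which drops
    because Hom(A, e_a A) is nonzero. *)
Lemma Euler_projective P Y : rm_projective P ->
  Euler_form e (dimvec e P) (dimvec e Y) = (hom_dim P Y)%:Z.
Proof.
have [n] := ubnP (hom_dim (rm_reg A) P); elim: n P => // n IH P ltP pP.
have [P0|nP0] := Classical_Prop.classic (rm_zero P).
  have -> : dimvec e P = 0 by apply/colP=> i;
      rewrite dimvecE hom_dim_zeror // mxE.
  by rewrite Euler0l hom_dim_zerol.
have [a [i [p [hi hp pi]]]] := proj_split pP nP0.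
have [P' [i2 [p2 [hi2 hp2 pi2 [pi12 pi21] ip]]]] := split_biprod hi hp pi.
rewrite (hom_dim_biprodl hi hp hi2 hp2 pi pi2 pi21 ip).
have Er Z := hom_dim_biprodr hi hp hi2 hp2 pi pi2 pi12 ip Z.
have pP' : rm_projective P' by exact: rm_projective_retract pP hp2 hi2 pi2.
have -> : dimvec e P = 1 *: dimvec e (Pe a) + dimvec e P'.
  by apply/colP=> j; rewrite scale1r !mxE -!hom_dim_Pe Er PoszD.
rewrite Euler_linearl mul1r Euler_Pe dimvecE IH ?PoszD //.
move: ltP; rewrite ltnS; apply: leq_trans;
  rewrite Er -[X in (X < _)%N]add0n ltn_add2r.
have [g Eg] := Pe_gen_ex a; apply: (hom_dim_gt0 (orbit_map_hom g)) =>
    /lfunP/(_ 1).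
rewrite orbit_mapE rm_act1 zero_lfunE => g0.
by have := di_neq0 dirE a; rewrite -Eg g0 linear0 eqxx.
Qed.

End Idempotents.

(** * Least indices and the pigeonhole principle, for use on orbits *)

Lemma least_or_none (Q : nat -> Prop) :
  (forall k, ~ Q k) \/ (exists2 k, Q k & forall j, (j < k)%N -> ~ Q j).
Proof.
have [[k Qk]|nQ] := Classical_Prop.classic (exists k, Q k); last first.
  by left=> k Qk; apply: nQ; exists k.
right; have [n] := ubnP k; elim: n k Qk => // n IH k Qk ltk.
have [[j [ltj Qj]]|no] :=
    Classical_Prop.classic (exists j, (j < k)%N /\ Q j).
  by apply: (IH j Qj); apply: leq_trans ltj ltk.
by exists k => // j ltj Qj; apply: no; exists j.
Qed.

Lemma nat_pigeonhole (T : finType) (f : nat -> T) :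
  exists i j, (i < j)%N /\ f i = f j.
Proof.
have /injectivePn[x [y nxy Exy]] : ~~ injectiveb (fun k : 'I_(#|T|.+1) => f k).
  apply/injectiveP=> /card_codom; rewrite card_ord => E.
  by have := max_card [in codom (fun k : 'I_(#|T|.+1) => f k)]; rewrite E ltnn.
have [lt|lt|E] := ltngtP x y; [by exists x, y | by exists y, x |].
by rewrite (ord_inj E) eqxx in nxy.
Qed.

(** * Direct sums, and modules whose endomorphisms are scalars *)

Section Bricks.
Variables (K : fieldType) (A : falgType K).
Implicit Types X Y Z M N : rmodule A.

Lemma rm_iso_trans X Y Z : rm_iso X Y -> rm_iso Y Z -> rm_iso X Z.
Proof.
move=> /rm_iso_inv[f [f' [hf hf' ff ff']]] /rm_iso_inv[g [g' [hg hg' gg gg']]].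
apply: (@rm_isoP _ _ _ _ (g \o f)%VF (f' \o g')%VF); first exact: is_hom_comp.
  by rewrite -comp_lfunA [(g' \o (g \o f))%VF]comp_lfunA gg comp_lfun1l.
by rewrite -comp_lfunA [(f \o (f' \o g'))%VF]comp_lfunA ff' comp_lfun1l.
Qed.

Lemma rm_sum_biprod X Y Z : rm_iso X (rm_sum Y Z) ->
  exists (i1 : 'Hom(Y, X)) (p1 : 'Hom(X, Y)) (i2 : 'Hom(Z, X))
    (p2 : 'Hom(X, Z)),
    [/\ is_hom i1 /\ is_hom p1, is_hom i2 /\ is_hom p2,
        (p1 \o i1 = \1)%VF /\ (p2 \o i2 = \1)%VF,
        (p1 \o i2 = 0)%VF /\ (p2 \o i1 = 0)%VF &
        ((i1 \o p1) + (i2 \o p2) = \1)%VF].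
Proof.
move/rm_iso_inv=> [f [g [hf hg gf fg]]].
have gfE x : g (f x) = x by have /lfunP/(_ x) := gf;
    rewrite comp_lfunE id_lfunE.
have fgE x : f (g x) = x by have /lfunP/(_ x) := fg;
    rewrite comp_lfunE id_lfunE.
pose i1 : 'Hom(Y, X) := linfun (fun y => g ((y, 0) : rm_sum Y Z)).
pose i2 : 'Hom(Z, X) := linfun (fun z => g ((0, z) : rm_sum Y Z)).
pose p1 : 'Hom(X, Y) := linfun (fun x => (f x : rm_sum Y Z).1).
pose p2 : 'Hom(X, Z) := linfun (fun x => (f x : rm_sum Y Z).2).
have i1E y : i1 y = g (y, 0).
  apply: linfun_linear => c u v; rewrite -linearP; congr (g _); congr (_, _).
  by rewrite /= scaler0 addr0.
have i2E z : i2 z = g (0, z).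
  apply: linfun_linear => c u v; rewrite -linearP; congr (g _); congr (_, _).
  by rewrite /= scaler0 addr0.
have p1E x : p1 x = (f x : rm_sum Y Z).1.
  by apply: linfun_linear => c u v; rewrite linearP.
have p2E x : p2 x = (f x : rm_sum Y Z).2.
  by apply: linfun_linear => c u v; rewrite linearP.
exists i1, p1, i2, p2; split; [split|split|split|split|].
- move=> y a; rewrite !i1E -hg; congr (g _); congr (_, _).
  by rewrite /= rm_act0l.
- by move=> x a; rewrite !p1E hf.
- move=> y a; rewrite !i2E -hg; congr (g _); congr (_, _).
  by rewrite /= rm_act0l.
- by move=> x a; rewrite !p2E hf.
- by apply/lfunP=> y; rewrite comp_lfunE id_lfunE i1E p1E fgE.
- by apply/lfunP=> y; rewrite comp_lfunE id_lfunE i2E p2E fgE.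
- by apply/lfunP=> y; rewrite comp_lfunE zero_lfunE i2E p1E fgE.
- by apply/lfunP=> y; rewrite comp_lfunE zero_lfunE i1E p2E fgE.
apply/lfunP=> x; rewrite add_lfunE !comp_lfunE id_lfunE i1E i2E p1E p2E.
rewrite -linearD -[RHS]gfE; congr (g _); case: (f x) => y z.
by congr (_, _); rewrite /= ?addr0 ?add0r.
Qed.

Lemma hom1_eq0 X : (\1%VF = 0 :> 'Hom(X, X)) -> rm_zero X.
Proof. by move/lfunP=> E x; have := E x; rewrite id_lfunE zero_lfunE. Qed.

Lemma idempotent_indec X : ~ rm_zero X ->
  (forall f : 'Hom(X, X), is_hom f -> (f \o f = f)%VF -> f = 0 \/ f = \1%VF) ->
  rm_indecomposable X.
Proof.
move=> X0 idX; split=> // Y Z.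
move/rm_sum_biprod=> [i1 [p1 [i2 [p2 [[hi1 hp1] [hi2 hp2] [pi1 pi2] [pi12 pi21] ip]]]]].
have [||E|E] := idX (i1 \o p1)%VF; first exact: is_hom_comp.
- by rewrite -comp_lfunA [(p1 \o _)%VF]comp_lfunA pi1 comp_lfun1l.
- left; apply: hom1_eq0; rewrite -pi1 -[p1]comp_lfun1l -pi1 -[X in
    (X \o i1)%VF]comp_lfunA.
  by rewrite E comp_lfun0r comp_lfun0l.
right; apply: hom1_eq0; rewrite -pi2 -[i2]comp_lfun1l -E -comp_lfunA.
by rewrite pi12 !comp_lfun0r.
Qed.

Lemma brick_scalar X (f : 'Hom(X, X)) : hom_dim X X = 1%N -> is_hom f ->
  exists c, f = c *: \1%VF.
Proof.
move=> d1 hf; have id_in : \1%VF \in hom_space X X by apply/hom_spaceP/is_hom1.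
have id0 : \1%VF != 0 :> 'Hom(X, X).
  apply/eqP=> /hom1_eq0 X0; by rewrite hom_dim_zerol in d1.
have /eqP E : (<[\1%VF : 'Hom(X, X)]> == hom_space X X)%VS.
  by rewrite eqEdim -memvE id_in dim_vline id0 -/(hom_dim X X) d1.
by have /hom_spaceP := hf; rewrite -E => /vlineP.
Qed.

Lemma brick_indec X : hom_dim X X = 1%N -> rm_indecomposable X.
Proof.
move=> d1; apply: idempotent_indec => [X0 | f hf ff].
  by rewrite hom_dim_zerol in d1.
have [c Ec] := brick_scalar d1 hf.
have [c0|c0] := eqVneq c 0; first by left; rewrite Ec c0 scale0r.
by right; move: ff; rewrite Ec -comp_lfunZl comp_lfun1l => /(scalerI c0)->.
Qed.

(** The identity of [X] is a sum of composites [b i \o a i], each a scalar; one of them is nonzero,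
    so [X] is a summand of [M] itself rather than of a power. This gives bounds independent of the
    number of copies. *)
Lemma brick_retract M X Z : retract M X -> hom_dim X X = 1%N ->
  (hom_dim Z X <= hom_dim Z M)%N.
Proof.
move=> [k [a [b [ha hb ab]]]] d1.
have [i bai] : exists i, (b i \o a i)%VF != 0.
  apply/existsP; apply: contraT; rewrite negb_exists => /forallP b0.
  have : hom_dim X X = 0%N.
    apply: hom_dim_zerol; apply: hom1_eq0; rewrite -ab big1 // => i _.
    by apply/eqP; rewrite -[_ == _]negbK.
  by rewrite d1.
have [c Ec] := brick_scalar d1 (is_hom_comp (hb i) (ha i)).
have c0 : c != 0 by apply: contraNneq bai => c0; rewrite Ec c0 scale0r.
have hb' := is_homZ c^-1 (hb i).
have E : ((c^-1 *: b i) \o a i = \1)%VF.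
  by rewrite -comp_lfunZl Ec scalerA mulVf // scale1r.
have [X2 [i2 [p2 [hi2 hp2 pi2 [pi12 pi21] ip]]]] := split_biprod (ha i) hb' E.
by rewrite (hom_dim_biprodr (ha i) hb' hi2 hp2 E pi2 pi12 ip) leq_addr.
Qed.

Lemma direct_summand_in_add M X : direct_summand X M -> in_add M X.
Proof.
move=> [X' isoM]; exists 1%N, X'; apply: rm_iso_trans isoM _.
pose f : 'Hom(M, rm_pow M 1) := linfun (fun x : M => [ffun _ =>
  x] : rm_pow M 1).
have fE x : f x = [ffun _ => x].
  by apply: linfun_linear => c u v; apply/ffunP=> i; rewrite !ffunE.
exists f; split=> [x a|].
  by rewrite !fE; apply/ffunP=> i; rewrite !ffunE.
exists (fun z : rm_pow M 1 => z ord0) => [x | z]; rewrite fE ?ffunE //.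
by apply/ffunP=> i; rewrite ffunE; congr (fun_of_fin z _); apply: val_inj;
  case: i => [[]].
Qed.

Lemma in_add_self M : in_add M M.
Proof.
apply: direct_summand_in_add; exists (rm_pow M 0).
have z0 (z : rm_pow M 0) : z = 0 by apply/ffunP=> -[].
pose f : 'Hom(rm_sum M (rm_pow M 0), M) :=
  linfun (fun z : rm_sum M (rm_pow M 0) => z.1).
have fE z : f z = z.1 by exact: linfun_linear.
exists f; split=> [z a|]; first by rewrite !fE.
exists (fun x => (x, 0)) => [[x z] | x]; rewrite fE //=.
by rewrite -(z0 z).
Qed.

Lemma rm_reg_projective : rm_projective (rm_reg A).
Proof.
move=> M N g f hg gs hf; have /limg_surj/(_ (f 1))[x Ex] := gs.
exists (orbit_map x); first exact: orbit_map_hom.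
apply/lfunP=> a; rewrite comp_lfunE orbit_mapE hg Ex -hf.
by congr (f _); exact: mul1r.
Qed.

End Bricks.

(** * Cluster tilting modules *)

Section Cluster.
Variables (K : fieldType) (A : falgType K) (s : nat).
Variables (e : 'I_s -> A) (r : 'I_s -> nat).
Hypothesis dirE : directed_idempotents e r.
Variable m : nat.
Hypothesis gld : gldim_le A m.+1.
Variable M : rmodule A.
Hypothesis nCT : cluster_tilting m.+1 M.
Implicit Types X Y Z N : rmodule A.
Local Notation reg := (rm_reg A).
Local Notation Pe := (Pe e).
Local Notation dv := (dimvec e).
Local Notation Eu := (Euler_form e).
Local Notation add := (in_add M).

(** Fixing one resolution of length at most n for each module makes [tau] a function on modules,
    which can be iterated. *)
Definition short_res X :
    {P : proj_resolution X | forall i, (m.+1 < i)%N -> rm_zero (P i)} :=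
  ClassicalEpsilon.constructive_indefinite_description _ (gld X).

Definition res X : proj_resolution X := sval (short_res X).

Lemma res_zero X i : (m.+1 < i)%N -> rm_zero (res X i).
Proof. exact: (svalP (short_res X)). Qed.

(* The higher Auslander-Reiten translate [D Ext^n(X, A)]. *)
Definition tau X : rmodule A := syz (res X) m.+1.

Lemma add_Ext X Y i : add X -> add Y -> (0 < i < m.+1)%N -> Ext_eq0 i X Y.
Proof.
move=> /in_add_retract aX aY; case: i => // i lti.
have [[/(_ aY) EMY _] _] := nCT Y.
by apply: Ext_eq0_retractl aX _ (EMY _ lti); exists (res M).
Qed.

Lemma add_proj Q : rm_projective Q -> add Q.
Proof. by move=> pQ; apply/(nCT Q).2 => -[|i] // _; exact: Ext_eq0_proj. Qed.

Lemma add_nak Q : rm_projective Q -> add (nak Q).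
Proof.
by move=> pQ; apply/(nCT _).1 => -[|i] // _ R; exact: Ext_res_nak.
Qed.

Lemma add_tau X : add X -> add (tau X).
Proof.
move=> aX; apply/(nCT _).1 => i lti R.
apply: (@Ext_res_syz_up _ _ X (res X) m.+1 M R) => // j ltj;
  apply: add_Ext => //.
  exact: in_add_self.
exact/add_proj/rm_reg_projective.
Qed.

(** Formula (1). The alternating sum of the resolution gives the dimension vector of [X], and each
    projective term contributes a Hom dimension; [euler_char_hom] evaluates the sum. *)
Lemma Euler_hom X Y : add X -> add Y ->
  Eu (dv X) (dv Y) = (hom_dim X Y)%:Z + (-1) ^+ m.+1 * (hom_dim Y (tau X))%:Z.
Proof.
move=> aX aY; have EXY i (lti : (0 < i < m.+1)%N) := add_Ext aX aY lti.
rewrite -(euler_char_hom (res X) EXY).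
have -> : dv X = \sum_(i < m.+2) (-1) ^+ i *: dv (res X i).
  apply/colP=> j; rewrite (dimvecE dirE) summxE.
  rewrite -(euler_char_proj (P := res X) (m := m)).
  - by apply: eq_bigr => i _; rewrite [RHS]mxE (dimvecE dirE).
  - exact: (Pe_projective dirE).
  by apply: res_zero.
rewrite Euler_suml; apply: eq_bigr => i _.
by rewrite (Euler_projective dirE) //; exact: res_objP.
Qed.

(** Membership in add M stands in for being a summand of [M]: it is what the Ext criteria of cluster
    tilting yield directly for [tau X]. *)
Definition cluster_indec X := rm_indecomposable X /\ add X.

Lemma indec_hom_gt0 X : rm_indecomposable X -> (0 < hom_dim X X)%N.
Proof.
move=> [X0 _]; apply: (@hom_dim_gt0 _ _ _ _ \1%VF); first exact: is_hom1.
by move/hom1_eq0.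
Qed.

Lemma hom_tau_proj X Y : rm_projective X -> add Y -> hom_dim Y (tau X) = 0%N.
Proof.
move=> pX aY; have := Euler_hom (add_proj pX) aY.
rewrite (Euler_projective dirE) //.
rewrite -[LHS]addr0 => /addrI/esym/eqP.
by rewrite mulf_eq0 signr_eq0 /= => /eqP[].
Qed.

(** The mirror image of [Euler_Pe]. By linearity it suffices to take x = dv(e_a A), where both sides
    are dim Hom(e_b A, e_a A). *)
Lemma Euler_nak b x : Eu x (dv (nak (Pe b))) = x b 0.
Proof.
have [c ->] := dimvec_span dirE x; rewrite Euler_suml summxE.
apply: eq_bigr => a _; rewrite mxE; congr (_ * _).
rewrite (Euler_Pe dirE) !(dimvecE dirE) hom_dim_nak //;
  exact: (Pe_projective dirE).
Qed.

(** For the injective N (e_b A), the pairing with [X] already equals dim Hom(X, N (e_b A)), so the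
    second term of (1) must vanish. *)
Lemma hom_nak_tau b X : add X -> hom_dim (nak (Pe b)) (tau X) = 0%N.
Proof.
move=> aX; have pb : rm_projective (Pe b) by exact: (Pe_projective dirE).
have := Euler_hom aX (add_nak pb).
rewrite Euler_nak (dimvecE dirE) hom_dim_nak //.
rewrite -[LHS]addr0 => /addrI/esym/eqP.
by rewrite mulf_eq0 signr_eq0 /= => /eqP[].
Qed.

(** * The translate at a nonprojective module *)

Section NonProjective.
Variable X : rmodule A.
Hypotheses (cX : cluster_indec X) (npX : ~ rm_projective X).

Let Ereg i : (0 < i < m.+1)%N -> Ext_eq0 i X reg.
Proof.
by apply: add_Ext; [exact: cX.2 | exact/add_proj/rm_reg_projective].
Qed.

Let hom0 (h : 'Hom(X, reg)) : is_hom h -> h = 0.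
Proof. exact: (hom_reg_eq0 (res X) cX.1 npX Ereg (gld _)). Qed.

Lemma hom_dim_proj_eq0 Q : rm_projective Q -> hom_dim X Q = 0%N.
Proof.
move=> pQ; apply/eqP; rewrite dimv_eq0 -subv0; apply/subvP=> f /hom_spaceP hf.
by rewrite memv0; apply/eqP; exact: (hom_proj_eq0 hom0 pQ hf).
Qed.

(** By linearity take y = dv(e_i A): the left side is dim Hom(e_i A, T X), and (1) reduces <X, e_i
    A> to its second term because Hom(X, e_i A) = 0. *)
Lemma Euler_tau y : Eu y (dv (tau X)) = (-1) ^+ m.+1 * Eu (dv X) y.
Proof.
have [c ->] := dimvec_span dirE y; rewrite Euler_suml.
have -> : Eu (dv X) (\sum_i c i *: dv (Pe i)) = \sum_i c i * Eu (dv X) (dv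
    (Pe i)).
  elim/big_rec2: _ => [|i z u _ <-]; last by rewrite Euler_linearr.
  by rewrite /Euler_form mulmx0 mxE.
rewrite mulr_sumr; apply: eq_bigr => i _.
have pi : rm_projective (Pe i) by exact: (Pe_projective dirE).
rewrite (Euler_hom cX.2 (add_proj pi)) hom_dim_proj_eq0 //.
rewrite (Euler_projective dirE) // add0r mulrCA; congr (_ * _).
by rewrite mulrA -expr2 sqrr_sign mul1r.
Qed.

(** Expand <Y, T X> by (1) and compare it with (-1)^n <X, Y>: both contain dim Hom(Y, T X), and
    cancelling it leaves the equality. *)
Lemma hom_dim_tau Y : add Y -> hom_dim X Y = hom_dim (tau X) (tau Y).
Proof.
move=> aY; have := Euler_hom aY (add_tau cX.2); rewrite Euler_tau.
rewrite (Euler_hom cX.2 aY) mulrDr mulrA -expr2 sqrr_sign mul1r addrC.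
move/addrI/(mulfI _); rewrite signr_eq0 => /(_ isT).
by move=> E; apply/eqP; rewrite -eqz_nat E.
Qed.

Lemma tau_full Y (g : 'Hom(tau X, tau Y)) : add Y -> is_hom g ->
  exists2 f, is_hom f & tau_rel (P := res X) (R := res Y) f g.
Proof.
by move=> aY hg; apply: (tau_rel_full Ereg hom0) => //; exact: hom_dim_tau.
Qed.

Lemma tau_faithful Y f : tau_rel (m := m) (P := res X) (R := res Y) f 0 ->
    f = 0.
Proof. exact: (tau_rel_faithful Ereg hom0). Qed.

Lemma cluster_indec_tau : cluster_indec (tau X).
Proof.
split; last exact: add_tau cX.2.
apply: idempotent_indec => [T0 | g hg gg].
  case: cX => -[X0 _] _; apply: X0; apply: hom1_eq0; apply: tau_faithful.
  have -> : 0 = \1%VF :> 'Hom(tau X, tau X).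
    by apply/lfunP=> x; rewrite (T0 x) !linear0.
  exact: tau_rel1.
have [f hf fg] := tau_full cX.2 hg.
have ff : (f \o f = f)%VF.
  apply/eqP; rewrite -subr_eq0; apply/eqP; apply: tau_faithful.
  by have := tau_relB (tau_rel_comp fg fg) fg; rewrite gg subrr.
have same f' g' : f = f' -> tau_rel (P := res X) (R := res X) f' g' ->
    (forall g1, tau_rel (m := m) (P := res X) (R := res X) 0 g1 -> g1 = 0) ->
    g = g'.
  move=> <- fg' u; apply/eqP; rewrite -subr_eq0; apply/eqP/u.
  by have := tau_relB fg fg'; rewrite subrr.
(* A map related to 0 is 0. A lift of 0 is d t' + t d in degree n; the first term is zero because
   the resolution stops in degree n, and N of the second kills ker (N P_n -> N P_(n-1)). *)
have u g1 : tau_rel (m := m) (P := res X) (R := res X) 0 g1 -> g1 = 0.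
  move=> [hg1 [F lF EF]]; apply/lfunP=> z; apply: syz_inj_inj.
  rewrite -comp_lfunE EF comp_lfunE zero_lfunE linear0.
  have [t [t' [ht ht' ->]]] := chain_lift_homotopy lF.
  apply: nak_ext => h hh; rewrite nak_mapE // nak_ev0.
  rewrite comp_lfunDr comp_lfunA comp_lfunA.
  have -> : (h \o res_diff (res X) m.+1 = 0)%VF.
    apply/comp_lfun_eq0P => x.
    by rewrite (res_zero (X := X) (i := m.+2) _ x) // !linear0.
  rewrite comp_lfun0l add0r -nak_mapE //; last exact: is_hom_comp.
  have /comp_lfun_eq0P/(_ z) := syz_injK (res X) m.+1.
  by rewrite /= => ->; rewrite nak_ev0.
have [f0|f1] := indec_idempotent cX.1 hf ff.
  by left; apply: (same _ _ f0 _ u); exact: tau_rel0.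
by right; apply: (same _ _ f1 _ u); exact: tau_rel1.
Qed.

End NonProjective.

Lemma tau_iso X Y : cluster_indec X -> ~ rm_projective X ->
  cluster_indec Y -> ~ rm_projective Y -> rm_iso (tau X) (tau Y) -> rm_iso X Y.
Proof.
move=> cX npX cY npY /rm_iso_inv[g [g' [hg hg' gg' g'g]]].
have [f hf fg] := tau_full cX npX cY.2 hg.
have [f' hf' fg'] := tau_full cY npY cX.2 hg'.
apply: (rm_isoP (g := f') hf); apply/eqP; rewrite -subr_eq0; apply/eqP.
  apply: (tau_faithful cX npX).
  by have := tau_relB (tau_rel_comp fg fg') (tau_rel1 _ _); rewrite gg' subrr.
apply: (tau_faithful cY npY).
by have := tau_relB (tau_rel_comp fg' fg) (tau_rel1 _ _); rewrite g'g subrr.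
Qed.

(* A map [X -> S_b -> T], where [S_b] is the simple module at [b]: no vertex of
   [X] precedes [b] and no vertex of [T] follows it. *)
Lemma hom_through_simple X T b :
  (forall c, (r c < r b)%N -> hom_dim (Pe c) X = 0%N) ->
  (forall c, (r b < r c)%N -> hom_dim (Pe c) T = 0%N) ->
  (0 < hom_dim (Pe b) X)%N -> (0 < hom_dim (Pe b) T)%N -> (0 < hom_dim X T)%N.
Proof.
have Pe0 Y c : hom_dim (Pe c) Y = 0%N -> forall y : Y, rm_act y (e c) = 0.
  move/eqP; rewrite dimv_eq0 => /eqP E y.
  have := @Pe_map_hom _ _ _ e c Y y => /hom_spaceP;
      rewrite E memv0 => /eqP/lfunP E0.
  have [g Eg] := Pe_gen_ex e c.
  by have := E0 g; rewrite Pe_mapE Eg zero_lfunE.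
have gen Y : (0 < hom_dim (Pe b) Y)%N ->
    exists2 y : Y, rm_act y (e b) = y & y <> 0.
  rewrite lt0n => /eqP/hom_dim_neq0[f /(Pe_hom dirE)[y Ey ->] y0];
    exists y => // E.
  by apply: y0; apply/lfunP=> z; rewrite Pe_mapE E rm_act0l zero_lfunE.
move=> X0 T0 /gen[x Ex x0] /gen[t Et t0].
have [psi psix] : exists psi : 'Hom(X, K^o), psi x != 0.
  apply: Classical_Prop.NNPP => no; apply: x0; apply/eqP; rewrite -memv0.
  apply: functional_sep => psi _; apply/eqP/negPn/negP => ne.
  by apply: no; exists psi.
pose f : 'Hom(X, T) := linfun (fun y : X => (psi (rm_act y (e b)) : K) *: t).
have fE y : f y = (psi (rm_act y (e b)) : K) *: t.
  apply: linfun_linear => c u v.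
  by rewrite rm_actl linearP scalerDl scalerA.
apply: (@hom_dim_gt0 _ _ _ _ f); last first.
  move/lfunP/(_ x); rewrite fE Ex zero_lfunE => /eqP;
    rewrite scaler_eq0 (negPf psix).
  by move/eqP.
move=> y a; rewrite !fE rm_actZl.
have [c Ec] := di_local dirE b a.
have -> : rm_act (rm_act y a) (e b) = c *: rm_act y (e b).
  rewrite -rm_actZr -Ec {1}(act_sum_idem dirE y) !rm_act_suml
    (bigD1 b) //= big1.
    by rewrite addr0 !rm_actA.
  move=> d nd; rewrite -!rm_actA mulrA.
  have [->|/(di_rank dirE)[E|/X0/Pe0 E]] := eqVneq (e d * a * e b) 0.
  - by rewrite rm_act0r.
  - by rewrite E eqxx in nd.
  by rewrite -mulrA rm_actA E rm_act0l.
have -> : rm_act t a = c *: t.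
  rewrite -{2}Et -rm_actZr -Ec [LHS](act_sum_idem dirE) (bigD1 b) //= big1.
    by rewrite addr0 !rm_actA Et.
  move=> d nd; rewrite -Et -!rm_actA mulrA.
  have [->|/(di_rank dirE)[E|/T0/Pe0 E]] := eqVneq (e b * a * e d) 0.
  - by rewrite rm_act0r.
  - by rewrite E eqxx in nd.
  by rewrite rm_actA E.
by rewrite linearZ scalerA mulrC.
Qed.

(* For [n] odd this is a matter of signs. For [n] even, [X] lives on the
   vertices after [b], [tau X] on those before [b], and both contain [S_b], so
   that [Hom(X, tau X) <> 0], whereas [<X, tau X> = 1 <= dim End(tau X)]. *)
Lemma dimvec_nonproj X b : cluster_indec X -> ~ rm_projective X ->
  dv X <> dv (Pe b).
Proof.
move=> cX npX E; have pP c : rm_projective (Pe c) by exact: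
  (Pe_projective dirE).
have EX y : Eu (dv X) y = y b 0 by rewrite E (Euler_Pe dirE).
have EP c : (-1) ^+ m.+1 * (hom_dim (Pe c) (tau X))%:Z = (hom_dim (Pe b)
    (Pe c))%:Z.
  have := Euler_hom cX.2 (add_proj (pP c)).
  by rewrite EX (dimvecE dirE) (hom_dim_proj_eq0 cX npX (pP c)) add0r => ->.
(* At c = b the right side of [EP] is 1 while the left side is a signed dimension, so the sign is
   positive and n is even from here on. *)
have s1 : (-1) ^+ m.+1 = 1 :> int.
  have := EP b; rewrite (hom_dim_Pe_self dirE) -signr_odd.
  by case: (odd _) => //=; rewrite expr1 mulN1r; lia.
have hT c : hom_dim (Pe c) (tau X) = hom_dim (Pe b) (Pe c).
  by have := EP c; rewrite s1 mul1r => -[].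
have hX c : hom_dim (Pe c) X = hom_dim (Pe c) (Pe b).
  by have := congr1 (fun v : 'cV_s => v c 0) E;
    rewrite /= !(dimvecE dirE) => -[].
have rk c d : (r c < r d)%N -> hom_dim (Pe c) (Pe d) = 0%N.
  move=> lt; apply/eqP; apply: contraLR lt => nz.
  have [|->|/ltnW] := @Cartan_rank _ _ _ _ _ dirE c d;
      rewrite ?ltnn -?leqNgt //.
  by rewrite (CartanE dirE) eqz_nat.
have cT := cluster_indec_tau cX npX.
have := Euler_hom cX.2 (add_tau cX.2); rewrite EX (dimvecE dirE) hT s1 mul1r.
rewrite (hom_dim_Pe_self dirE) => E1.
have T0 := indec_hom_gt0 cT.1.
have : (0 < hom_dim X (tau X))%N.
  by apply: (@hom_through_simple _ _ b) => [c lt|c lt||];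
    rewrite ?hT ?hX ?(hom_dim_Pe_self dirE) // rk.
by lia.
Qed.

(** If they were equal, (-1)^n <X, y> = <y, T X> = y_b = <e_b A, y> for all y, so nondegeneracy
    gives (-1)^n dv(X) = dv(e_b A). The b-th coordinate on the right is 1, so the sign is positive,
    against [dimvec_nonproj]. *)
Lemma dimvec_tau_nak X b : cluster_indec X -> ~ rm_projective X ->
  dv (tau X) <> dv (nak (Pe b)).
Proof.
move=> cX npX E; have Ey y : (-1) ^+ m.+1 * Eu (dv X) y = Eu (dv (Pe b)) y.
  by rewrite -Euler_tau // E Euler_nak (Euler_Pe dirE).
have E2 : (-1) ^+ m.+1 *: dv X = dv (Pe b).
  apply: (Euler_nondegl dirE) => i.
  by rewrite -Ey -[X in Eu X](addr0 (_ *: _)) Euler_linearl Euler0l addr0.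
apply: (dimvec_nonproj (b := b) cX npX); rewrite -E2.
have := congr1 (fun v : 'cV_s => v b 0) E2.
rewrite /= mxE !(dimvecE dirE) (hom_dim_Pe_self dirE) -signr_odd.
by case: (odd _) => /=; rewrite ?expr0 ?scale1r // expr1 mulN1r; lia.
Qed.

Lemma dimvec_tau X Y : cluster_indec X -> ~ rm_projective X ->
  cluster_indec Y -> ~ rm_projective Y -> dv (tau X) = dv (tau Y) <->
    dv X = dv Y.
Proof.
move=> cX npX cY npY; split=> E; last first.
  apply/colP=> i; rewrite -!(Euler_Pe dirE) Euler_tau // Euler_tau //.
  by rewrite E.
apply: (Euler_nondegl dirE) => i; apply: (mulfI (x := (-1) ^+ m.+1)).
  by rewrite signr_eq0.
by rewrite -!Euler_tau // E.
Qed.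

(** * Orbits of the translate *)

Definition nonproj_upto k X := forall j, (j < k)%N ->
  ~ rm_projective (iter j tau X).

Lemma cluster_indec_iter k X : cluster_indec X -> nonproj_upto k X ->
  cluster_indec (iter k tau X).
Proof.
move=> cX; elim: k => // k IH np; apply: cluster_indec_tau; last exact: np.
by apply: IH => j ltj; apply: np; exact: ltnW.
Qed.

Lemma add_iter k X : add X -> add (iter k tau X).
Proof. by move=> aX; elim: k => // k IH; exact: add_tau. Qed.

(** Only the orbit of [X] has to avoid projectives before step [k]. Thus [Y] may be [tau X] even
    when the orbit of [X] reaches a projective exactly at step [k]. *)
Lemma hom_dim_iter k X Y : cluster_indec X -> nonproj_upto k X -> add Y ->
  hom_dim X Y = hom_dim (iter k tau X) (iter k tau Y).
Proof.
move=> cX; elim: k => // k IH np aY.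
have np' : nonproj_upto k X by move=> j ltj; apply: np; exact: ltnW.
rewrite IH // !iterS; apply: hom_dim_tau; last exact: add_iter.
  exact: cluster_indec_iter.
exact: np.
Qed.

Lemma dimvec_iter k X Y : cluster_indec X -> nonproj_upto k X ->
  cluster_indec Y -> nonproj_upto k Y ->
  dv (iter k tau X) = dv (iter k tau Y) -> dv X = dv Y.
Proof.
move=> cX; elim: k => // k IH npX cY npY.
have npX' : nonproj_upto k X by move=> j ltj; apply: npX; exact: ltnW.
have npY' : nonproj_upto k Y by move=> j ltj; apply: npY; exact: ltnW.
rewrite !iterS => /dimvec_tau E; apply: IH => //; apply: E.
- exact: cluster_indec_iter.
- exact: npX.
- exact: cluster_indec_iter.
exact: npY.
Qed.

Lemma indec_proj P : rm_indecomposable P -> rm_projective P ->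
  exists a, rm_iso P (Pe a).
Proof.
move=> indP pP; have [a [i [p [hi hp pi]]]] := proj_split dirE pP indP.1.
exists a; apply: (rm_isoP (g := i) hp) => //.
have [|E|//] := indec_idempotent indP (is_hom_comp hi hp).
  by rewrite -comp_lfunA [(p \o _)%VF]comp_lfunA pi comp_lfun1l.
have := hom_dim_Pe_self dirE a; rewrite hom_dim_zerol //.
apply: hom1_eq0; rewrite -pi -[p]comp_lfun1l -pi -[X in (X \o i)%VF]comp_lfunA.
by rewrite E comp_lfun0r comp_lfun0l.
Qed.

Lemma dimvec_iso X Y : rm_iso X Y -> dv X = dv Y.
Proof.
by move=> isoXY; apply/colP=> i; rewrite !(dimvecE dirE) (hom_dim_isor _ isoXY).
Qed.

(** * Orbits that start at indecomposable injectives *)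

Section Injectives.
Variable b : 'I_s.

Let Ib := nak (Pe b).

Lemma hom_dim_nak_self : hom_dim Ib Ib = 1%N.
Proof.
have pP : rm_projective (Pe b) by exact: (Pe_projective dirE).
by rewrite !hom_dim_nak ?(hom_dim_Pe_self dirE).
Qed.

Lemma cluster_indec_nak : cluster_indec Ib.
Proof.
split; first exact/brick_indec/hom_dim_nak_self.
exact/add_nak/(Pe_projective dirE).
Qed.

(** An equality moved back by [k] steps would give the start of the orbit the dimension vector of T
    Y with Y nonprojective, which [dimvec_tau_nak] excludes. *)
Lemma nak_tau_orbit k j : (k < j)%N -> nonproj_upto j Ib ->
  dv (iter k tau Ib) <> dv (iter j tau Ib).
Proof.
move=> ltkj np E; have cI := cluster_indec_nak.
have [i Ei] : exists i, j = (k + i.+1)%N by exists (j - k.+1)%N; lia.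
have npS l : (l <= j)%N -> nonproj_upto l Ib.
  by move=> lel l' ltl; apply: np; exact: leq_trans ltl lel.
have ci : cluster_indec (iter i.+1 tau Ib).
  by apply: cluster_indec_iter => //; apply: npS; lia.
have : dv Ib = dv (iter i.+1 tau Ib).
  apply: (@dimvec_iter k) => //; first by apply: npS; lia.
    by move=> l ltl; rewrite -iterD; apply: np; lia.
  by rewrite -iterD -Ei.
move/esym; rewrite iterS; apply: dimvec_tau_nak; last by apply: np; lia.
by apply: cluster_indec_iter => //; apply: npS; lia.
Qed.

(* Every [iter k tau Ib] would be a summand of [M], so the dimension vectors
   would be bounded. *)
Lemma nak_tau_terminates :
  exists2 k, rm_projective (iter k tau Ib) & nonproj_upto k Ib.
Proof.
have [no|//] := least_or_none (fun k => rm_projective (iter k tau Ib)).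
have np k : nonproj_upto k Ib by move=> j _; exact: no.
have cI := cluster_indec_nak.
pose B := \max_(i < s) hom_dim (Pe i) M.
have bound k i : (hom_dim (Pe i) (iter k tau Ib) <= B)%N.
  (* Hom dimensions are preserved along the orbit, so every term has scalar endomorphisms, like its
     start, and is bounded by [M]. *)
  apply: leq_trans (leq_bigmax i); apply: brick_retract.
    exact/in_add_retract/add_iter/cI.2.
  by rewrite -hom_dim_iter ?hom_dim_nak_self //; exact: cI.2.
pose f k : {ffun 'I_s -> 'I_B.+1} := [ffun i => inord (hom_dim (Pe i)
  (iter k tau Ib))].
have [k [j [ltkj Ef]]] := nat_pigeonhole f.
case: (nak_tau_orbit ltkj (np j)); apply/colP=> i; rewrite !(dimvecE dirE).
have := congr1 (fun g : {ffun 'I_s -> 'I_B.+1} => nat_of_ord (g i)) Ef.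
by rewrite !ffunE !inordK ?ltnS ?bound // => ->.
Qed.

End Injectives.

(* [b |-> sigma b], where the orbit of [nak (Pe b)] ends at [Pe (sigma b)], is
   injective, hence surjective. *)
Lemma Pe_tau_nak a : exists b k,
  nonproj_upto k (nak (Pe b)) /\ rm_iso (iter k tau (nak (Pe b))) (Pe a).
Proof.
have /fin_all_exists[k kE] b : exists k, nonproj_upto k (nak (Pe b)) /\
    rm_projective (iter k tau (nak (Pe b))).
  by have [k pk npk] := nak_tau_terminates b; exists k.
have /fin_all_exists[sig sigE] b : exists c,
    rm_iso (iter (k b) tau (nak (Pe b))) (Pe c).
  have [npk pk] := kE b; apply: indec_proj pk.
  by have [] := cluster_indec_iter (cluster_indec_nak b) npk.
suff inj_sig : injective sig.
  have [b <-] : exists b, sig b = a by exists (invF inj_sig a); rewrite f_invF.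
  by exists b, (k b); have [] := kE b.
(* If both orbits end at the same projective, going back [k b] steps gives dv(I_b) = dv(T^d I_c)
   with d = k c - k b. For d > 0 this contradicts [dimvec_tau_nak]; for d = 0, pairing with a unit
   vector gives b = c. *)
have half b c : (k b <= k c)%N -> sig b = sig c -> b = c.
  move=> le E; have [npb _] := kE b; have [npc _] := kE c.
  have npcS l : (l <= k c)%N -> nonproj_upto l (nak (Pe c)).
    by move=> lel l' ltl; apply: npc; exact: leq_trans ltl lel.
  have Ed : dv (nak (Pe b)) = dv (iter (k c - k b) tau (nak (Pe c))).
    apply: (@dimvec_iter (k b)) => //.
    - exact: cluster_indec_nak.
    - by apply: cluster_indec_iter (npcS _ (leq_subr _ _));
        exact: cluster_indec_nak.
    - by move=> l ltl; rewrite -iterD; apply: npc; lia.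
    by rewrite -iterD subnKC // (dimvec_iso (sigE b)) (dimvec_iso (sigE c)) E.
  case Ek: (k c - k b)%N Ed => [|i] Ed.
    have := Euler_nak b (delta_mx c 0);
        rewrite Ed /= Euler_nak !mxE !eqxx andbT.
    by case: eqP => [->|].
  case: (@dimvec_tau_nak (iter i tau (nak (Pe c))) b); rewrite -?iterS -?Ed //.
    by apply: cluster_indec_iter (npcS _ _); [exact: cluster_indec_nak | lia].
  by apply: npc; lia.
move=> b c E; have [le|/ltnW le] := leqP (k b) (k c); first exact: half.
by apply/esym/half.
Qed.

(** Each e_a A is T^k I_b with k < N, so for an endless orbit dim Hom(e_a A, T^N X) = dim Hom(I_b,
    T^(N-k) X), which is 0 because N - k > 0. Thus T^N X vanishes at every vertex, although it is
    indecomposable. *)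
Lemma tau_terminates X : cluster_indec X ->
  exists2 k, rm_projective (iter k tau X) & nonproj_upto k X.
Proof.
move=> cX; have [no|//] := least_or_none (fun k => rm_projective
  (iter k tau X)).
have np k : nonproj_upto k X by move=> j _; exact: no.
have /fin_all_exists[b bE] a : exists b, exists k,
    nonproj_upto k (nak (Pe b)) /\ rm_iso (iter k tau (nak (Pe b))) (Pe a).
  exact: Pe_tau_nak.
have /fin_all_exists[k kE] a := bE a.
(* The successor guarantees that at least one [tau] remains after the [k a] steps are cancelled, as
   [hom_nak_tau] requires. *)
pose N := (\max_(a < s) k a).+1.
have [[XN0 _] _] := cluster_indec_iter cX (np N).
case: XN0; apply: (zero_Pe dirE) => a; have [npa isoa] := kE a.
have lek : (k a < N)%N by rewrite ltnS (leq_bigmax a).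
have [i Ei] : exists i, N = (k a + i.+1)%N by exists (N - (k a).+1)%N; lia.
rewrite -(hom_dim_isol _ isoa) Ei iterD -hom_dim_iter //; last first.
- exact/add_iter/cX.2.
- exact: cluster_indec_nak.
by rewrite iterS hom_nak_tau //; exact/add_iter/cX.2.
Qed.

(** Both terms of (1) are transported to the end e_a A of the orbit: the first becomes dim End(e_a
    A) = 1, the second dim Hom(e_a A, T (e_a A)) = 0. *)
Lemma cluster_indec_root X : cluster_indec X -> Eu (dv X) (dv X) = 1.
Proof.
move=> cX; have [k pk npk] := tau_terminates cX.
have [a isoa] := indec_proj (cluster_indec_iter cX npk).1 pk.
rewrite (Euler_hom cX.2 cX.2) (hom_dim_iter cX npk cX.2)
  (hom_dim_iter cX npk (add_tau cX.2)).
rewrite -iterSr iterS hom_tau_proj // ?mulr0 ?addr0; last exact/add_iter/cX.2.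
by rewrite (hom_dim_isol _ isoa) (hom_dim_isor _ isoa) (hom_dim_Pe_self dirE).
Qed.

(** Induction on the length of the orbit of [X]. At each step [dimvec_nonproj] makes [X] and [Y]
    both projective or both nonprojective, so the two orbits end together. *)
Lemma cluster_indec_dimvec_inj X Y : cluster_indec X -> cluster_indec Y ->
  dv X = dv Y -> rm_iso X Y.
Proof.
move=> cX; have [k] := tau_terminates cX.
elim: k X Y cX => [|k IH] X Y cX pk npk cY E.
  have [a isoX] := indec_proj cX.1 pk.
  have [pY|npY] := Classical_Prop.classic (rm_projective Y).
    have [b isoY] := indec_proj cY.1 pY.
    move: E; rewrite (dimvec_iso isoX) (dimvec_iso isoY) =>
      /(dimvec_Pe_inj dirE) Eab.
    by rewrite Eab in isoX; exact: rm_iso_trans isoX (rm_iso_sym isoY).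
  by case: (dimvec_nonproj cY npY (b := a)); rewrite -E; exact: dimvec_iso.
have npX : ~ rm_projective X by exact: (npk 0%N).
have [pY|npY] := Classical_Prop.classic (rm_projective Y).
  have [b isoY] := indec_proj cY.1 pY.
  by case: (dimvec_nonproj cX npX (b := b)); rewrite E; exact: dimvec_iso.
apply: tau_iso => //; apply: IH;
  [exact: cluster_indec_tau| | |exact: cluster_indec_tau|].
- by rewrite -iterSr.
- by move=> j ltj; rewrite -iterSr; apply: npk.
by apply/dimvec_tau.
Qed.

End Cluster.

(** * Vertex idempotents of path algebras *)

Section PathAlgebraIdempotents.
Variables (K : fieldType) (l : nat) (Q : quiver l).
Local Notation KQ := (path_alg K Q).
Local Notation pv := (pa_vertex K Q).
Implicit Types f g : KQ.

Lemma coef_pa_vertex i (p : qpath Q) :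
  coef (pv i) p = ((psrc p == i) && (parrows p == [::]))%:R.
Proof. exact: ffunE. Qed.

Lemma coef_vertexl i f r : coef (pv i * f) r = (psrc r == i)%:R * coef f r.
Proof.
have -> : pv i * f = pa_mul (pv i) f by [].
have [||t [st at_]] := @qpath_ex _ Q (psrc r) [::] => //.
have ctrr : pcat t r r by rewrite /pcat /ptgt st at_ !eqxx.
rewrite Defs.coefM (bigD1 t) //=
  (bigD1 r) //= ctrr coef_pa_vertex st at_ eqxx andbT mul1r.
rewrite big1 => [|q neq_qr].
  rewrite addr0 big1 ?addr0 // => p neq_pt; rewrite big1 // => q _.
  have [cpqr|_] := boolP (pcat p q r); last by rewrite mul0r.
  rewrite coef_pa_vertex; case: (parrows p =P [::]) => [ap|]; last first.
    by rewrite andbF mul0r mulr0.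
  case/eqP: neq_pt; apply: qpath_inj; last by rewrite ap at_.
  by case/and3P: cpqr => /eqP ->; rewrite st.
have [ctqr|_] := boolP (pcat t q r); last by rewrite mul0r.
case/and3P: ctqr => _ /eqP tt /eqP ar.
case/eqP: neq_qr; apply: qpath_inj; last by rewrite ar at_.
by rewrite -tt /ptgt at_ st.
Qed.

Lemma coef_vertexr i f r : coef (f * pv i) r = (ptgt r == i)%:R * coef f r.
Proof.
have -> : f * pv i = pa_mul f (pv i) by [].
have [||t [st at_]] := @qpath_ex _ Q (ptgt r) [::] => //.
have crtr : pcat r t r by rewrite /pcat st at_ cats0 !eqxx.
rewrite Defs.coefM (bigD1 r) //=
  (bigD1 t) //= crtr coef_pa_vertex st at_ eqxx andbT mul1r mulrC.
rewrite big1 => [|q neq_qt].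
  rewrite addr0 big1 ?addr0 // => p neq_pr; rewrite big1 // => q _.
  have [cpqr|_] := boolP (pcat p q r); last by rewrite mul0r.
  rewrite coef_pa_vertex; case: (parrows q =P [::]) => [aq|]; last first.
    by rewrite andbF !mulr0.
  case/eqP: neq_pr; case/and3P: cpqr => /eqP sp _ /eqP ar.
  by apply: qpath_inj; rewrite // ar aq cats0.
have [crqr|_] := boolP (pcat r q r); last by rewrite mul0r.
rewrite coef_pa_vertex; case: (parrows q =P [::]) => [aq|]; last first.
  by rewrite andbF !mulr0.
case/eqP: neq_qt; apply: qpath_inj; last by rewrite aq at_.
by case/and3P: crqr => _ /eqP <-; rewrite st.
Qed.

Lemma coef_vertexlr i j f r :
  coef (pv i * f * pv j) r = ((psrc r == i) && (ptgt r == j))%:R * coef f r.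
Proof. by rewrite coef_vertexr coef_vertexl mulrA -natrM mulnb andbC. Qed.

Hypothesis acyclicQ : acyclic_quiver Q.

Definition ancestors (i : 'I_l.+1) : {set 'I_l.+1} :=
  [set c | [exists p : qpath Q, (psrc p == c) && (ptgt p == i)]].

(** Concatenation with [p] turns ancestors of its source into ancestors of its target. The target is
    its own ancestor through the trivial path, but being an ancestor of the source would close a
    cycle. Hence the number of ancestors serves as the rank [r]. *)
Lemma ancestors_proper (p : qpath Q) : psrc p != ptgt p ->
  (#|ancestors (psrc p)| < #|ancestors (ptgt p)|)%N.
Proof.
move=> np; apply/proper_card/properP.
have cat_walk (q : qpath Q) : ptgt q = psrc p ->
    walk (psrc q) (parrows q ++ parrows p) /\
    walk_end (psrc q) (parrows q ++ parrows p) = ptgt p.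
  move=> tq; rewrite walk_cat walk_end_cat -/(ptgt q) tq.
  by rewrite !walk_qpath.
split.
  apply/subsetP=> c; rewrite !inE => /existsP[q /andP[/eqP sq /eqP tq]].
  have [w we] := cat_walk q tq.
  have [u [su au]] := qpath_ex w (acyclic_walk_size acyclicQ w).
  by apply/existsP; exists u; rewrite su sq eqxx /ptgt su au we eqxx.
exists (ptgt p).
  have [||t [st at_]] := @qpath_ex _ Q (ptgt p) [::] => //.
  by rewrite inE; apply/existsP; exists t; rewrite /ptgt st at_ /= !eqxx.
rewrite inE; apply/negP=> /existsP[q /andP[/eqP sq /eqP tq]].
have [w we] := cat_walk q tq.
have /(congr1 size) := acyclicQ w (etrans we (esym sq)).
rewrite size_cat; case Ep: (parrows p) => [|a u]; last by rewrite addnS.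
by rewrite /ptgt Ep /= eqxx in np.
Qed.

Variables (R : KQ -> Prop) (A : falgType K) (pi : {lrmorphism KQ -> A}).
Hypotheses (relR : forall x, R x -> is_relation x) (presA : presents R pi).

Lemma vertex_idempotents :
  directed_idempotents (fun i => pi (pv i)) (fun i => #|ancestors i|).
Proof.
have [pi_onto pi_ker] := presA; split.
- move=> i; rewrite -rmorphM; congr (pi _); apply: coef_inj => p.
  by rewrite coef_vertexl coef_pa_vertex; case: eqP; rewrite ?mul1r ?mul0r.
- move=> i j nij; rewrite -rmorphM -[RHS](rmorph0 pi); congr (pi _).
  apply: coef_inj => p; rewrite coef_vertexl coef_pa_vertex [RHS]ffunE.
  by case: eqP => [->|_]; rewrite ?(negPf nij) ?mulr0 ?mul0r.
- rewrite -rmorph_sum -[RHS](rmorph1 pi); congr (pi _); apply: coef_inj => p.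
  rewrite [coef 1 p]ffunE /coef sum_ffunE (bigD1 (psrc p)) //= big1.
    by rewrite addr0 ffunE eqxx.
  by move=> i ni; rewrite ffunE eq_sym (negPf ni).
(* Relations involve only paths of length at least two, and multiplication does not shorten paths,
   so an element of the ideal has coefficient 0 at the trivial path [t]. *)
- move=> i; apply/eqP=> /pi_ker[m [a [x [b [Rx E]]]]].
  have [||t [st at_]] := @qpath_ex _ Q i [::] => //.
  have := congr1 (fun f : KQ => coef f t) E;
      rewrite coef_pa_vertex st at_ !eqxx /=.
  rewrite /coef sum_ffunE big1 => [/eqP|k _]; first by rewrite oner_eq0.
  rewrite -/(coef _ t); have ->
    : a k * x k * b k = pa_mul (pa_mul (a k) (x k)) (b k) by [].
  rewrite Defs.coefM big1 // => p _; rewrite big1 // => q _.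
  case: (boolP (pcat p q t)) => [/and3P[_ _ /eqP apq]|_]; last by rewrite mul0r.
  rewrite Defs.coefM big1 ?mul0r ?mulr0 // => u _; rewrite big1 // => v _.
  case: (boolP (pcat u v p)) => [/and3P[_ _ /eqP auv]|_]; last by rewrite mul0r.
  have [->|xv] := eqVneq (coef (x k) v) 0; first by rewrite !mulr0.
  have [j [j' /(_ v xv)[_ _ szv]]] := relR (Rx k).
  move: apq; rewrite at_ auv => /(congr1 size); rewrite !size_cat /=.
  by move: szv; case: (size (parrows v)) => // k' _; rewrite addnS.
- move=> i a; have [x <-] := pi_onto a.
  have [||t [st at_]] := @qpath_ex _ Q i [::] => //.
  (* By acyclicity the only path from i to i is the trivial one, so e_i x e_i retains just that
     coefficient. *)
  exists (coef x t); rewrite -!rmorphM -linearZ; congr (pi _).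
  apply: coef_inj => p; rewrite coef_vertexlr Defs.coefZ coef_pa_vertex mulrC.
  case: (psrc p =P i) => [sp|]; last by rewrite !mulr0.
  case: (ptgt p =P i) => [tp|ntp] /=.
    have ap := acyclicQ (walk_qpath p) (etrans tp (esym sp)).
    by rewrite ap eqxx (qpath_inj (etrans st (esym sp)) (etrans at_ (esym ap))).
  case: eqP => [ap|]; last by rewrite !mulr0.
  by case: ntp; rewrite /ptgt ap sp.
move=> i j a; have [x <-] := pi_onto a; rewrite -!rmorphM => nz.
(* A nonzero image needs a path from i to j in the support of [x]; that path compares the ranks. *)
have [p] : exists p, coef (pv i * x * pv j) p != 0.
  apply/existsP; apply: contraNT nz; rewrite negb_exists => /forallP c0.
  apply/eqP; rewrite -[RHS](rmorph0 pi); congr (pi _); apply: coef_inj => p.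
  by rewrite [RHS]ffunE; apply/eqP; rewrite -[_ == _]negbK.
rewrite coef_vertexlr; case: (psrc p =P i) => [<-|]; last by rewrite mul0r eqxx.
case: (ptgt p =P j) => [<-|]; last by rewrite mul0r eqxx.
move=> _; have [|np] := eqVneq (psrc p) (ptgt p); first by left.
by right; exact: ancestors_proper.
Qed.

End PathAlgebraIdempotents.

Theorem theorem1p2 (K : closedFieldType) (l : nat) (Q : quiver l)
    (acyclicQ : acyclic_quiver Q) (connectedQ : connected_quiver Q)
    (R : path_alg K Q -> Prop) (relR : forall r, R r -> is_relation r)
    (Lambda : falgType K) (pi : {lrmorphism path_alg K Q -> Lambda})
    (presLambda : presents R pi)
    (n : nat) (n_ge1 : (1 <= n)%N)
    (nRF : n_representation_finite Lambda n)
    (M : rmodule Lambda) (nCT : cluster_tilting n M) :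
  let e := fun i : 'I_l.+1 => pi (pa_vertex K Q i) in
  (forall X : rmodule Lambda, cluster_indecomposable M X ->
     positive_root (Euler_quad e) (dimvec e X)) /\
  (forall X Y : rmodule Lambda,
     cluster_indecomposable M X -> cluster_indecomposable M Y ->
     (rm_iso X Y <-> dimvec e X = dimvec e Y)).
Proof.
move=> e; have dirE := vertex_idempotents acyclicQ relR presLambda.
case: n n_ge1 nRF nCT => // m _ [gld _] nCT.
have cI X : cluster_indecomposable M X -> cluster_indec M X.
  by move=> [indX /direct_summand_in_add].
split=> [X /cI cX | X Y /cI cX /cI cY]; split.
- exact: (cluster_indec_root dirE gld nCT cX).
- by move=> i; rewrite (dimvecE dirE).
- exact: (dimvec_iso dirE).
exact: (cluster_indec_dimvec_inj dirE gld nCT cX cY).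
Qed.
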